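(* For any Poisson manifold $M$, the first secondary characteristic class and the modular class satisfy $$m_1(M)=\frac{1}{2\pi}\,\mathrm{mod}(M)\in H^1_\Pi(M).$$
   Context: $M$ is a Poisson manifold with bivector $\Pi$; $\#:T^*M\to TM$ is defined by $\beta(\#\alpha)=\Pi(\alpha,\beta)$; the bracket of 1-forms is $[\alpha,\beta]=\mathcal L_{\#\alpha}\beta-\mathcal L_{\#\beta}\alpha-d(\Pi(\alpha,\beta))$. The contravariant differential $\delta$ on multivector fields is $$\delta Q(\alpha_0,\dots,\alpha_r)=\tfrac{1}{r+1}\sum_{k}(-1)^k\#\alpha_k(Q(\alpha_0,\dots,\widehat{\alpha}_k,\dots,\alpha_r))+\tfrac1{r+1}\sum_{k<l}(-1)^{k+l}Q([\alpha_k,\alpha_l],\alpha_0,\dots,\widehat\alpha_k,\dots,\widehat\alpha_l,\dots,\alpha_r),$$ and its cohomology is the Poisson cohomology $H^*_\Pi(M)$. For a function $f$, $\delta f=\#$-differential: $\delta f(\alpha)=\#\alpha(f)$. A linear contravariant connection on $M$ is given by its contravariant derivative $D:\Omega^1(M)\times\Omega^1(M)\to\Omega^1(M)$, $(\alpha,\beta)\mapsto D_\alpha\beta$, which is $\mathbb R$-bilinear with $D_{f\alpha}\beta=fD_\alpha\beta$ and $D_\alpha(f\beta)=fD_\alpha\beta+\#\alpha(f)\beta$; it extends to all tensor fields as usual, with $D_\alpha f=\#\alpha(f)$. It is a basic connection if (i) $D_\alpha\beta|_S=[\alpha,\beta]|_S$ for every symplectic leaf $S$ and all $\alpha,\beta\in\Omega^1(M)$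 with $\#\beta|_S=0$; and (ii) $D\Pi=0$. A riemannian contravariant connection is $D^0_\alpha=\nabla_{\#\alpha}$ where $\nabla$ is a covariant linear connection with $\nabla g=0$ for some riemannian metric $g$. Let $D^1$ be a basic connection and $D^0$ a riemannian contravariant connection. Then $\alpha\mapsto\mathrm{tr}(D^1_\alpha-D^0_\alpha)$ (trace of the endomorphism of $T^*_xM$) is a vector field on $M$ which is $\delta$-closed, with Poisson cohomology class independent of the choices; the first secondary characteristic class is $$m_1(M)=\Big[\alpha\mapsto\tfrac1{2\pi}\mathrm{tr}(D^1_\alpha-D^0_\alpha)\Big]\in H^1_\Pi(M).$$ Modular class: let $\mu$ be a (smooth positive) measure on $M$ with divergence $\mathrm{div}_\mu X=\mathcal L_X\mu/\mu$. The map $f\mapsto\mathrm{div}_\mu(\#df)$ is a derivation of $C^\infty(M)$, hence a vector field $v_\mu$; it is $\delta$-closed and $\mathrm{mod}(M)=[v_\mu]\in H^1_\Pi(M)$, which is independent of $\mu$. *)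

(* Defs.v *)
From Stdlib Require Import Relation_Operators.
From HB Require Import structures.
From mathcomp Require Import all_boot all_order all_algebra.
From mathcomp Require Import all_classical all_reals all_analysis.

Set Implicit Arguments.
Unset Strict Implicit.
Unset Printing Implicit Defensive.

Import Order.TTheory GRing.Theory Num.Theory.
Import numFieldNormedType.Exports.

Local Open Scope classical_set_scope.
Local Open Scope ring_scope.

Section SmoothMaps.
Context {R : realType} {n : nat}.
Implicit Types (U : set 'rV[R]_n) (f : 'rV[R]_n -> R).

Definition partial (i : 'I_n) f (y : 'rV[R]_n) : R :=
  'D_(delta_mx 0 i : 'rV[R]_n) f y.

Fixpoint Ck (k : nat) U f : Prop :=
  match k with
  | 0 => forall y, U y -> {for y, continuous f}
  | k'.+1 => (forall y, U y -> differentiable f y) /\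
             (forall i, Ck k' U (partial i f))
  end.

Definition smooth_on U f : Prop := forall k, Ck k U f.

Definition smooth_mx_on U (m k : nat) (F : 'rV[R]_n -> 'M[R]_(m, k)) : Prop :=
  forall i j, smooth_on U (fun y => F y i j).

End SmoothMaps.

Section Manifold.
Variables (R : realType) (n : nat).

(* [cinv] is total; it is only meaningful on the image [cmap @` dom]. *)
Record chart (T : Type) := Chart {
  dom : set T;
  cmap : T -> 'rV[R]_n;
  cinv : 'rV[R]_n -> T }.

Definition cimage (T : Type) (c : chart T) : set 'rV[R]_n := cmap c @` dom c.

Definition transition (T : Type) (c c' : chart T) : 'rV[R]_n -> 'rV[R]_n :=
  cmap c' \o cinv c.

Record chart_axioms (T : topologicalType) (c : chart T) : Prop := {
  chart_open_dom : open (dom c);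
  chart_open_image : open (cimage c);
  chart_cmapK : forall p, dom c p -> cinv c (cmap c p) = p;
  chart_cmap_continuous : forall p, dom c p -> {for p, continuous (cmap c)};
  chart_cinv_continuous :
    forall y, cimage c y -> {for y, continuous (cinv c)} }.

Record smoothManifold := SmoothManifold {
  msort :> topologicalType;
  m_hausdorff : hausdorff_space msort;
  m_second_countable : second_countable (T := msort);
  atlas : set (chart msort);
  atlas_chart : forall c, atlas c -> chart_axioms c;
  atlas_cover : forall p : msort, exists c, atlas c /\ dom c p;
  atlas_compatible : forall c c', atlas c -> atlas c' ->
    smooth_mx_on (cmap c @` (dom c `&` dom c')) (transition c c') }.

End Manifold.

Section TensorFields.
Context {R : realType} {n : nat} (M : smoothManifold R n).

(* A preferred chart around each point. The tangent space at p is R^n, a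
   tangent (resp. cotangent) vector at p being given by the row vector of its
   components in the preferred chart at p, and similarly for other tensors;
   the components in any other chart are obtained by the usual
   transformation rules (vcoord, ..., below). *)
Definition chart_at (p : M) : chart R n M := sval (cid (atlas_cover p)).

(* The row-vector Jacobian of the change of coordinates from c to c':
   its (i, j) entry is d y'_j / d y_i. *)
Definition jac (c c' : chart R n M) (p : M) : 'M[R]_n :=
  jacobian (transition c c') (cmap c p).

Definition rowfield := M -> 'rV[R]_n.
Definition tensor2 := M -> 'M[R]_n.

Implicit Types (c : chart R n M) (f g : M -> R) (X Y : rowfield) (al be : rowfield).

Definition vcoord c X (y : 'rV[R]_n) : 'rV[R]_n :=
  let p := cinv c y in X p *m jac (chart_at p) c p.

Definition fcoord c al (y : 'rV[R]_n) : 'rV[R]_n :=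
  let p := cinv c y in al p *m (jac c (chart_at p) p)^T.

Definition bivcoord c (P : tensor2) (y : 'rV[R]_n) : 'M[R]_n :=
  let p := cinv c y in
  (jac (chart_at p) c p)^T *m P p *m jac (chart_at p) c p.

Definition metcoord c (G : tensor2) (y : 'rV[R]_n) : 'M[R]_n :=
  let p := cinv c y in
  jac c (chart_at p) p *m G p *m (jac c (chart_at p) p)^T.

Definition denscoord c (mu : M -> R) (y : 'rV[R]_n) : R :=
  let p := cinv c y in mu p * `|\det (jac c (chart_at p) p)|.

Definition smooth_fun f : Prop :=
  forall c, atlas c -> smooth_on (cimage c) (f \o cinv c).

Definition vector_field X : Prop :=
  forall c, atlas c -> smooth_mx_on (cimage c) (vcoord c X).

Definition one_form al : Prop :=
  forall c, atlas c -> smooth_mx_on (cimage c) (fcoord c al).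

Definition bivector_field (P : tensor2) : Prop :=
  (forall p, (P p)^T = - P p) /\
  (forall c, atlas c -> smooth_mx_on (cimage c) (bivcoord c P)).

Definition riemannian_metric (G : tensor2) : Prop :=
  [/\ forall p, (G p)^T = G p,
      forall p (v : 'rV[R]_n), v != 0 -> 0 < (v *m G p *m v^T) 0 0
    & forall c, atlas c -> smooth_mx_on (cimage c) (metcoord c G)].

(* A smooth positive measure is given by its smooth positive density with
   respect to the Lebesgue measure |dx| of charts; mu p is the value of this
   density at p in the preferred chart at p. *)
Definition smooth_positive_measure (mu : M -> R) : Prop :=
  (forall p, 0 < mu p) /\
  (forall c, atlas c -> smooth_on (cimage c) (denscoord c mu)).

Definition fscale f X : rowfield := fun p => f p *: X p.

Definition dform f : rowfield := fun p =>
  \row_i partial i (f \o cinv (chart_at p)) (cmap (chart_at p) p).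

Definition pairing al X : M -> R := fun p => (al p *m (X p)^T) 0 0.

Definition eval2 (B : tensor2) X Y : M -> R :=
  fun p => (X p *m B p *m (Y p)^T) 0 0.

Definition dir X f : M -> R := pairing (dform f) X.

(* (L_X al)_j = X^i d_i al_j + al_i d_j X^i *)
Definition lie_form X al : rowfield := fun p =>
  let c := chart_at p in let y := cmap c p in
  \row_j \sum_i (X p 0 i * partial i (fun z => fcoord c al z 0 j) y
               + al p 0 i * partial j (fun z => vcoord c X z 0 i) y).

(* L_X (rho |dx|) = d_i (rho X^i) |dx| *)
Definition lie_density X (mu : M -> R) : M -> R := fun p =>
  let c := chart_at p in
  \sum_i partial i (fun z => denscoord c mu z * vcoord c X z 0 i) (cmap c p).

Definition divergence (mu : M -> R) X : M -> R :=
  fun p => lie_density X mu p / mu p.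

End TensorFields.

Section Poisson.
Context {R : realType} {n : nat} {M : smoothManifold R n}.
Variable P : tensor2 M.
Implicit Types (f g h : M -> R) (X Y V W : rowfield M) (al be ga : rowfield M).

Definition pbracket f g : M -> R := eval2 P (dform f) (dform g).

Definition is_poisson : Prop :=
  bivector_field P /\
  forall f g h, smooth_fun f -> smooth_fun g -> smooth_fun h ->
    pbracket f (pbracket g h) + pbracket g (pbracket h f)
      + pbracket h (pbracket f g) = 0.

Definition sharp al : rowfield M := fun p => al p *m P p.

Definition form_bracket al be : rowfield M :=
  lie_form (sharp al) be - lie_form (sharp be) al - dform (eval2 P al be).

(* An r-vector field is viewed as a function of lists of r 1-forms; its values
   on lists of another length are irrelevant. *)
Definition multivector := seq (rowfield M) -> M -> R.

Definition mv_fun f : multivector := fun _ => f.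
Definition mv_vector V : multivector := fun s => pairing (nth 0 s 0) V.

Definition omit (k : nat) (s : seq (rowfield M)) : seq (rowfield M) :=
  take k s ++ drop k.+1 s.

Definition delta (Q : multivector) : multivector := fun s x =>
  (size s)%:R^-1 *
    (\sum_(k < size s)
        (-1) ^+ k * dir (sharp (nth 0 s k)) (Q (omit k s)) x)
  + (size s)%:R^-1 *
    (\sum_(k < size s) \sum_(l < size s | (k < l)%N)
        (-1) ^+ (k + l) *
        Q (form_bracket (nth 0 s k) (nth 0 s l) :: omit k (omit l s)) x).

Definition delta_closed V : Prop :=
  forall al0 al1, one_form al0 -> one_form al1 ->
    delta (mv_vector V) [:: al0; al1] = 0.

(* Classes in H^1 = ker (delta on vector fields) / delta (C^oo(M)), as cosets *)
Definition H1_class V : set (rowfield M) :=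
  [set W | [/\ vector_field W, delta_closed W
             & exists2 f, smooth_fun f & forall al, one_form al ->
                 mv_vector W [:: al]
                   = mv_vector V [:: al] + delta (mv_fun f) [:: al]]].

(* Meaningful as the scaling of H^1 for a != 0. *)
Definition H1_scale (a : R) (C : set (rowfield M)) : set (rowfield M) :=
  [set a *: V | V in C].

(* The symplectic leaf of x is the set of points joined to x by finitely many
   arcs of integral curves of hamiltonian vector fields. The velocity of a curve
   at time t is read in the preferred chart at gamma t. *)

Definition integral_curve X (a b : R) (gamma : R -> M) : Prop :=
  forall t, a < t < b ->
    {for t, continuous gamma} /\
    is_derive t 1 (cmap (chart_at (gamma t)) \o gamma) (X (gamma t)).

Definition hamiltonian_arc (x y : M) : Prop :=
  exists f a b gamma s t,
    [/\ smooth_fun f, integral_curve (sharp (dform f)) a b gamma,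
        a < s < b, a < t < b & gamma s = x /\ gamma t = y].

Definition symplectic_leaf (S : set M) : Prop :=
  exists x, S = [set y | clos_refl_trans M hamiltonian_arc x y].

Definition form_operator := rowfield M -> rowfield M -> rowfield M.

Record contravariant_connection (D : form_operator) : Prop := {
  contra_form : forall al be, one_form al -> one_form be -> one_form (D al be);
  contra_linear_l : forall (a : R) al al' be,
    one_form al -> one_form al' -> one_form be ->
    D (a *: al + al') be = a *: D al be + D al' be;
  contra_linear_r : forall (a : R) al be be',
    one_form al -> one_form be -> one_form be' ->
    D al (a *: be + be') = a *: D al be + D al be';
  contra_tensorial : forall f al be,
    smooth_fun f -> one_form al -> one_form be ->
    D (fscale f al) be = fscale f (D al be);
  contra_leibniz : forall f al be,
    smooth_fun f -> one_form al -> one_form be ->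
    D al (fscale f be) = fscale f (D al be) + fscale (dir (sharp al) f) be }.

(* (D_al B)(be, ga) for the extension of D to a bivector field B *)
Definition contra_bivector (D : form_operator) al (B : tensor2 M) be ga :
    M -> R :=
  dir (sharp al) (eval2 B be ga) - eval2 B (D al be) ga - eval2 B be (D al ga).

(* [basic_leaf] compares sections of the restriction of T^*M to S (1-forms are
   not pulled back to T^*S). *)
Record basic_connection (D : form_operator) : Prop := {
  basic_contravariant : contravariant_connection D;
  basic_leaf : forall S, symplectic_leaf S ->
    forall al be, one_form al -> one_form be ->
    (forall x, S x -> sharp be x = 0) ->
    forall x, S x -> D al be x = form_bracket al be x;
  basic_poisson : forall al be ga,
    one_form al -> one_form be -> one_form ga ->
    contra_bivector D al P be ga = 0 }.

Record covariant_connection (N : rowfield M -> rowfield M -> rowfield M) : Prop := {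
  cov_field : forall X Y, vector_field X -> vector_field Y ->
    vector_field (N X Y);
  cov_linear_l : forall (a : R) X X' Y,
    vector_field X -> vector_field X' -> vector_field Y ->
    N (a *: X + X') Y = a *: N X Y + N X' Y;
  cov_linear_r : forall (a : R) X Y Y',
    vector_field X -> vector_field Y -> vector_field Y' ->
    N X (a *: Y + Y') = a *: N X Y + N X Y';
  cov_tensorial : forall f X Y,
    smooth_fun f -> vector_field X -> vector_field Y ->
    N (fscale f X) Y = fscale f (N X Y);
  cov_leibniz : forall f X Y,
    smooth_fun f -> vector_field X -> vector_field Y ->
    N X (fscale f Y) = fscale f (N X Y) + fscale (dir X f) Y }.

Definition metric_connection (G : tensor2 M)
    (N : rowfield M -> rowfield M -> rowfield M) : Prop :=
  forall X Y Z, vector_field X -> vector_field Y -> vector_field Z ->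
    dir X (eval2 G Y Z) = eval2 G (N X Y) Z + eval2 G Y (N X Z).

(* D_al = N_(# al), where N acts on 1-forms by duality:
   (N_X be)(Y) = X (be(Y)) - be(N_X Y). *)
Definition riemannian_connection (D : form_operator) : Prop :=
  contravariant_connection D /\
  exists G N,
    [/\ riemannian_metric G, covariant_connection N, metric_connection G N
      & forall al be Y, one_form al -> one_form be -> vector_field Y ->
          pairing (D al be) Y
            = dir (sharp al) (pairing be Y) - pairing be (N (sharp al) Y)].

(* E is the endomorphism of the cotangent space at x (acting on row vectors on
   the right) induced by the tensorial operator A on 1-forms. *)
Definition induces_at (A : rowfield M -> rowfield M) (x : M) (E : 'M[R]_n) : Prop :=
  forall be, one_form be -> A be x = be x *m E.

Definition first_class_field (D1 D0 : form_operator) V : Prop :=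
  vector_field V /\
  forall al, one_form al -> forall x,
    exists2 E, induces_at (fun be => D1 al be - D0 al be) x E
             & pairing al V x = (2 * pi)^-1 * \tr E.

Definition modular_field (mu : M -> R) V : Prop :=
  vector_field V /\
  forall f, smooth_fun f -> dir V f = divergence mu (sharp (dform f)).

(* C is the class m_1(M), resp. mod(M), computed from the given choices; that
   the representing field exists and is delta-closed is part of the
   assertion. *)
Definition first_secondary_class (D1 D0 : form_operator) (C : set (rowfield M)) :
    Prop :=
  exists V, [/\ first_class_field D1 D0 V, delta_closed V & C = H1_class V].

Definition modular_class (mu : M -> R) (C : set (rowfield M)) : Prop :=
  exists V, [/\ modular_field mu V, delta_closed V & C = H1_class V].

End Poisson.

(* Main.v *)
(** For a function f with hamiltonian vector field X_f, the operator D1_df and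
    the Lie derivative along X_f agree on the conormal covectors of the leaf
    through x and both preserve Pi. Their difference A at x therefore vanishes
    on the kernel of # and satisfies A Pi + Pi A^T = 0, which forces tr A = 0:
    in coordinates, tr D1_df = d_i X_f^i. For the riemannian connection,
    tr D0_alpha = - #alpha (log sqrt (det g)). Hence alpha |-> tr (D1_alpha -
    D0_alpha) is exactly the modular vector field of the riemannian density,
    and replacing this density by mu changes it by delta of the logarithm of
    their ratio.

    Condition (i) on D1 only concerns 1-forms annihilated by # along a whole
    leaf, so covectors in the kernel of #_x have to be extended to such forms.
    If L selects r = rank Pi_x rows such that L Pi_x L^T is invertible, put
    K = L^T (L Pi L^T)^-1 L near x. Then v (1 - Pi K) is annihilated by #
    wherever Pi has rank r, and this happens along the whole leaf: the Schur
    complement Pi - Pi K Pi solves a linear differential equation along each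
    integral curve of a hamiltonian vector field, so it stays zero. *)

(* The operators [D1] and [D0] act on global 1-forms, and the Jacobi identity is given for global
   functions, whereas traces and divergences are computed in charts. Cutoffs bridge this gap:
   coordinates, their differentials and the coordinate fields are multiplied by bump functions, and
   an operator with a Leibniz rule is then determined at [x] by its values on the cut-off coframe.
   Since [D_alpha] at [x] depends on [alpha] at [x] only, [alpha] may be replaced there by some
   [df]; this is why it is enough to know [D1] along hamiltonian fields.

   The riemannian density comes before [mu] because with it the field of [m_1] is [1/(2 pi)] times a
   modular field on the nose, not just up to a coboundary. Its smoothness and closedness are then
   instances of facts about modular fields of arbitrary densities, and no curvature has to be
   computed. The passage to [mu] takes place entirely between two modular fields. *)
Require Import Defs.
From Stdlib Require Import Relation_Operators.
From mathcomp Require Import all_boot all_order all_algebra.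
From mathcomp Require Import all_classical all_reals all_analysis.
From mathcomp Require Import ring lra.

Set Implicit Arguments.
Unset Strict Implicit.
Unset Printing Implicit Defensive.

Import Order.TTheory GRing.Theory Num.Theory.
Import numFieldNormedType.Exports.

Local Open Scope classical_set_scope.
Local Open Scope ring_scope.

(** * Differential calculus *)

Section Extensionality.
Context {R : realType} {V : normedModType R}.

Lemma eq_differentiable (W : normedModType R) (f g : V -> W) (y : V) :
  f =1 g -> differentiable g y -> differentiable f y.
Proof. by move=> /funext ->. Qed.

Lemma eq_derive (W : normedModType R) (f g : V -> W) (u y : V) :
  f =1 g -> 'D_u f y = 'D_u g y.
Proof. by move=> /funext ->. Qed.

End Extensionality.

Ltac diff_under tac := eapply eq_differentiable; [by move=> ?; cbv beta; tac; reflexivity|].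
Ltac derive_under tac := etransitivity; [by apply: eq_derive => ?; cbv beta; tac; reflexivity|].

Section Differentials.
Context {R : realType} {V : normedModType R}.

(** The difference [g - f] vanishes near [y], so the little-o characterisation gives it the
    differential [0]; adding it to [f] yields [g]. *)
Lemma near_eq_differentiable (W : normedModType R) (f g : V -> W) (y : V) :
  {near y, f =1 g} -> differentiable f y -> differentiable g y.
Proof.
move=> fg df; pose h : V -> W := g - f.
have h0 : \forall z \near (0 : V), h (z + y) = 0.
  move: fg; rewrite (near_shift 0) => fg'.
  apply: filterS fg' => z; rewrite [((_ : set V) \o _) z]/= subr0 => fgz.
  by rewrite /h -[(g - f) _]/(g _ - f _) fgz subrr.
have hy : h y = 0 by have := nbhs_singleton h0; rewrite add0r.
have c0 : continuous (0 : V -> W) by exact: cst_continuous.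
have e0 : h \o shift y = cst (h y) + \0 +o_ 0 id.
  apply/eqaddoE; rewrite addr0 funeqE => z /=; rewrite hy add0r.
  rewrite littleoE // => e e0.
  by apply: filterS h0 => t /= ->; rewrite normr0 mulr_ge0 // ltW.
have dh : differentiable h y.
  by apply/diff_locallyP; rewrite (diff_unique c0 e0).
have -> : g = f + h by rewrite /h addrC subrK.
exact: differentiableD.
Qed.

Lemma differentiable_big (I : Type) (s : seq I) (p : pred I) (f : I -> V -> R) y :
  (forall i, p i -> differentiable (f i) y) ->
  differentiable (fun z => \sum_(i <- s | p i) f i z) y.
Proof.
move=> df.
have -> : (fun z => \sum_(i <- s | p i) f i z) = \sum_(i <- s | p i) f i.
  by apply/funext => z; rewrite fct_sumE.
elim/big_ind : _ => //.
by move=> ? ? ? ?; exact: differentiableD.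
Qed.

Lemma derive_big (I : Type) (s : seq I) (p : pred I) (f : I -> V -> R) u y :
  (forall i, p i -> differentiable (f i) y) ->
  'D_u (fun z => \sum_(i <- s | p i) f i z) y = \sum_(i <- s | p i) 'D_u (f i) y.
Proof.
move=> df.
have -> : (fun z => \sum_(i <- s | p i) f i z) = \sum_(i <- s | p i) f i.
  by apply/funext => z; rewrite fct_sumE.
elim: s => [|i s IH]; first by rewrite !big_nil derive_cst.
rewrite !big_cons; case: ifP => // pi; rewrite deriveD ?IH //.
  exact/diff_derivable/df.
apply/diff_derivable; elim/big_ind : _ => //.
by move=> ? ? ? ?; exact: differentiableD.
Qed.

Lemma differentiable_mul (f g : V -> R) y :
  differentiable f y -> differentiable g y -> differentiable (fun z => f z * g z) y.
Proof. exact: differentiableM. Qed.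

Lemma derive_mul (f g : V -> R) u y :
  differentiable f y -> differentiable g y ->
  'D_u (fun z => f z * g z) y = f y * 'D_u g y + g y * 'D_u f y.
Proof. by move=> df dg; rewrite [LHS]deriveM //; exact: diff_derivable. Qed.

Lemma differentiable_bigprod (I : Type) (s : seq I) (p : pred I) (f : I -> V -> R) y :
  (forall i, p i -> differentiable (f i) y) ->
  differentiable (fun z => \prod_(i <- s | p i) f i z) y.
Proof.
move=> df; elim: s => [|i s IH].
  diff_under ltac:(rewrite big_nil).
  exact: differentiable_cst.
diff_under ltac:(rewrite big_cons).
by case pi : (p i) => //; apply: differentiable_mul => //; exact: df.
Qed.

(** The factor being differentiated is removed by the test [j != i], which removes exactly one
    factor only when the list has no repetition; hence [uniq s]. *)
Lemma derive_bigprod (I : eqType) (s : seq I) (f : I -> V -> R) u y :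
  uniq s -> (forall i, differentiable (f i) y) ->
  'D_u (fun z => \prod_(i <- s) f i z) y =
    \sum_(i <- s) 'D_u (f i) y * \prod_(j <- s | j != i) f j y.
Proof.
move=> + df; elim: s => [_|i s IH /= /andP[is_ us]].
  derive_under ltac:(rewrite big_nil).
  by rewrite big_nil derive_cst.
derive_under ltac:(rewrite big_cons).
rewrite derive_mul //; last exact: differentiable_bigprod.
rewrite IH // !big_cons eqxx /= addrC mulrC; congr (_ * _ + _).
  rewrite [RHS]big_seq_cond [LHS]big_seq_cond; apply: eq_bigl => j.
  by rewrite andbT; case: (boolP (j \in s)) => //= js; apply/esym/eqP => ji; rewrite -ji js in is_.
rewrite mulr_sumr [LHS]big_seq_cond [RHS]big_seq_cond; apply: eq_bigr => j /andP[js _].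
rewrite big_cons; case: eqVneq => [ij|_]; first by rewrite ij js in is_.
by rewrite mulrCA.
Qed.

End Differentials.

(** * Derivatives of matrix-valued maps and of determinants *)

Section MatrixDerivative.
Context {R : realType} {V : normedModType R}.

(** Entrywise, because tensor fields are smooth component by component; [dmxE] identifies it with
    the derivative in the space of matrices. *)
Definition dmx (m k : nat) (u : V) (F : V -> 'M[R]_(m, k)) (y : V) : 'M[R]_(m, k) :=
  \matrix_(i, j) 'D_u (fun z => F z i j) y.

Definition mdiff (m k : nat) (F : V -> 'M[R]_(m, k)) (y : V) : Prop :=
  forall i j, differentiable (fun z => F z i j) y.

Lemma near_eq_dmx m k u (F G : V -> 'M[R]_(m, k)) y :
  {near y, F =1 G} -> dmx u F y = dmx u G y.
Proof.
move=> FG; apply/matrixP => i j; rewrite !mxE; apply: near_eq_derive.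
by apply: filterS FG => z ->.
Qed.

Lemma near_eq_mdiff m k (F G : V -> 'M[R]_(m, k)) y :
  {near y, F =1 G} -> mdiff F y -> mdiff G y.
Proof.
move=> FG dF i j; apply: near_eq_differentiable (dF i j).
by apply: filterS FG => z ->.
Qed.

Lemma mdiff_cst m k (A : 'M[R]_(m, k)) y : mdiff (fun=> A) y.
Proof. by move=> i j; exact: differentiable_cst. Qed.

Lemma dmx_cst m k u (A : 'M[R]_(m, k)) y : dmx u (fun=> A) y = 0.
Proof. by apply/matrixP => i j; rewrite !mxE derive_cst. Qed.

Lemma mdiffM m k l (F : V -> 'M[R]_(m, k)) (G : V -> 'M[R]_(k, l)) y :
  mdiff F y -> mdiff G y -> mdiff (fun z => F z *m G z) y.
Proof.
move=> dF dG i j; diff_under ltac:(rewrite mxE).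
by apply: differentiable_big => t _; exact: differentiable_mul.
Qed.

Lemma dmxM m k l u (F : V -> 'M[R]_(m, k)) (G : V -> 'M[R]_(k, l)) y :
  mdiff F y -> mdiff G y ->
  dmx u (fun z => F z *m G z) y = dmx u F y *m G y + F y *m dmx u G y.
Proof.
move=> dF dG; apply/matrixP => i j; rewrite !mxE.
derive_under ltac:(rewrite mxE).
rewrite derive_big -?big_split /=; last by move=> t _; exact: differentiable_mul.
by apply: eq_bigr => t _; rewrite derive_mul // !mxE addrC; congr (_ + _); rewrite mulrC.
Qed.

Lemma dmxD m k u (F G : V -> 'M[R]_(m, k)) y : mdiff F y -> mdiff G y ->
  dmx u (fun z => F z + G z) y = dmx u F y + dmx u G y.
Proof.
move=> dF dG; apply/matrixP => i j; rewrite !mxE.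
derive_under ltac:(rewrite mxE).
by rewrite [LHS]deriveD //; exact: diff_derivable.
Qed.

Lemma mdiffN m k (F : V -> 'M[R]_(m, k)) y : mdiff F y -> mdiff (fun z => - F z) y.
Proof.
move=> dF i j; diff_under ltac:(rewrite mxE).
exact: (differentiableN (dF i j)).
Qed.

Lemma dmxN m k u (F : V -> 'M[R]_(m, k)) y : mdiff F y ->
  dmx u (fun z => - F z) y = - dmx u F y.
Proof.
move=> dF; apply/matrixP => i j; rewrite !mxE.
derive_under ltac:(rewrite mxE).
by rewrite [LHS]deriveN //; exact: diff_derivable.
Qed.

Lemma dmxB m k u (F G : V -> 'M[R]_(m, k)) y : mdiff F y -> mdiff G y ->
  dmx u (fun z => F z - G z) y = dmx u F y - dmx u G y.
Proof. by move=> dF dG; rewrite dmxD ?dmxN //; exact: mdiffN. Qed.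

Lemma mdiff_tr m k (F : V -> 'M[R]_(m, k)) y : mdiff F y -> mdiff (fun z => (F z)^T) y.
Proof. by move=> dF i j; diff_under ltac:(rewrite mxE); exact: dF. Qed.

Lemma dmx_tr m k u (F : V -> 'M[R]_(m, k)) y : dmx u (fun z => (F z)^T) y = (dmx u F y)^T.
Proof.
apply/matrixP => i j; rewrite !mxE.
by derive_under ltac:(rewrite mxE).
Qed.

Lemma derive_tr m u (F : V -> 'M[R]_m) y : mdiff F y ->
  'D_u (fun z => \tr (F z)) y = \tr (dmx u F y).
Proof.
by move=> dF; rewrite derive_big //; apply: eq_bigr => i _; rewrite mxE.
Qed.

Lemma mdiff_differentiable m k (F : V -> 'M[R]_(m, k)) y : mdiff F y -> differentiable F y.
Proof.
move=> dF.
have -> : F = \sum_(ij : 'I_m * 'I_k) (fun z => F z ij.1 ij.2 *: delta_mx ij.1 ij.2).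
  apply/funext => z; rewrite fct_sumE [LHS]matrix_sum_delta pair_bigA /=.
  exact: eq_bigr.
apply: (big_ind (fun g : V -> 'M[R]_(m, k) => differentiable g y)).
- exact: (@differentiable_cst _ _ _ (0 : 'M[R]_(m, k))).
- by move=> g h dg dh; exact: (differentiableD dg dh).
- by move=> ij _; exact: (differentiableZl (delta_mx ij.1 ij.2) (dF ij.1 ij.2)).
Qed.

Lemma dmxE m k u (F : V -> 'M[R]_(m, k)) y : mdiff F y -> dmx u F y = 'D_u F y.
Proof.
by move=> dF; rewrite derive_mx //; exact/diff_derivable/mdiff_differentiable.
Qed.

Lemma differentiable_det m (F : V -> 'M[R]_m) y : mdiff F y ->
  differentiable (fun z => \det (F z)) y.
Proof.
move=> dF; apply: differentiable_big => s _; apply: differentiable_mul.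
  exact: differentiable_cst.
exact: differentiable_bigprod.
Qed.

(** Jacobi's formula. Differentiating the Leibniz expansion gives one determinant for each row, with
    that row differentiated; cofactor expansion along this row produces the adjugate. *)
Lemma derive_det m u (F : V -> 'M[R]_m) y : mdiff F y ->
  'D_u (fun z => \det (F z)) y = \tr (dmx u F y *m \adj (F y)).
Proof.
move=> dF; rewrite derive_big; last first.
  move=> s _; apply: differentiable_mul; first exact: differentiable_cst.
  exact: differentiable_bigprod.
have -> : \tr (dmx u F y *m \adj (F y)) =
    \sum_i \det (\matrix_(j, k) if j == i then dmx u F y j k else F y j k).
  apply: eq_bigr => i _; rewrite mxE (expand_det_row _ i); apply: eq_bigr => k _.
  rewrite [in RHS]mxE eqxx !mxE; congr (_ * (_ * \det _)).
  apply/matrixP => a b; rewrite !mxE.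
  by case: eqP => // /esym/eqP; rewrite (negbTE (neq_lift _ _)).
rewrite exchange_big /=; apply: eq_bigr => s _.
rewrite derive_mul ?derive_cst ?mulr0 ?addr0; last 2 first.
- exact: differentiable_cst.
- exact: differentiable_bigprod.
rewrite -mulr_sumr; congr (_ * _).
rewrite derive_bigprod ?index_enum_uniq //; apply: eq_bigr => i _.
rewrite [RHS](bigD1 i) //= !mxE eqxx; congr (_ * _).
by apply: eq_bigr => j /negPf ji; rewrite mxE ji.
Qed.

End MatrixDerivative.

(** * Chain rule and jacobians *)

Section ChainRule.
Context {R : realType} {V : normedModType R} {n : nat}.

Lemma differentiable_mdiff_comp (T : V -> 'rV[R]_n) (f : 'rV[R]_n -> R) y :
  mdiff T y -> differentiable f (T y) -> differentiable (fun z => f (T z)) y.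
Proof. by move=> /mdiff_differentiable dT df; exact: differentiable_comp. Qed.

Lemma derive_comp (T : V -> 'rV[R]_n) (f : 'rV[R]_n -> R) u y :
  mdiff T y -> differentiable f (T y) ->
  'D_u (fun z => f (T z)) y = 'D_(dmx u T y) f (T y).
Proof.
move=> mT df; have dT := mdiff_differentiable mT.
rewrite deriveE; last exact: differentiable_comp.
by rewrite (diff_comp dT df) /= -deriveE // -deriveE // dmxE.
Qed.

Lemma mdiff_comp m k (T : V -> 'rV[R]_n) (F : 'rV[R]_n -> 'M[R]_(m, k)) y :
  mdiff T y -> mdiff F (T y) -> mdiff (fun z => F (T z)) y.
Proof. by move=> mT mF i j; exact: (differentiable_mdiff_comp mT (mF i j)). Qed.

Lemma dmx_comp m k (T : V -> 'rV[R]_n) (F : 'rV[R]_n -> 'M[R]_(m, k)) u y :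
  mdiff T y -> mdiff F (T y) -> dmx u (fun z => F (T z)) y = dmx (dmx u T y) F (T y).
Proof.
move=> mT mF; apply/matrixP => i j; rewrite !mxE.
by rewrite (derive_comp u mT (mF i j)).
Qed.

Lemma derive_partial (f : 'rV[R]_n -> R) (v y : 'rV[R]_n) : differentiable f y ->
  'D_v f y = \sum_i v 0 i * partial i f y.
Proof.
move=> df; rewrite deriveE // {1}(row_sum_delta v) raddf_sum.
by apply: eq_bigr => i _; rewrite /= linearZ /= /partial deriveE.
Qed.

Lemma jacobian_dmx m (T : 'rV[R]_n -> 'rV[R]_m) y v : mdiff T y ->
  v *m jacobian T y = dmx v T y.
Proof.
by move=> mT; rewrite dmxE // deriveEjacobian //; exact: mdiff_differentiable.
Qed.

Lemma jacobianE m (T : 'rV[R]_n -> 'rV[R]_m) y i j : mdiff T y ->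
  jacobian T y i j = partial i (fun z => T z 0 j) y.
Proof.
move=> mT; have := jacobian_dmx (delta_mx 0 i) mT.
by rewrite -rowE => /rowP/(_ j); rewrite !mxE => ->.
Qed.

End ChainRule.

(** * Locality and closure properties of smooth functions *)

Section SmoothCalculus.
Context {R : realType} {n : nat}.
Implicit Types (U W : set 'rV[R]_n) (f g : 'rV[R]_n -> R).

Lemma open_near_eq (X : topologicalType) (Y : Type) (U : set X) (f g : X -> Y) y :
  open U -> U y -> (forall z, U z -> f z = g z) -> {near y, f =1 g}.
Proof.
move=> oU Uy fg; have : nbhs y U by exact: open_nbhs_nbhs.
by apply: filterS.
Qed.

Lemma partial_eq_on U i f g y : open U -> (forall z, U z -> f z = g z) ->
  U y -> partial i f y = partial i g y.
Proof. by move=> oU fg Uy; apply: near_eq_derive; exact: (open_near_eq oU Uy fg). Qed.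

Lemma Ck_eq k U f g : open U -> (forall z, U z -> f z = g z) ->
  Ck k U f -> Ck k U g.
Proof.
move=> oU; elim: k f g => [|k IH] f g fg /=.
  move=> cf y Uy; have nfg := open_near_eq oU Uy fg.
  rewrite /prop_for /continuous_at -(fg _ Uy).
  exact: cvg_trans (@near_eq_cvg _ _ (nbhs y) _ f g nfg) (cf y Uy).
case=> df pf; split=> [y Uy|i].
  exact: near_eq_differentiable (open_near_eq oU Uy fg) (df y Uy).
by apply: (IH (partial i f)) => // z; exact: partial_eq_on.
Qed.

Lemma CkW k U f : Ck k.+1 U f -> Ck k U f.
Proof.
elim: k f => [|k IH] f [df pf].
  by move=> y Uy; apply: differentiable_continuous; exact: df.
by split=> // i; apply: IH; exact: pf.
Qed.

Lemma Ck_sub k U W f : W `<=` U -> Ck k U f -> Ck k W f.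
Proof.
move=> WU; elim: k f => [|k IH] f /=; first by move=> cf y /WU; exact: cf.
by case=> df pf; split=> [y /WU|i]; [exact: df|exact: IH].
Qed.

Lemma Ck_local k U f :
  (forall y, U y -> exists2 W, W y & Ck k W f) -> Ck k U f.
Proof.
elim: k f => [|k IH] f Wf /=; first by move=> y Uy; have [W Wy cf] := Wf y Uy; exact: (cf y Wy).
split=> [y Uy|i]; first by have [W Wy [df _]] := Wf y Uy; exact: (df y Wy).
by apply: IH => y Uy; have [W Wy [_ pf]] := Wf y Uy; exists W => //; exact: pf.
Qed.

Lemma smooth_on_eq U f g : open U -> (forall z, U z -> f z = g z) ->
  smooth_on U f -> smooth_on U g.
Proof. by move=> oU fg sf k; exact: Ck_eq (sf k). Qed.

Lemma smooth_on_sub U W f : W `<=` U -> smooth_on U f -> smooth_on W f.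
Proof. by move=> WU sf k; exact: Ck_sub (sf k). Qed.

Lemma smooth_on_local U f :
  (forall y, U y -> exists2 W, W y & smooth_on W f) -> smooth_on U f.
Proof. by move=> Wf k; apply: Ck_local => y Uy; have [W Wy sf] := Wf y Uy; exists W => //; exact: sf. Qed.

Lemma smooth_differentiable U f y : smooth_on U f -> U y -> differentiable f y.
Proof. by move=> sf Uy; have [df _] := sf 1%N; exact: (df y Uy). Qed.

Lemma smooth_partial U f i : smooth_on U f -> smooth_on U (partial i f).
Proof. by move=> sf k; have [_ pf] := sf k.+1; exact: (pf i). Qed.

Lemma smooth_on_cst U (a : R) : smooth_on U (fun=> a).
Proof.
move=> k; elim: k a => [|k IH] a /=; first by move=> y _; exact: cst_continuous.
split=> [y _|i]; first exact: differentiable_cst.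
suff -> : partial i (fun=> a) = (fun=> 0) by [].
by apply/funext => y; rewrite /partial derive_cst.
Qed.

Lemma CkD k U f g : open U -> Ck k U f -> Ck k U g -> Ck k U (fun y => f y + g y).
Proof.
move=> oU; elim: k f g => [|k IH] f g /=.
  by move=> cf cg y Uy; apply: continuousD; [exact: cf|exact: cg].
case=> df pf [dg pg]; split=> [y Uy|i].
  by apply: (differentiableD (df y Uy) (dg y Uy)).
apply: (@Ck_eq _ _ (fun y => partial i f y + partial i g y)) => // [z Uz|].
  by apply/esym; apply: deriveD; apply: diff_derivable; [exact: df|exact: dg].
exact: (IH _ _ (pf i) (pg i)).
Qed.

Lemma CkM k U f g : open U -> Ck k U f -> Ck k U g -> Ck k U (fun y => f y * g y).
Proof.
move=> oU; elim: k f g => [|k IH] f g.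
  by move=> cf cg y Uy; apply: continuousM; [exact: cf|exact: cg].
move=> cf cg; have [[df pf] [dg pg]] := (cf, cg); split=> [y Uy|i].
  by apply: differentiable_mul; [exact: df|exact: dg].
apply: (@Ck_eq _ _ (fun y => f y * partial i g y + g y * partial i f y)) => // [z Uz|].
  by apply/esym; apply: derive_mul; [exact: df|exact: dg].
apply: (CkD oU); [apply: (IH _ _ (CkW cf) (pg i))|apply: (IH _ _ (CkW cg) (pf i))].
Qed.

Lemma smooth_onD U f g : open U -> smooth_on U f -> smooth_on U g ->
  smooth_on U (fun y => f y + g y).
Proof. by move=> oU sf sg k; exact: CkD. Qed.

Lemma smooth_onM U f g : open U -> smooth_on U f -> smooth_on U g ->
  smooth_on U (fun y => f y * g y).
Proof. by move=> oU sf sg k; exact: CkM. Qed.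

Lemma smooth_onN U f : open U -> smooth_on U f -> smooth_on U (fun y => - f y).
Proof.
move=> oU sf; apply: (@smooth_on_eq _ (fun y => (-1) * f y)) => //.
  by move=> z _; rewrite mulN1r.
by apply: smooth_onM => //; exact: smooth_on_cst.
Qed.

Lemma smooth_on_sum U (I : Type) (s : seq I) (p : pred I) (f : I -> 'rV[R]_n -> R) :
  open U -> (forall i, p i -> smooth_on U (f i)) ->
  smooth_on U (fun y => \sum_(i <- s | p i) f i y).
Proof.
move=> oU sf; elim: s => [|i s IH].
  by apply: (smooth_on_eq oU _ (smooth_on_cst U 0)) => z _; rewrite big_nil.
apply: (@smooth_on_eq _ (fun y => (if p i then f i y else 0) + \sum_(i <- s | p i) f i y)) => //.
  by move=> z _; rewrite big_cons; case: ifP => // _; rewrite add0r.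
apply: smooth_onD => //; case pi : (p i); [exact: sf|exact: smooth_on_cst].
Qed.

Lemma smooth_on_prod U (I : Type) (s : seq I) (p : pred I) (f : I -> 'rV[R]_n -> R) :
  open U -> (forall i, p i -> smooth_on U (f i)) ->
  smooth_on U (fun y => \prod_(i <- s | p i) f i y).
Proof.
move=> oU sf; elim: s => [|i s IH].
  by apply: (smooth_on_eq oU _ (smooth_on_cst U 1)) => z _; rewrite big_nil.
apply: (@smooth_on_eq _ (fun y => (if p i then f i y else 1) * \prod_(i <- s | p i) f i y)) => //.
  by move=> z _; rewrite big_cons; case: ifP => // _; rewrite mul1r.
apply: smooth_onM => //; case pi : (p i); [exact: sf|exact: smooth_on_cst].
Qed.

Lemma partial_coord (i j : 'I_n) (y : 'rV[R]_n) :
  partial j (fun z => z 0 i) y = (i == j)%:R.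
Proof.
transitivity (dmx (delta_mx 0 j) id y 0 i); first by rewrite mxE.
rewrite dmxE; last by move=> a b; exact: differentiable_coord.
by rewrite derive_id mxE eqxx.
Qed.

Lemma derive_coord (i : 'I_n) (v y : 'rV[R]_n) : 'D_v (fun z : 'rV[R]_n => z 0 i) y = v 0 i.
Proof.
rewrite derive_partial; last exact: differentiable_coord.
rewrite (bigD1 i) //= partial_coord eqxx mulr1 big1 ?addr0 // => j /negPf ji.
by rewrite partial_coord eq_sym ji mulr0.
Qed.

Lemma smooth_on_coord U (i : 'I_n) : smooth_on U (fun y => y 0 i).
Proof.
case=> [|k] /=; first by move=> y _; exact: coord_continuous.
split=> [y _|j]; first exact: differentiable_coord.
have -> : partial j (fun y : 'rV[R]_n => y 0 i) = (fun=> (i == j)%:R).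
  by apply/funext => y; exact: partial_coord.
exact: smooth_on_cst.
Qed.

Lemma smooth_onV U f : open U -> (forall y, U y -> f y != 0) ->
  smooth_on U f -> smooth_on U (fun y => (f y)^-1).
Proof.
move=> oU f0 sf; have df y : U y -> differentiable (fun y => (f y)^-1) y.
  by move=> Uy; apply: differentiableV; [exact: smooth_differentiable sf Uy|exact: f0].
elim=> [|k IH] /=.
  by move=> y Uy; apply: differentiable_continuous; exact: df.
(* The derivative is a product of copies of [1/f] and a partial derivative of [f], so the induction
   hypothesis on [1/f] itself suffices. *)
split=> // i; apply: (@Ck_eq _ _ (fun y => - ((f y)^-1 * (f y)^-1) * partial i f y)) => //.
  move=> z Uz; rewrite [RHS]deriveV ?f0 //; last first.
    exact/diff_derivable/(smooth_differentiable sf Uz).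
  by rewrite expr2 invfM.
apply: CkM => //; last by have [_ pf] := sf k.+1; exact: pf.
apply: (@Ck_eq _ _ (fun y => (-1) * ((f y)^-1 * (f y)^-1))) => //.
  by move=> z _; rewrite mulN1r.
by do ?apply: CkM => //; exact: smooth_on_cst.
Qed.

End SmoothCalculus.

(** * Smoothness of compositions, logarithms and square roots *)

Section SmoothComposition.
Context {R : realType} {n : nat}.
Implicit Types (U : set 'rV[R]_n) (f : 'rV[R]_n -> R).

Lemma smooth_on_comp m U (W : set 'rV[R]_m) (T : 'rV[R]_n -> 'rV[R]_m)
    (f : 'rV[R]_m -> R) :
  open U -> (forall y, U y -> W (T y)) ->
  (forall j, smooth_on U (fun y => T y 0 j)) -> smooth_on W f ->
  smooth_on U (fun y => f (T y)).
Proof.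
move=> oU UW sT + k.
have mT y : U y -> mdiff T y.
  by move=> Uy i j; rewrite ord1; exact: smooth_differentiable (sT j) Uy.
have dfT g : smooth_on W g -> forall y, U y -> differentiable (fun y => g (T y)) y.
  move=> sg y Uy; apply: differentiable_mdiff_comp; first exact: mT.
  by apply: smooth_differentiable sg _; exact: UW.
elim: k f => [|k IH] f sf.
  by move=> y Uy; apply: differentiable_continuous; exact: (dfT f).
split=> [|i]; first exact: dfT.
apply: (@Ck_eq _ _ _ _ (fun y => \sum_j partial i (fun z => T z 0 j) y * partial j f (T y))) => //.
  move=> z Uz; rewrite [RHS](derive_comp _ (mT z Uz)); last first.
    by apply: smooth_differentiable sf _; exact: UW.
  rewrite derive_partial; last by apply: smooth_differentiable sf _; exact: UW.
  by apply: eq_bigr => j _; rewrite mxE.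
have CkS (F : 'I_m -> 'rV[R]_n -> R) : (forall j, Ck k U (F j)) -> Ck k U (fun y => \sum_j F j y).
  move=> CF; elim: (index_enum _) => [|j s IHs].
    by apply: (Ck_eq oU _ (smooth_on_cst U 0 k)) => z _; rewrite big_nil.
  apply: (@Ck_eq _ _ _ _ (fun y => F j y + \sum_(j <- s) F j y)) => //.
    by move=> z _; rewrite big_cons.
  exact: CkD.
apply: CkS => j; apply: CkM => //; first exact: smooth_partial.
by apply: IH; exact: smooth_partial.
Qed.

Lemma differentiable_ln (x : R) : 0 < x -> differentiable (@ln R) x.
Proof. by move=> /is_derive1_ln[dx _]; exact/derivable1_diffP. Qed.

Lemma derive_ln f u y : differentiable f y -> 0 < f y ->
  'D_u (fun z => ln (f z)) y = (f y)^-1 * 'D_u f y.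
Proof.
move=> df fy; have dl := differentiable_ln fy.
rewrite deriveE; last exact: differentiable_comp.
rewrite (diff_comp df dl) /= -(deriveE _ df) diff1E //.
by rewrite derive1E (@derive_val _ _ _ _ _ _ _ (is_derive1_ln fy)) /= mulrC.
Qed.

Lemma smooth_on_ln U f : open U -> (forall y, U y -> 0 < f y) ->
  smooth_on U f -> smooth_on U (fun y => ln (f y)).
Proof.
move=> oU f0 sf.
have df y : U y -> differentiable (fun y => ln (f y)) y.
  move=> Uy; apply: differentiable_comp; first exact: smooth_differentiable sf Uy.
  by apply: differentiable_ln; exact: f0.
have pln i y : U y -> partial i (fun y => ln (f y)) y = (f y)^-1 * partial i f y.
  by move=> Uy; apply: derive_ln; [exact: smooth_differentiable sf Uy|exact: f0].
case=> [|k].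
  by move=> y Uy; apply: differentiable_continuous; exact: df.
split=> // i; apply: (Ck_eq oU) => [z Uz|]; first by rewrite pln.
suff : smooth_on U (fun z => (f z)^-1 * partial i f z) by exact.
apply: smooth_onM => //; last exact: smooth_partial.
by apply: smooth_onV => // y /f0 /lt0r_neq0.
Qed.

Lemma smooth_on_sqrt U f : open U -> (forall y, U y -> 0 < f y) ->
  smooth_on U f -> smooth_on U (fun y => Num.sqrt (f y)).
Proof.
move=> oU f0 sf.
have dsq (x : R) : 0 < x -> differentiable (@Num.sqrt R) x.
  by move=> /is_derive1_sqrt[dx _]; exact/derivable1_diffP.
have df y : U y -> differentiable (fun y => Num.sqrt (f y)) y.
  move=> Uy; apply: differentiable_comp; first exact: smooth_differentiable sf Uy.
  by apply: dsq; exact: f0.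
(* Writing the derivative as a smooth factor times the square root itself lets the induction on [k]
   close. *)
have psq i y : U y -> partial i (fun y => Num.sqrt (f y)) y =
    (2^-1 * (f y)^-1 * partial i f y) * Num.sqrt (f y).
  move=> Uy; have dfy := smooth_differentiable sf Uy; have fy := f0 _ Uy.
  rewrite /partial deriveE; last exact: df.
  rewrite (diff_comp dfy (dsq _ fy)) /= -(deriveE _ dfy) diff1E; last exact: dsq.
  rewrite derive1E (@derive_val _ _ _ _ _ _ _ (is_derive1_sqrt fy)) /=.
  have s0 : Num.sqrt (f y) != 0 by rewrite sqrtr_eq0 -ltNge.
  rewrite -{2}(sqr_sqrtr (ltW fy)) -[LHS]/(_ * _); field.
  by rewrite s0.
elim=> [|k IH].
  by move=> y Uy; apply: differentiable_continuous; exact: df.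
split=> // i; apply: (Ck_eq oU) => [z Uz|]; first by rewrite psq.
apply: CkM => //.
suff : smooth_on U (fun z => 2^-1 * (f z)^-1 * partial i f z) by exact.
apply: smooth_onM => //; last exact: smooth_partial.
apply: smooth_onM => //; first exact: smooth_on_cst.
by apply: smooth_onV => // y /f0 /lt0r_neq0.
Qed.

End SmoothComposition.

(** * Symmetry of second derivatives *)

Section MixedPartials.
Context {R : realType} {n : nat}.
Implicit Types (U : set 'rV[R]_n) (f : 'rV[R]_n -> R).

Lemma derive_line (g : 'rV[R]_n -> R) (z v : 'rV[R]_n) (s : R) :
  differentiable g (z + s *: v) ->
  is_derive s 1 (fun t => g (z + t *: v)) ('D_v g (z + s *: v)).
Proof.
move=> dg; pose T (t : R) : 'rV[R]_n := z + t *: v.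
have dT : differentiable T s.
  apply: (@differentiableD _ _ _ (cst z) (fun t : R => t *: v)).
    exact: differentiable_cst.
  by apply: (@differentiableZl _ _ _ id v).
have TE : 'D_1 T s = v.
  rewrite [LHS](@deriveD _ _ _ (cst z) (fun t : R => t *: v)); last 2 first.
  - exact: derivable_cst.
  - by apply: diff_derivable; apply: (@differentiableZl _ _ _ id v).
  rewrite derive_cst add0r deriveE; last by apply: (@differentiableZl _ _ _ id v).
  by rewrite (@diffZl _ _ _ id v) // diff_val scale1r.
have dgT : differentiable (g \o T) s by exact: differentiable_comp.
split; first exact: (@diff_derivable _ _ _ (g \o T)).
rewrite (deriveE _ dgT) (diff_comp dT dg) /= -(deriveE _ dT) TE.
by rewrite -(deriveE _ dg).
Qed.

Lemma MVT_line (g : 'rV[R]_n -> R) (z v : 'rV[R]_n) (h : R) : 0 < h ->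
  (forall s, 0 <= s <= h -> differentiable g (z + s *: v)) ->
  exists2 c, 0 < c < h & g (z + h *: v) - g z = 'D_v g (z + c *: v) * h.
Proof.
move=> h0 dg.
have [||c] := @MVT R (fun t => g (z + t *: v)) (fun t => 'D_v g (z + t *: v)) 0 h h0.
- move=> x; rewrite in_itv /= => /andP[x0 xh].
  by apply: derive_line; apply: dg; rewrite !ltW.
- apply: derivable_within_continuous => x; rewrite in_itv /= => xh.
  by have [] := derive_line (dg x xh).
- by rewrite in_itv /= scale0r addr0 subr0 => ch ->; exists c.
Qed.

(** The mean value theorem is applied to [z |-> f (z + h e_j) - f z] along [e_i], then to the [i]-th
    partial derivative along [e_j]. The left side is symmetric in [i] and [j], while the right side
    singles out one order of differentiation. *)
Lemma mixed_difference U f (y : 'rV[R]_n) (i j : 'I_n) (h : R) :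
  smooth_on U f -> 0 < h ->
  (forall s t, 0 <= s <= h -> 0 <= t <= h ->
    U (y + s *: delta_mx 0 i + t *: delta_mx 0 j)) ->
  exists2 st : R * R, 0 <= st.1 <= h /\ 0 <= st.2 <= h &
    f (y + h *: delta_mx 0 i + h *: delta_mx 0 j) - f (y + h *: delta_mx 0 i)
      - f (y + h *: delta_mx 0 j) + f y =
    partial j (partial i f) (y + st.1 *: delta_mx 0 i + st.2 *: delta_mx 0 j) * h * h.
Proof.
move=> sf h0 Ubox.
set ei : 'rV[R]_n := delta_mx 0 i; set ej : 'rV[R]_n := delta_mx 0 j.
have h0h : 0 <= h <= h by rewrite lexx ltW.
have z0h : 0 <= (0 : R) <= h by rewrite lexx ltW.
have dsh z : U (z + h *: ej) -> differentiable (fun z => f (z + h *: ej)) z.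
  move=> Uz; apply: (@differentiable_comp _ _ _ _ (fun z => z + h *: ej) f).
    apply: (@differentiableD _ _ _ id (cst (h *: ej))) => //.
  exact: smooth_differentiable sf Uz.
pose G z := f (z + h *: ej) - f z.
have UG s : 0 <= s <= h -> U (y + s *: ei + h *: ej) /\ U (y + s *: ei).
  by move=> sh; split; [exact: Ubox|have := Ubox s 0 sh z0h; rewrite scale0r addr0].
have [|s /andP[s0 sh]] := @MVT_line G y ei h h0.
  move=> s /UG[U1 U2]; apply: differentiableB; first exact: dsh.
  exact: smooth_differentiable sf U2.
have ssh : 0 <= s <= h by rewrite !ltW.
have [U1 U2] := UG s ssh.
rewrite [X in _ = X * _](@deriveB _ _ _ (fun z => f (z + h *: ej)) f); last 2 first.
- exact/diff_derivable/dsh.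
- exact/diff_derivable/(smooth_differentiable sf U2).
(* Both sides are derivatives at [0] of the same function of [t], with the translations taken in two
   orders. *)
have -> : 'D_ei (fun z => f (z + h *: ej)) (y + s *: ei) = partial i f (y + s *: ei + h *: ej).
  have [d1 d2] : is_derive (0 : R) 1 (fun t : R => f (y + s *: ei + h *: ej + t *: ei))
      ('D_ei f (y + s *: ei + h *: ej)).
    have := @derive_line f (y + s *: ei + h *: ej) ei 0.
    by rewrite scale0r addr0; apply; exact: smooth_differentiable sf U1.
  have [d3 d4] : is_derive (0 : R) 1 (fun t : R => f (y + s *: ei + t *: ei + h *: ej))
      ('D_ei (fun z => f (z + h *: ej)) (y + s *: ei)).
    have := @derive_line (fun z => f (z + h *: ej)) (y + s *: ei) ei 0.
    by rewrite scale0r addr0; apply; exact: dsh.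
  rewrite -d4 /partial -d2; apply: eq_derive => t.
  by rewrite addrAC.
have [|t /andP[t0 th]] := @MVT_line (partial i f) (y + s *: ei) ej h h0.
  move=> t th; apply: (smooth_differentiable (smooth_partial i sf)).
  exact: Ubox.
rewrite -/(partial i f (y + s *: ei)) => -> Gh.
exists (s, t); first by rewrite !ltW.
rewrite /= -Gh /G; ring.
Qed.

Lemma common_ball U (A B : 'rV[R]_n -> R) (y : 'rV[R]_n) (e : R) : 0 < e -> nbhs y U ->
  {for y, continuous A} -> {for y, continuous B} ->
  exists2 d, 0 < d & forall z, ball y d z ->
    [/\ U z, `|A y - A z| < e & `|B y - B z| < e].
Proof.
move=> e0 nU /cvgrPdist_lt/(_ _ e0) nA /cvgrPdist_lt/(_ _ e0) nB.
have nUAB : nbhs y (U `&` ([set z | `|A y - A z| < e] `&` [set z | `|B y - B z| < e])).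
  exact: filterI nU (filterI nA nB).
have [d d0 Hd] := (nbhs_ballP _ _).1 nUAB.
by exists d => // z /Hd[Uz [Az Bz]].
Qed.

(** If the two mixed derivatives differed at [y], continuity would separate their values on a ball;
    two uses of [mixed_difference], with [i] and [j] exchanged, make them equal at some pair of
    points of a small square in that ball. *)
Lemma partial_comm U f (i j : 'I_n) y : open U -> U y -> smooth_on U f ->
  partial i (partial j f) y = partial j (partial i f) y.
Proof.
move=> oU Uy sf; apply/eqP/negPn/negP => neq.
pose A := partial i (partial j f); pose B := partial j (partial i f).
set ei : 'rV[R]_n := delta_mx 0 i; set ej : 'rV[R]_n := delta_mx 0 j.
have {}neq : A y != B y := neq.
have e0 : 0 < `|A y - B y| / 2 by rewrite divr_gt0 // normr_gt0 subr_eq0.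
have cA : {for y, continuous A}.
  by apply: differentiable_continuous; exact: (smooth_differentiable (smooth_partial i (smooth_partial j sf)) Uy).
have cB : {for y, continuous B}.
  by apply: differentiable_continuous; exact: (smooth_differentiable (smooth_partial j (smooth_partial i sf)) Uy).
have [d d0 Hd] := common_ball e0 (open_nbhs_nbhs (conj oU Uy)) cA cB.
(* The square of side [h] must lie in the ball of radius [d]: the [+ 1] keeps the denominator
   positive and the factor 2 makes the inequality strict. *)
pose h := d / (2 * (`|ei| + `|ej| + 1)).
have N0 : 0 < `|ei| + `|ej| + 1 by rewrite ltr_wpDl // addr_ge0.
have h0 : 0 < h by rewrite divr_gt0 // mulr_gt0.
have inb s t : 0 <= s <= h -> 0 <= t <= h -> ball y d (y + s *: ei + t *: ej).
  move=> /andP[s0 sh] /andP[t0 th]; rewrite -ball_normE /= -addrA opprD addNKr normrN.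
  apply: (le_lt_trans (ler_normD _ _)); rewrite !normrZ !ger0_norm //.
  apply: (@le_lt_trans _ _ (h * (`|ei| + `|ej| + 1))).
    rewrite !mulrDr mulr1; apply: ler_wpDr; first exact: ltW.
    by rewrite lerD // ler_wpM2r.
  have -> : h * (`|ei| + `|ej| + 1) = d / 2 by rewrite /h; field; rewrite gt_eqF.
  by rewrite ltr_pdivrMr // ltr_pMr // ltr1n.
have [|[s t] /= [sh th] E1] := @mixed_difference U f y i j h sf h0.
  by move=> s t sh th; have [] := Hd _ (inb s t sh th).
have [|[t' s'] /= [th' sh'] E2] := @mixed_difference U f y j i h sf h0.
  by move=> t' s' th' sh'; rewrite addrAC; have [] := Hd _ (inb s' t' sh' th').
have [_ _ B1] := Hd _ (inb s t sh th).
have [_ A1 _] := Hd _ (inb s' t' sh' th').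
have AB : A (y + s' *: ei + t' *: ej) = B (y + s *: ei + t *: ej).
  apply: (mulIf (lt0r_neq0 h0)); apply: (mulIf (lt0r_neq0 h0)).
  rewrite [y + s' *: ei + _]addrAC.
  apply: (etrans (esym E2)); apply: (etrans _ E1).
  rewrite [y + h *: ej + _]addrAC; congr (_ + _).
  exact: addrAC.
rewrite AB in A1.
have := ler_distD (B (y + s *: ei + t *: ej)) (A y) (B y).
rewrite leNgt => /negP; apply.
rewrite [ltRHS](splitr `|A y - B y|); apply: ltrD; first exact: A1.
rewrite [ltLHS]distrC; exact: B1.
Qed.

End MixedPartials.

(** * Bump functions *)

Section Bump.
Context {R : realType}.

(* [exp (- 1 / t)] for [p = 1]; the polynomial factor makes the family stable
   under differentiation. *)
Definition flat (p : {poly R}) (t : R) : R :=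
  if 0 < t then p.[t^-1] * expR (- t^-1) else 0.

(** With [s = 1/t], the inequality [exp s >= s^(k+2) / (k+2)!] controls the term of degree [k] of
    [p]. The two extra powers become [t^2], which makes the difference quotient at [0] tend to
    [0]. *)
Lemma flat_bound (p : {poly R}) : exists2 C, 0 <= C & forall t, `|flat p t| <= C * t ^+ 2.
Proof.
exists (\sum_(k < size p) `|p`_k| * (k.+2)`!%:R).
  by apply: sumr_ge0 => k _; rewrite mulr_ge0.
move=> t; rewrite /flat; case: ifPn => [t0|_]; last first.
  by rewrite normr0 mulr_ge0 ?sqr_ge0 // sumr_ge0 // => k _; rewrite mulr_ge0.
set s := t^-1; have s0 : 0 < s by rewrite invr_gt0.
rewrite normrM (ger0_norm (expR_ge0 _)) expRN ler_pdivrMr ?expR_gt0 //.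
rewrite horner_coef; apply: (le_trans (ler_norm_sum _ _ _)).
rewrite !mulr_suml; apply: ler_sum => k _.
rewrite normrM normrX (gtr0_norm s0) -2!mulrA; apply: ler_wpM2l => //.
have := @expR_ge1Dxn R s k.+1 (ltW s0).
move/(le_trans (_ : s ^+ k.+2 / (k.+2)`!%:R <= _)); rewrite lerDr ler01 => /(_ isT).
rewrite ler_pdivrMr ?ltr0n ?fact_gt0 // => sE.
have -> : s ^+ k = s ^+ k.+2 * t ^+ 2.
  by rewrite -[k.+2]addn2 exprD /s -mulrA -exprMn mulVf ?gt_eqF // expr1n mulr1.
rewrite [leLHS]mulrC [leRHS]mulrCA; apply: ler_wpM2l; first exact: sqr_ge0.
by rewrite mulrC.
Qed.

(** For [s = 1/t] one has [ds/dt = - s^2], so [p(s) exp(-s)] has derivative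
    [s^2 (p - p')(s) exp(-s)]. At [0] the quadratic bound of [flat_bound] gives the derivative
    [0]. *)
Lemma is_derive_flat (p : {poly R}) (t : R) :
  is_derive t 1 (flat p) (flat ('X ^+ 2 * (p - p^`())) t).
Proof.
case: (ltrgtP 0 t) => [t0|t0|<-].
- have fE : \forall z \near t, p.[z^-1] * expR (- z^-1) = flat p z.
    have : \forall z \near t, 0 < z by exact: lt_nbhsr.
    by apply: filterS => z z0; rewrite /flat z0.
  apply: (near_eq_is_derive fE); rewrite /flat t0 !hornerE /=.
  have tn0 := lt0r_neq0 t0.
  have dV : is_derive t 1 (fun z : R => z^-1) (- t ^- 2).
    split; first exact: derivableV.
    by rewrite (@deriveV _ _ id) // derive_id [LHS]mulr1.
  have dp : is_derive t 1 (fun z : R => p.[z^-1]) (p^`().[t^-1] * - t ^- 2).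
    exact: (@is_derive1_comp _ (horner p) (fun z => z^-1) t _ _ (is_derive_poly p t^-1) dV).
  have de : is_derive t 1 (fun z : R => expR (- z^-1)) (expR (- t^-1) * - - t ^- 2).
    exact: (@is_derive1_comp _ expR (fun z => - z^-1) t _ _ (is_derive_expR _) (is_deriveN dV)).
  apply: is_derive_eq (is_deriveM dp de) _.
  by rewrite -![_ *: _]/(_ * _) -exprVn; ring.
- have fE : \forall z \near t, 0 = flat p z.
    have : \forall z \near t, z < 0 by exact: lt_nbhsl.
    by apply: filterS => z z0; rewrite /flat ltNge (ltW z0).
  rewrite {2}/flat ltNge (ltW t0) /=.
  by apply: (near_eq_is_derive fE); exact: is_derive_cst.
- rewrite {2}/flat ltxx.
  have [C C0 HC] := flat_bound p.
  have cv : (fun h : R => h^-1 *: ((flat p \o shift 0) (h *: (1 : R)) - flat p 0)) @ 0^' --> (0 : R).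
    apply/cvgrPdist_lt => e e0; near=> h.
    rewrite sub0r normrN /= {2}/flat ltxx subr0 addr0 normrM normfV.
    have h0 : h != 0 by near: h; exact: nbhs_dnbhs_neq.
    rewrite mulrC ltr_pdivrMr ?normr_gt0 // [h%:A]mulr1.
    apply: (le_lt_trans (HC h)); rewrite -(real_normK (num_real h)) expr2 mulrA.
    rewrite ltr_pM2r ?normr_gt0 //.
    apply: (@le_lt_trans _ _ ((C + 1) * `|h|)).
      by rewrite ler_wpM2r // lerDl.
    rewrite mulrC -ltr_pdivlMr ?ltr_wpDl //.
    by near: h; apply: dnbhs0_lt; rewrite divr_gt0 // ltr_wpDl.
  split; first by apply/cvg_ex; exists 0.
  exact: cvg_lim cv.
Unshelve. all: by end_near. Qed.

Lemma smooth_on_flat n (U : set 'rV[R]_n) (p : {poly R}) (q : 'rV[R]_n -> R) :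
  open U -> smooth_on U q -> smooth_on U (fun y => flat p (q y)).
Proof.
move=> oU sq k.
have df p' y : U y -> differentiable (fun y => flat p' (q y)) y.
  move=> Uy; apply: differentiable_comp; first exact: smooth_differentiable sq Uy.
  by apply/derivable1_diffP; have [] := is_derive_flat p' (q y).
elim: k p => [|k IH] p.
  by move=> y Uy; apply: differentiable_continuous; exact: df.
split=> [y Uy|i]; first exact: df.
apply: (@Ck_eq _ _ _ _ (fun y => flat ('X ^+ 2 * (p - p^`())) (q y) * partial i q y)) => //.
  move=> z Uz; have dq := smooth_differentiable sq Uz.
  have [d1 d2] := is_derive_flat p (q z).
  have df1 : differentiable (flat p) (q z) by exact/derivable1_diffP.
  rewrite /partial [RHS]deriveE; last exact: df.
  rewrite (diff_comp dq df1) /= -(deriveE _ dq) diff1E // derive1E d2.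
  by rewrite mulrC.
by apply: CkM => //; exact: smooth_partial.
Qed.

Lemma flat1_gt0 t : 0 < t -> 0 < flat 1 t.
Proof. by move=> t0; rewrite /flat t0 hornerC mul1r expR_gt0. Qed.

Lemma flat1_ge0 t : 0 <= flat 1 t.
Proof. by case: (ltP 0 t) => [/flat1_gt0/ltW//|t0]; rewrite /flat ltNge t0. Qed.

Lemma flat_le0 p t : t <= 0 -> flat p t = 0.
Proof. by move=> t0; rewrite /flat ltNge t0. Qed.

(** The function is [a / (a + b)], where [a] is positive exactly inside the euclidean sphere of
    radius [r] and [b] exactly outside that of radius [r / 2]: the denominator never vanishes, and
    the quotient is [1] where [b = 0]. The support is bounded coordinatewise so as to lie in a
    compact box. *)
Lemma bump_function n (y0 : 'rV[R]_n) (r : R) : 0 < r ->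
  exists psi : 'rV[R]_n -> R, [/\ smooth_on setT psi,
    \forall y \near y0, psi y = 1 &
    forall y, psi y != 0 -> forall i, `|y 0 i - y0 0 i| < r].
Proof.
move=> r0; pose q (y : 'rV[R]_n) := \sum_i (y 0 i - y0 0 i) * (y 0 i - y0 0 i).
pose a y := flat 1 (r ^+ 2 + - q y); pose b y := flat 1 (q y + - (r ^+ 2 / 4)).
have oT : open [set: 'rV[R]_n] by exact: openT.
have sq : smooth_on setT q.
  apply: smooth_on_sum => // i _; have s1 : smooth_on setT (fun y : 'rV[R]_n => y 0 i - y0 0 i).
    by apply: smooth_onD => //; [exact: smooth_on_coord|exact: smooth_on_cst].
  exact: smooth_onM.
have sa : smooth_on setT a.
  apply: smooth_on_flat => //; apply: smooth_onD => //; first exact: smooth_on_cst.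
  exact: smooth_onN.
have sb : smooth_on setT b.
  by apply: smooth_on_flat => //; apply: smooth_onD => //; exact: smooth_on_cst.
have ab0 y : 0 < a y + b y.
  case: (ltP (q y) (r ^+ 2)) => qr.
    by apply: ltr_pwDl; [apply: flat1_gt0; rewrite subr_gt0|exact: flat1_ge0].
  apply: ltr_wpDl; first exact: flat1_ge0.
  apply: flat1_gt0; rewrite subr_gt0; apply: lt_le_trans qr.
  by rewrite ltr_pdivrMr // ltr_pMr ?exprn_gt0 // ltr1n.
exists (fun y => a y * (a y + b y)^-1); split.
- apply: smooth_onM => //; apply: smooth_onV => //; last exact: smooth_onD.
  by move=> y _; exact: lt0r_neq0.
- have qc : {for y0, continuous q}.
    by apply: differentiable_continuous; exact: smooth_differentiable sq I.
  have q0 : q y0 = 0 by apply: big1 => i _; rewrite subrr mul0r.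
  have : \forall y \near y0, q y < r ^+ 2 / 4.
    have r4 : q y0 < r ^+ 2 / 4 by rewrite q0 divr_gt0 // exprn_gt0.
    by apply: (qc [set x | x < r ^+ 2 / 4]); exact: lt_nbhsl.
  apply: filterS => y qy; have b0 : b y = 0 by apply: flat_le0; rewrite subr_le0 ltW.
  by rewrite b0 addr0 divff //; have := ab0 y; rewrite b0 addr0 => /lt0r_neq0.
- move=> y ay i; rewrite ltNge; apply/negP => ri.
  move: ay; rewrite mulf_eq0 negb_or => /andP[/eqP ay _]; apply: ay.
  apply: flat_le0; rewrite subr_le0.
  apply: (@le_trans _ _ ((y 0 i - y0 0 i) * (y 0 i - y0 0 i))).
    by rewrite -expr2 -(real_normK (num_real (y 0 i - y0 0 i))) lerXn2r // nnegrE // ltW.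
  rewrite /q (bigD1 i) //= lerDl; apply: sumr_ge0 => j _.
  by rewrite -expr2 sqr_ge0.
Qed.

End Bump.

(** * Charts and tensor fields *)

Section SmoothMatrices.
Context {R : realType} {n : nat}.
Implicit Types (U : set 'rV[R]_n).

Lemma smooth_mx_mdiff U m k (F : 'rV[R]_n -> 'M[R]_(m, k)) y :
  smooth_mx_on U F -> U y -> mdiff F y.
Proof. by move=> sF Uy i j; exact: smooth_differentiable (sF i j) Uy. Qed.

Lemma smooth_mx_eq U m k (F G : 'rV[R]_n -> 'M[R]_(m, k)) : open U ->
  (forall y, U y -> F y = G y) -> smooth_mx_on U F -> smooth_mx_on U G.
Proof.
move=> oU FG sF i j; apply: (smooth_on_eq oU _ (sF i j)) => y Uy.
by rewrite FG.
Qed.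

Lemma smooth_mx_cst U m k (A : 'M[R]_(m, k)) : smooth_mx_on U (fun=> A).
Proof. by move=> i j; exact: smooth_on_cst. Qed.

Lemma smooth_mx_mul U m k l (F : 'rV[R]_n -> 'M[R]_(m, k)) (G : 'rV[R]_n -> 'M[R]_(k, l)) :
  open U -> smooth_mx_on U F -> smooth_mx_on U G -> smooth_mx_on U (fun y => F y *m G y).
Proof.
move=> oU sF sG i j; apply: (smooth_on_eq oU (f := fun y => \sum_t F y i t * G y t j)).
  by move=> y _; rewrite mxE.
by apply: smooth_on_sum => // t _; exact: smooth_onM.
Qed.

Lemma smooth_mx_add U m k (F G : 'rV[R]_n -> 'M[R]_(m, k)) :
  open U -> smooth_mx_on U F -> smooth_mx_on U G -> smooth_mx_on U (fun y => F y + G y).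
Proof.
move=> oU sF sG i j; apply: (smooth_on_eq oU (f := fun y => F y i j + G y i j)).
  by move=> y _; rewrite mxE.
exact: smooth_onD.
Qed.

Lemma smooth_mx_scale U m k (f : 'rV[R]_n -> R) (F : 'rV[R]_n -> 'M[R]_(m, k)) :
  open U -> smooth_on U f -> smooth_mx_on U F -> smooth_mx_on U (fun y => f y *: F y).
Proof.
move=> oU sf sF i j; apply: (smooth_on_eq oU (f := fun y => f y * F y i j)).
  by move=> y _; rewrite mxE.
exact: smooth_onM.
Qed.

Lemma smooth_mx_sub U m k (F G : 'rV[R]_n -> 'M[R]_(m, k)) :
  open U -> smooth_mx_on U F -> smooth_mx_on U G -> smooth_mx_on U (fun y => F y - G y).
Proof.
move=> oU sF sG; apply: smooth_mx_add => //.
apply: (smooth_mx_eq oU (F := fun y => (-1) *: G y)) => [y _|]; first by rewrite scaleN1r.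
by apply: smooth_mx_scale => //; exact: smooth_on_cst.
Qed.

Lemma smooth_mx_tr U m k (F : 'rV[R]_n -> 'M[R]_(m, k)) :
  open U -> smooth_mx_on U F -> smooth_mx_on U (fun y => (F y)^T).
Proof.
move=> oU sF i j; apply: (smooth_on_eq oU (f := fun y => F y j i)) => //.
by move=> y _; rewrite mxE.
Qed.

Lemma smooth_on_det U m (F : 'rV[R]_n -> 'M[R]_m) :
  open U -> smooth_mx_on U F -> smooth_on U (fun y => \det (F y)).
Proof.
move=> oU sF; apply: smooth_on_sum => // s _; apply: smooth_onM => //.
  exact: smooth_on_cst.
by apply: smooth_on_prod => // i _; exact: sF.
Qed.

Lemma smooth_mx_inv U m (F : 'rV[R]_n -> 'M[R]_m) :
  open U -> (forall y, U y -> F y \in unitmx) ->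
  smooth_mx_on U F -> smooth_mx_on U (fun y => invmx (F y)).
Proof.
move=> oU uF sF.
apply: (smooth_mx_eq oU (F := fun y => (\det (F y))^-1 *: \adj (F y))) => [y /uF Fy|].
  by rewrite /invmx Fy.
apply: smooth_mx_scale => //.
  apply: smooth_onV => //; last exact: smooth_on_det.
  by move=> y /uF; rewrite unitmxE unitfE.
move=> i j; apply: (smooth_on_eq oU (f := fun y => (-1) ^+ (j + i) * \det (row' j (col' i (F y))))).
  by move=> y _; rewrite mxE.
apply: smooth_onM => //; first exact: smooth_on_cst.
apply: smooth_on_det => // a b.
apply: (smooth_on_eq oU (f := fun y => F y (lift j a) (lift i b))) => //.
by move=> y _; rewrite !mxE.
Qed.

End SmoothMatrices.

(** * Changes of charts and their jacobians *)

Section Charts.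
Context {R : realType} {n : nat} {M : smoothManifold R n}.
Implicit Types (c : chart R n M) (p q : M) (y : 'rV[R]_n).

(** Written with [cinv] instead of as an image, so that openness is a case of [open_preimage];
    [overlapE] returns to the set in the compatibility axiom of the atlas. *)
Definition overlap c c' : set 'rV[R]_n := [set y | cimage c y /\ dom c' (cinv c y)].

Lemma chart_atP p : atlas (chart_at p) /\ dom (chart_at p) p.
Proof. exact: (svalP (cid (atlas_cover p))). Qed.

Section OneChart.
Variables (c : chart R n M) (ac : atlas c).

Lemma cmapK p : dom c p -> cinv c (cmap c p) = p.
Proof. exact: (chart_cmapK (atlas_chart ac)). Qed.

Lemma open_cimage : open (cimage c).
Proof. exact: (chart_open_image (atlas_chart ac)). Qed.

Lemma cimage_cmap p : dom c p -> cimage c (cmap c p).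
Proof. by move=> cp; exists p. Qed.

Lemma dom_cinv y : cimage c y -> dom c (cinv c y).
Proof. by move=> [p cp <-]; rewrite cmapK. Qed.

Lemma cinvK y : cimage c y -> cmap c (cinv c y) = y.
Proof. by move=> [p cp <-]; rewrite cmapK. Qed.

Lemma open_preimage (A : set M) : open A -> open [set y | cimage c y /\ A (cinv c y)].
Proof.
move=> oA; rewrite openE => y [cy Ay]; have nc : nbhs y (cimage c) by apply: open_nbhs_nbhs; split=> //; exact: open_cimage.
have cc := chart_cinv_continuous (atlas_chart ac) cy.
have nA : nbhs (cinv c y) A by exact: open_nbhs_nbhs.
exact: filterI nc (cc A nA).
Qed.

Lemma near_dom p : dom c p -> \forall q \near p, dom c q.
Proof.
by move=> cp; apply: open_nbhs_nbhs; split => //; exact: (chart_open_dom (atlas_chart ac)).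
Qed.

End OneChart.

Lemma overlapE c c' : atlas c -> overlap c c' = cmap c @` (dom c `&` dom c').
Proof.
move=> ac; apply/seteqP; split=> y.
  by move=> [cy c'y]; exists (cinv c y); [split=> //; exact: dom_cinv|exact: cinvK].
by move=> [p [cp c'p] <-]; split; [exact: cimage_cmap|rewrite cmapK].
Qed.

Section TwoCharts.
Variables (c c' : chart R n M) (ac : atlas c) (ac' : atlas c').

Lemma open_overlap : open (overlap c c').
Proof. by apply: open_preimage => //; exact: (chart_open_dom (atlas_chart ac')). Qed.

Lemma overlap_cmap p : dom c p -> dom c' p -> overlap c c' (cmap c p).
Proof. by move=> cp c'p; split; [exact: cimage_cmap|rewrite cmapK]. Qed.

Lemma smooth_transition : smooth_mx_on (overlap c c') (transition c c').
Proof. by rewrite overlapE //; exact: atlas_compatible. Qed.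

Lemma mdiff_transition p : dom c p -> dom c' p -> mdiff (transition c c') (cmap c p).
Proof.
by move=> cp c'p; exact: smooth_mx_mdiff smooth_transition (overlap_cmap cp c'p).
Qed.

Lemma cimage_transition y : overlap c c' y -> cimage c' (transition c c' y).
Proof. by case=> _; exists (cinv c y). Qed.

Lemma cinv_transition y : overlap c c' y -> cinv c' (transition c c' y) = cinv c y.
Proof. by case=> _ c'y; rewrite /transition /= cmapK. Qed.

Lemma smooth_jac : smooth_mx_on (overlap c c') (fun y => jac c c' (cinv c y)).
Proof.
move=> i j; apply: (smooth_on_eq open_overlap
    (f := partial i (fun z => transition c c' z 0 j))).
  move=> y [cy c'y]; rewrite /jac cinvK // jacobianE //.
  by apply: smooth_mx_mdiff smooth_transition _; split.
exact/smooth_partial/smooth_transition.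
Qed.

Lemma jac_dmx p v : dom c p -> dom c' p ->
  v *m jac c c' p = dmx v (transition c c') (cmap c p).
Proof. by move=> cp c'p; rewrite /jac jacobian_dmx //; exact: mdiff_transition. Qed.

End TwoCharts.

Lemma jacE c c' p : jac c c' p = jacobian (transition c c') (cmap c p).
Proof. by []. Qed.

(* Failed unification problems between [mulmx] and an unfolded jacobian would
   otherwise not terminate in practice. *)
#[global] Opaque jac.

Lemma row_mx_eq (A B : 'M[R]_n) : (forall v : 'rV_n, v *m A = v *m B) -> A = B.
Proof. by move=> AB; apply/row_matrixP => i; rewrite !rowE. Qed.

Lemma jac_id c p : atlas c -> dom c p -> jac c c p = 1%:M.
Proof.
move=> ac cp; apply: row_mx_eq => v; rewrite (jac_dmx ac ac v cp cp) mulmx1.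
have : {near cmap c p, transition c c =1 id}.
  apply: (open_near_eq (open_cimage ac)); first exact: cimage_cmap.
  by move=> z; exact: cinvK.
move=> /near_eq_dmx ->; rewrite dmxE; last by move=> i j; exact: differentiable_coord.
by rewrite derive_id.
Qed.

Lemma jac_comp c c' c'' p : atlas c -> atlas c' -> atlas c'' ->
  dom c p -> dom c' p -> dom c'' p -> jac c c' p *m jac c' c'' p = jac c c'' p.
Proof.
move=> ac ac' ac'' cp c'p c''p; apply: row_mx_eq => v.
rewrite mulmxA [in LHS](jac_dmx ac ac' v cp c'p) [LHS](jac_dmx ac' ac'' _ c'p c''p).
rewrite [RHS](jac_dmx ac ac'' v cp c''p).
have cc' := overlap_cmap ac cp c'p.
have nE : {near cmap c p, transition c c'' =1 (fun z => transition c' c'' (transition c c' z))}.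
  apply: (open_near_eq (open_overlap ac ac') cc') => z [cz c'z].
  by rewrite /transition /= cmapK.
have Tp : transition c c' (cmap c p) = cmap c' p by rewrite /transition /= cmapK.
rewrite (near_eq_dmx _ nE) dmx_comp; first by rewrite Tp.
  exact: mdiff_transition.
by rewrite Tp; exact: mdiff_transition.
Qed.

Lemma jacK c c' p : atlas c -> atlas c' -> dom c p -> dom c' p ->
  jac c c' p *m jac c' c p = 1%:M.
Proof. by move=> ac ac' cp c'p; rewrite jac_comp // jac_id. Qed.

End Charts.

Section Coordinates.
Context {R : realType} {n : nat} {M : smoothManifold R n}.
Implicit Types (c : chart R n M) (X Y al be : rowfield M) (P G : tensor2 M) (f : M -> R).

Section AtPoint.
Variables (c c' : chart R n M) (ac : atlas c) (ac' : atlas c').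
Variables (y : 'rV[R]_n) (cy : overlap c c' y).

Let dc : dom c (cinv c y). Proof. by apply: dom_cinv => //; case: cy. Qed.
Let dc' : dom c' (cinv c y). Proof. by case: cy. Qed.

Lemma vcoord_transition X :
  vcoord c' X (transition c c' y) = vcoord c X y *m jac c c' (cinv c y).
Proof.
rewrite /vcoord (cinv_transition ac' cy) -mulmxA; have [aa da] := chart_atP (cinv c y).
by rewrite (jac_comp aa ac ac' da dc dc').
Qed.

End AtPoint.

Section OneChart.
Variables (c : chart R n M) (ac : atlas c).
Variables (y : 'rV[R]_n) (cy : cimage c y).

Let p := cinv c y.
Let dc : dom c p. Proof. exact: dom_cinv. Qed.
Let ca := chart_at p.
Let aa : atlas ca. Proof. by have [] := chart_atP p. Qed.
Let da : dom ca p. Proof. by have [] := chart_atP p. Qed.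
Let ja : jac ca c p *m jac c ca p = 1%:M. Proof. exact: jacK. Qed.
Let jcT : (jac c ca p)^T *m (jac ca c p)^T = 1%:M.
Proof. by rewrite -trmx_mul ja trmx1. Qed.
Lemma pairing_coord al X :
  pairing al X p = (fcoord c al y *m (vcoord c X y)^T) 0 0.
Proof.
rewrite /pairing /fcoord /vcoord -/p -/ca; move: jcT.
move: (jac c ca p) (jac ca c p) (al p) (X p) => J J' a x JJ.
by rewrite trmx_mul mulmxA -[in RHS](mulmxA a) JJ mulmx1.
Qed.

Lemma eval2_form_coord P al be :
  eval2 P al be p = (fcoord c al y *m bivcoord c P y *m (fcoord c be y)^T) 0 0.
Proof.
rewrite /eval2 /fcoord /bivcoord -/p -/ca; move: jcT ja.
move: (jac c ca p) (jac ca c p) (al p) (be p) (P p) => J J' a b P' JJ JJ'.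
by rewrite trmx_mul trmxK !mulmxA -[in RHS](mulmxA a) JJ mulmx1 -[in RHS](mulmxA (a *m P')) JJ' mulmx1.
Qed.

Lemma eval2_field_coord G X Y :
  eval2 G X Y p = (vcoord c X y *m metcoord c G y *m (vcoord c Y y)^T) 0 0.
Proof.
rewrite /eval2 /vcoord /metcoord -/p -/ca; move: jcT ja.
move: (jac c ca p) (jac ca c p) (X p) (Y p) (G p) => J J' a b P' JJ JJ'.
by rewrite trmx_mul !mulmxA -[in RHS](mulmxA a) JJ' mulmx1 -[in RHS](mulmxA (a *m P')) JJ mulmx1.
Qed.

Lemma vcoord_sharp P al : vcoord c (sharp P al) y = fcoord c al y *m bivcoord c P y.
Proof.
rewrite /vcoord /sharp /fcoord /bivcoord -/p -/ca; move: jcT.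
move: (jac c ca p) (jac ca c p) (al p) (P p) => J J' a P' JJ.
by rewrite !mulmxA -[in RHS](mulmxA a) JJ mulmx1.
Qed.

Lemma fcoord_inj al : fcoord c al y *m (jac ca c p)^T = al p.
Proof.
rewrite /fcoord -/p -/ca; move: jcT.
by move: (jac c ca p) (jac ca c p) (al p) => J J' a JJ; rewrite -mulmxA JJ mulmx1.
Qed.

Lemma vcoord_inj X : vcoord c X y *m jac c ca p = X p.
Proof.
rewrite /vcoord -/p -/ca; move: ja.
by move: (jac c ca p) (jac ca c p) (X p) => J J' a JJ; rewrite -mulmxA JJ mulmx1.
Qed.

(** [dform] uses the preferred chart of each point, and this chart varies with the point; the chain
    rule turns it into a gradient in one fixed chart. *)
Lemma fcoord_dform f : smooth_fun f ->
  fcoord c (dform f) y = \row_i partial i (f \o cinv c) y.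
Proof.
move=> sf; have ovy : overlap c ca y by split.
have mT : mdiff (transition c ca) y by exact: smooth_mx_mdiff (smooth_transition ac aa) ovy.
have Ty : transition c ca y = cmap ca p by [].
have dfa : differentiable (f \o cinv ca) (transition c ca y).
  by apply: smooth_differentiable (sf _ aa) _; rewrite Ty; exact: cimage_cmap.
have nE : {near y, f \o cinv c =1 (fun z => (f \o cinv ca) (transition c ca z))}.
  apply: (open_near_eq (open_overlap ac aa) ovy) => z zo /=.
  by rewrite -[in LHS](cinv_transition aa zo).
apply/rowP => i; rewrite [RHS]mxE /partial (near_eq_derive _ nE).
rewrite (derive_comp _ mT dfa) derive_partial // mxE; apply: eq_bigr => j _.
have -> : (jac c ca p)^T j i = dmx (delta_mx 0 i) (transition c ca) y 0 j.
  by rewrite mxE jacE (cinvK ac cy) jacobianE // mxE.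
by rewrite mulrC; congr (_ * _); rewrite /dform mxE Ty.
Qed.

Lemma dir_coord X f : smooth_fun f ->
  dir X f p = 'D_(vcoord c X y) (f \o cinv c) y.
Proof.
move=> sf; rewrite /dir pairing_coord fcoord_dform // derive_partial; last first.
  exact: smooth_differentiable (sf _ ac) cy.
by rewrite mxE; apply: eq_bigr => i _; rewrite !mxE mulrC.
Qed.

End OneChart.

Lemma chart_at_id (p : M) : jac (chart_at p) (chart_at p) p = 1%:M.
Proof. by have [? ?] := chart_atP p; exact: jac_id. Qed.

Lemma vcoord_at X (p : M) : vcoord (chart_at p) X (cmap (chart_at p) p) = X p.
Proof.
by have [? ?] := chart_atP p; rewrite /vcoord cmapK // chart_at_id mulmx1.
Qed.

Lemma fcoord_at al (p : M) : fcoord (chart_at p) al (cmap (chart_at p) p) = al p.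
Proof.
by have [? ?] := chart_atP p; rewrite /fcoord cmapK // chart_at_id trmx1 mulmx1.
Qed.

Lemma bivcoord_at P (p : M) : bivcoord (chart_at p) P (cmap (chart_at p) p) = P p.
Proof.
have [? ?] := chart_atP p.
by rewrite /bivcoord cmapK // chart_at_id trmx1 mulmx1 mul1mx.
Qed.

Lemma metcoord_at G (p : M) : metcoord (chart_at p) G (cmap (chart_at p) p) = G p.
Proof.
have [? ?] := chart_atP p.
by rewrite /metcoord cmapK // chart_at_id trmx1 mulmx1 mul1mx.
Qed.

Lemma denscoord_at (mu : M -> R) (p : M) :
  denscoord (chart_at p) mu (cmap (chart_at p) p) = mu p.
Proof.
have [? ?] := chart_atP p.
by rewrite /denscoord cmapK // chart_at_id det1 normr1 mulr1.
Qed.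

End Coordinates.

(** * Extension of local tensor fields by cutoffs *)

Section Cutoff.
Context {R : realType} {n : nat} {M : smoothManifold R n}.
Implicit Types (c : chart R n M) (W : set 'rV[R]_n) (chi : M -> R).

Definition chart_set c W : set M := [set q | dom c q /\ W (cmap c q)].

(** [K] is closed in [M] and not merely in the chart domain: its complement is then open in [M], and
    data multiplied by [chi] extend smoothly by zero. *)
Definition cutoff c W chi : Prop :=
  smooth_on W (chi \o cinv c) /\
  exists K : set M, [/\ closed K, K `<=` chart_set c W &
    forall q, ~ K q -> chi q = 0].

Lemma open_chart_set c W : atlas c -> open W -> open (chart_set c W).
Proof.
move=> ac oW; rewrite openE => q [cq Wq].
have nW : nbhs (cmap c q) W by exact: open_nbhs_nbhs.
exact: filterI (near_dom ac cq) (chart_cmap_continuous (atlas_chart ac) cq nW).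
Qed.

(** The bump function is supported in a closed box of half-width [e / 2] inside [W]. The box is
    compact, so its image in [M] is compact, and closed because [M] is Hausdorff; this image serves
    as [K]. *)
Lemma cutoff_exists c W y0 : atlas c -> open W -> W `<=` cimage c -> W y0 ->
  exists2 chi, cutoff c W chi & \forall z \near y0, chi (cinv c z) = 1.
Proof.
move=> ac oW Wc Wy0.
have nW : nbhs y0 W by exact: open_nbhs_nbhs.
have [e /= e0 eW] := (nbhs_ballP _ _).1 nW.
have r0 : 0 < e / 2 by rewrite divr_gt0.
have [psi [spsi psi1 psi0]] := bump_function y0 r0.
pose B : set 'rV[R]_n := [set v | forall i, v 0 i \in `[y0 0 i - e / 2, y0 0 i + e / 2]].
have BW : B `<=` W.
  move=> v Bv; apply: eW; split => // i j; rewrite ord1 /ball /= distrC.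
  have := Bv j; rewrite in_itv /= -ler_distl => /le_lt_trans; apply.
  by rewrite ltr_pdivrMr // ltr_pMr // ltr1n.
have cB : compact B.
  apply: (@rV_compact R n (fun i => [set` `[y0 0 i - e / 2, y0 0 i + e / 2]])) => i.
  exact: segment_compact.
have cK : closed (cinv c @` B).
  apply: compact_closed; first exact: m_hausdorff.
  apply: continuous_compact => //; apply: continuous_in_subspaceT => v /set_mem Bv.
  have cv : cimage c v by apply: Wc; exact: BW.
  exact: (chart_cinv_continuous (atlas_chart ac) cv).
pose chi q := if `[< dom c q >] then psi (cmap c q) else 0.
have chiE y : cimage c y -> chi (cinv c y) = psi y.
  by move=> cy; rewrite /chi asboolT ?cinvK //; exact: dom_cinv.
exists chi; last first.
  apply: filterS2 nW psi1 => z Wz <-; exact: chiE (Wc _ Wz).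
split.
  apply: (smooth_on_eq oW (f := psi)) => [z Wz|]; first by rewrite /= chiE //; exact: Wc.
  exact: smooth_on_sub spsi.
exists (cinv c @` B); split=> // [_ [v Bv <-]|q Kq].
  by have cv := Wc _ (BW _ Bv); split; [exact: dom_cinv|rewrite cinvK //; exact: BW].
rewrite /chi; case: asboolP => // cq; apply/eqP/negPn/negP => psiq; apply: Kq.
exists (cmap c q); last exact: cmapK.
by move=> i; rewrite in_itv /= -ler_distl ltW //; exact: psi0.
Qed.

Let scale_mulmx2 m k l r (a : R) (A : 'M[R]_(m, k)) (B : 'M[R]_(k, l)) (C : 'M[R]_(l, r)) :
  (a *: (A *m B)) *m C = a *: (A *m (B *m C)).
Proof. by rewrite -scalemxAl mulmxA. Qed.

Section Extension.
Variables (c : chart R n M) (ac : atlas c) (W : set 'rV[R]_n) (oW : open W).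
Variables (chi : M -> R) (cchi : cutoff c W chi).

Lemma cutoff0 q : ~ dom c q -> chi q = 0.
Proof.
case: cchi => _ [K [_ KW K0]] cq; by apply: K0 => /KW[dq _]; exact: cq.
Qed.

Let pre c' : set 'rV[R]_n := [set y | cimage c' y /\ chart_set c W (cinv c' y)].

Let open_pre c' : atlas c' -> open (pre c').
Proof. by move=> ac'; apply: open_preimage => //; exact: open_chart_set. Qed.

(** The open sets [pre c'] and the preimage of the complement of [K] cover the image of [c']. On the
    second one [chi] vanishes, and [F] with it. *)
Let smooth_glue c' (F : 'rV[R]_n -> R) : atlas c' ->
  (forall y, cimage c' y -> chi (cinv c' y) = 0 -> F y = 0) ->
  smooth_on (pre c') F -> smooth_on (cimage c') F.
Proof.
move=> ac' F0 sF; case: cchi => _ [K [clK KW K0]].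
apply: smooth_on_local => y c'y; case: (pselect (K (cinv c' y))) => Ky.
  by exists (pre c') => //; split => //; exact: KW.
exists [set y | cimage c' y /\ (~` K) (cinv c' y)] => //.
have oU : open [set y | cimage c' y /\ (~` K) (cinv c' y)].
  by apply: open_preimage => //; exact: closed_openC.
apply: (smooth_on_eq oU (f := fun=> 0)); last exact: smooth_on_cst.
by move=> z [c'z Kz]; rewrite F0 // K0.
Qed.

Let pre_transition c' y : atlas c' -> pre c' y -> W (transition c' c y).
Proof. by move=> ac' [_ []]. Qed.

Let smooth_pull c' (g : 'rV[R]_n -> R) : atlas c' -> smooth_on W g ->
  smooth_on (pre c') (fun y => g (transition c' c y)).
Proof.
move=> ac' sg; apply: (@smooth_on_comp _ _ _ _ W) => //; first exact: open_pre.
  by move=> y; exact: pre_transition.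
move=> j; apply: smooth_on_sub (smooth_transition ac' ac 0 j).
by move=> y [c'y []].
Qed.

Let chi_pull c' : atlas c' -> smooth_on (pre c') (fun y => chi (cinv c' y)).
Proof.
move=> ac'; case: cchi => schi _.
apply: smooth_on_eq (smooth_pull ac' schi); first exact: open_pre.
by move=> y [c'y [cy _]] /=; rewrite cinv_transition //; split.
Qed.

(** Outside [dom c] the values of [cmap c] and of the jacobians are arbitrary; since [chi] vanishes
    there, this and the next two definitions are extensions by zero. *)
Definition fun_ext (u : 'rV[R]_n -> R) : M -> R := fun q => chi q * u (cmap c q).

Definition form_ext (a : 'rV[R]_n -> 'rV[R]_n) : rowfield M := fun q =>
  chi q *: (a (cmap c q) *m (jac (chart_at q) c q)^T).

Definition field_ext (b : 'rV[R]_n -> 'rV[R]_n) : rowfield M := fun q =>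
  chi q *: (b (cmap c q) *m jac c (chart_at q) q).

Lemma smooth_fun_ext u : smooth_on W u -> smooth_fun (fun_ext u).
Proof.
move=> su c' ac'; apply: smooth_glue => // [y c'y|].
  by rewrite /fun_ext /= => ->; rewrite mul0r.
by apply: smooth_onM; [exact: open_pre|exact: chi_pull|exact: smooth_pull].
Qed.

Lemma smooth_cutoff : smooth_fun chi.
Proof.
have -> : chi = fun_ext (fun=> 1) by apply/funext => q; rewrite /fun_ext mulr1.
by apply: smooth_fun_ext; exact: smooth_on_cst.
Qed.

Lemma fcoord_form_ext_gen c' a y : atlas c' -> cimage c' y ->
  (chi (cinv c' y) != 0 -> dom c (cinv c' y)) ->
  fcoord c' (form_ext a) y =
    chi (cinv c' y) *: (a (cmap c (cinv c' y)) *m (jac c' c (cinv c' y))^T).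
Proof.
move=> ac' c'y; rewrite /fcoord /form_ext scale_mulmx2.
have [->|chi0 /(_ isT) cy] := eqVneq (chi (cinv c' y)) 0.
  by move=> _; apply: etrans (scale0r _) (esym (scale0r _)).
have [aa da] := chart_atP (cinv c' y).
rewrite -trmx_mul.
by rewrite (jac_comp ac' aa ac (dom_cinv ac' c'y) da cy).
Qed.

Lemma vcoord_field_ext_gen c' b y : atlas c' -> cimage c' y ->
  (chi (cinv c' y) != 0 -> dom c (cinv c' y)) ->
  vcoord c' (field_ext b) y =
    chi (cinv c' y) *: (b (cmap c (cinv c' y)) *m jac c c' (cinv c' y)).
Proof.
move=> ac' c'y; rewrite /vcoord /field_ext scale_mulmx2.
have [->|chi0 /(_ isT) cy] := eqVneq (chi (cinv c' y)) 0.
  by move=> _; apply: etrans (scale0r _) (esym (scale0r _)).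
have [aa da] := chart_atP (cinv c' y).
by rewrite (jac_comp ac aa ac' cy da (dom_cinv ac' c'y)).
Qed.

Let chi_dom q : chi q != 0 -> dom c q.
Proof. by move=> /eqP q0; apply: contrapT => /cutoff0. Qed.

Lemma fcoord_form_ext a y : cimage c y -> fcoord c (form_ext a) y = chi (cinv c y) *: a y.
Proof.
move=> cy; rewrite (fcoord_form_ext_gen _ ac cy (@chi_dom _)) (cinvK ac cy).
by rewrite (jac_id ac (dom_cinv ac cy)) trmx1 mulmx1.
Qed.

Lemma vcoord_field_ext b y : cimage c y -> vcoord c (field_ext b) y = chi (cinv c y) *: b y.
Proof.
move=> cy; rewrite (vcoord_field_ext_gen _ ac cy (@chi_dom _)) (cinvK ac cy).
by rewrite (jac_id ac (dom_cinv ac cy)) mulmx1.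
Qed.

Lemma fun_extE u y : cimage c y -> fun_ext u (cinv c y) = chi (cinv c y) * u y.
Proof. by move=> cy; rewrite /fun_ext cinvK. Qed.

Lemma one_form_ext a : smooth_mx_on W a -> one_form (form_ext a).
Proof.
move=> sa c' ac' i j; apply: smooth_glue => // [y c'y|].
  by rewrite /fcoord /form_ext scale_mulmx2 mxE => ->; exact: mul0r.
have oP := open_pre ac'.
have sE : smooth_mx_on (pre c') (fun y => chi (cinv c' y) *:
    (a (transition c' c y) *m (jac c' c (cinv c' y))^T)).
  apply: smooth_mx_scale => //; first exact: chi_pull.
  apply: smooth_mx_mul => //; first by move=> i0 j0; exact: (smooth_pull ac' (sa i0 j0)).
  apply: smooth_mx_tr => // i0 j0.
  by apply: smooth_on_sub (smooth_jac ac' ac i0 j0) => y [c'y []].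
apply: (smooth_on_eq oP _ (sE i j)) => y [c'y [cy _]].
by rewrite (fcoord_form_ext_gen _ ac' c'y (fun=> cy)).
Qed.

Lemma vector_field_ext b : smooth_mx_on W b -> vector_field (field_ext b).
Proof.
move=> sb c' ac' i j; apply: smooth_glue => // [y c'y|].
  by rewrite /vcoord /field_ext scale_mulmx2 mxE => ->; exact: mul0r.
have oP := open_pre ac'.
(* This jacobian is based at [c], so it is smooth in the coordinates of [c] and has to be pulled
   back by the transition. For forms the jacobian [jac c' c] is already smooth in those of [c']. *)
have sJ : smooth_mx_on (pre c') (fun y => jac c c' (cinv c (transition c' c y))).
  move=> i0 j0; apply: (@smooth_on_comp _ _ _ _ (overlap c c') (transition c' c)
    (fun y => jac c c' (cinv c y) i0 j0)) => //.
  - move=> y [c'y [cy _]]; split; first by exists (cinv c' y).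
    by rewrite cinv_transition //; exact: dom_cinv.
  - by move=> j1; apply: smooth_on_sub (smooth_transition ac' ac 0 j1) => y [c'y []].
  - exact: smooth_jac.
have sE : smooth_mx_on (pre c') (fun y => chi (cinv c' y) *:
    (b (transition c' c y) *m jac c c' (cinv c (transition c' c y)))).
  apply: smooth_mx_scale => //; first exact: chi_pull.
  by apply: smooth_mx_mul => // i0 j0; exact: (smooth_pull ac' (sb i0 j0)).
apply: (smooth_on_eq oP _ (sE i j)) => y [c'y [cy _]].
by rewrite (vcoord_field_ext_gen _ ac' c'y (fun=> cy)) cinv_transition.
Qed.

End Extension.
End Cutoff.

Section TensorClosure.
Context {R : realType} {n : nat} {M : smoothManifold R n}.
Implicit Types (f g : M -> R) (X Y al be : rowfield M) (P G : tensor2 M).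

Lemma smooth_fun_mul f g : smooth_fun f -> smooth_fun g -> smooth_fun (fun q => f q * g q).
Proof. by move=> sf sg c ac; apply: smooth_onM (sf c ac) (sg c ac); exact: open_cimage. Qed.

Lemma smooth_fun_add f g : smooth_fun f -> smooth_fun g -> smooth_fun (fun q => f q + g q).
Proof. by move=> sf sg c ac; apply: smooth_onD (sf c ac) (sg c ac); exact: open_cimage. Qed.

Lemma smooth_fun_cst (a : R) : smooth_fun (fun _ : M => a).
Proof. by move=> c ac; exact: smooth_on_cst. Qed.

Lemma fcoord_add c (a : R) al be y :
  fcoord c (a *: al + be) y = a *: fcoord c al y + fcoord c be y.
Proof. by rewrite /fcoord -[(a *: al + be) _]/(a *: al _ + be _) mulmxDl -scalemxAl. Qed.

Lemma vcoord_add c (a : R) X Y y :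
  vcoord c (a *: X + Y) y = a *: vcoord c X y + vcoord c Y y.
Proof. by rewrite /vcoord -[(a *: X + Y) _]/(a *: X _ + Y _) mulmxDl -scalemxAl. Qed.

Lemma fcoord_fscale c f al y : fcoord c (fscale f al) y = f (cinv c y) *: fcoord c al y.
Proof. by rewrite /fcoord /fscale -scalemxAl. Qed.

Lemma one_form_add (a : R) al be : one_form al -> one_form be -> one_form (a *: al + be).
Proof.
move=> sal sbe c ac; have oc := open_cimage ac.
apply: (smooth_mx_eq oc (F := fun y => a *: fcoord c al y + fcoord c be y)).
  by move=> y _; rewrite fcoord_add.
apply: smooth_mx_add => //; last exact: sbe.
by apply: smooth_mx_scale => //; [exact: smooth_on_cst|exact: sal].
Qed.

Lemma vector_field_add (a : R) X Y :
  vector_field X -> vector_field Y -> vector_field (a *: X + Y).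
Proof.
move=> sX sY c ac; have oc := open_cimage ac.
apply: (smooth_mx_eq oc (F := fun y => a *: vcoord c X y + vcoord c Y y)).
  by move=> y _; rewrite vcoord_add.
apply: smooth_mx_add => //; last exact: sY.
by apply: smooth_mx_scale => //; [exact: smooth_on_cst|exact: sX].
Qed.

Lemma one_form0 : one_form (0 : rowfield M).
Proof.
move=> c ac; apply: (smooth_mx_eq (open_cimage ac) (F := fun=> 0)) (smooth_mx_cst _ _).
by move=> y _; rewrite /fcoord mul0mx.
Qed.

Lemma vector_field0 : vector_field (0 : rowfield M).
Proof.
move=> c ac; apply: (smooth_mx_eq (open_cimage ac) (F := fun=> 0)) (smooth_mx_cst _ _).
by move=> y _; rewrite /vcoord mul0mx.
Qed.

Lemma vector_field_scale (a : R) X : vector_field X -> vector_field (a *: X).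
Proof. by move=> sX; rewrite -[a *: X]addr0; apply: vector_field_add => //; exact: vector_field0. Qed.

Lemma one_form_fscale f al : smooth_fun f -> one_form al -> one_form (fscale f al).
Proof.
move=> sf sal c ac; have oc := open_cimage ac.
apply: (smooth_mx_eq oc (F := fun y => (f \o cinv c) y *: fcoord c al y)).
  by move=> y _; rewrite fcoord_fscale.
by apply: smooth_mx_scale => //; [exact: sf|exact: sal].
Qed.

Lemma one_form_dform f : smooth_fun f -> one_form (dform f).
Proof.
move=> sf c ac; have oc := open_cimage ac.
apply: (smooth_mx_eq oc (F := fun y => \row_i partial i (f \o cinv c) y)).
  by move=> y cy; rewrite fcoord_dform.
move=> i j; apply: (smooth_on_eq oc (f := partial j (f \o cinv c))).
  by move=> y _; rewrite mxE.
by apply: smooth_partial; exact: sf.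
Qed.

Lemma vector_field_sharp P al : bivector_field P -> one_form al -> vector_field (sharp P al).
Proof.
move=> [_ sP] sal c ac; have oc := open_cimage ac.
apply: (smooth_mx_eq oc (F := fun y => fcoord c al y *m bivcoord c P y)).
  by move=> y cy; rewrite vcoord_sharp.
by apply: smooth_mx_mul => //; [exact: sal|exact: sP].
Qed.

Lemma smooth_pairing al X : one_form al -> vector_field X -> smooth_fun (pairing al X).
Proof.
move=> sal sX c ac; have oc := open_cimage ac.
apply: (smooth_on_eq oc (f := fun y => (fcoord c al y *m (vcoord c X y)^T) 0 0)).
  by move=> y cy; rewrite /= pairing_coord.
by apply: smooth_mx_mul => //; [exact: sal|apply: smooth_mx_tr => //; exact: sX].
Qed.

Lemma smooth_eval2 P al be : bivector_field P -> one_form al -> one_form be ->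
  smooth_fun (eval2 P al be).
Proof.
move=> [_ sP] sal sbe c ac; have oc := open_cimage ac.
apply: (smooth_on_eq oc (f := fun y =>
   (fcoord c al y *m bivcoord c P y *m (fcoord c be y)^T) 0 0)).
  by move=> y cy; rewrite /= eval2_form_coord.
apply: smooth_mx_mul => //; last by apply: smooth_mx_tr => //; exact: sbe.
by apply: smooth_mx_mul => //; [exact: sal|exact: sP].
Qed.

End TensorClosure.

(** * Cut-off frames and operators with a Leibniz rule *)

Section Frames.
Context {R : realType} {n : nat} {M : smoothManifold R n}.
Variable x : M.
Let c := chart_at x.
Let y0 := cmap c x.
Let ac : atlas c. Proof. by have [] := chart_atP x. Qed.
Let cx : dom c x. Proof. by have [] := chart_atP x. Qed.
Let cy0 : cimage c y0. Proof. exact: cimage_cmap. Qed.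
Let oc : open (cimage c). Proof. exact: open_cimage. Qed.
Let cinvy0 : cinv c y0 = x. Proof. exact: cmapK. Qed.

Variable chi : M -> R.
Hypothesis cchi : cutoff c (cimage c) chi.
Hypothesis chi1 : \forall z \near y0, chi (cinv c z) = 1.

(** A global form equal to [dy_i] near [x], as connections can be evaluated on global forms only;
    likewise for [frame] and the coordinate fields. *)
Definition coframe i : rowfield M := form_ext (chart_at x) chi (fun=> delta_mx 0 i).
Definition frame i : rowfield M := field_ext (chart_at x) chi (fun=> delta_mx 0 i).

Let near_cimage : \forall z \near y0, cimage c z.
Proof. exact: open_nbhs_nbhs. Qed.

Lemma chi_x : chi x = 1.
Proof. by rewrite -cinvy0; exact: nbhs_singleton chi1. Qed.

Lemma one_form_coframe i : one_form (coframe i).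
Proof. by apply: (one_form_ext ac oc cchi) => //; exact: smooth_mx_cst. Qed.

Lemma vector_field_frame i : vector_field (frame i).
Proof. by apply: (vector_field_ext ac oc cchi) => //; exact: smooth_mx_cst. Qed.

Lemma near_coframe i : \forall z \near y0, fcoord c (coframe i) z = delta_mx 0 i.
Proof.
apply: filterS2 near_cimage chi1 => z cz chiz.
by rewrite /coframe (fcoord_form_ext ac cchi) // chiz scale1r.
Qed.

Lemma near_frame i : \forall z \near y0, vcoord c (frame i) z = delta_mx 0 i.
Proof.
apply: filterS2 near_cimage chi1 => z cz chiz.
by rewrite /frame (vcoord_field_ext ac cchi) // chiz scale1r.
Qed.

Lemma coframe_x i : coframe i x = delta_mx 0 i.
Proof. by rewrite -[LHS]fcoord_at; exact: nbhs_singleton (near_coframe i). Qed.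

Lemma frame_x i : frame i x = delta_mx 0 i.
Proof. by rewrite -[LHS]vcoord_at; exact: nbhs_singleton (near_frame i). Qed.

Lemma dir_at X f : smooth_fun f -> dir X f x = 'D_(X x) (f \o cinv c) y0.
Proof. by move=> sf; rewrite -{1}cinvy0 (dir_coord ac cy0 _ sf) vcoord_at. Qed.

Let schi : smooth_fun chi.
Proof. exact: (smooth_cutoff ac oc cchi). Qed.

Lemma dir_near X f g : smooth_fun f -> smooth_fun g ->
  (\forall z \near y0, f (cinv c z) = g (cinv c z)) -> dir X f x = dir X g x.
Proof. by move=> sf sg fg; rewrite !dir_at //; exact: near_eq_derive. Qed.

(** Covers both arguments of a contravariant connection: [be |-> D al be] with [Z = # al], and the
    tensorial [al |-> D al be] with [Z = 0]. *)
Definition leibniz_form (Z : rowfield M) (A : rowfield M -> rowfield M) : Prop :=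
  (forall al be, one_form al -> one_form be -> A (al + be) = A al + A be) /\
  (forall f al, smooth_fun f -> one_form al ->
    A (fscale f al) = fscale f (A al) + fscale (dir Z f) al).

(* [chi^2 be] is the sum of the global forms [(chi be_i) (chi dy_i)]. *)
Lemma leibniz_at Z A be : leibniz_form Z A -> one_form be ->
  A be x = be x *m (\matrix_i A (coframe i) x) + dmx (Z x) (fcoord c be) y0.
Proof.
move=> [AD AZ] sbe.
pose b i := fun_ext c chi (fun y => fcoord c be y 0 i).
have sb i : smooth_fun (b i).
  by apply: (smooth_fun_ext ac oc cchi) => //; exact: (sbe c ac).
have se i : one_form (fscale (b i) (coframe i)).
  by apply: one_form_fscale => //; exact: one_form_coframe.
have sS (s : seq 'I_n) : one_form (\sum_(i <- s) fscale (b i) (coframe i)).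
  elim: s => [|i s IH]; first by rewrite big_nil; exact: one_form0.
  by rewrite big_cons -[fscale _ _]scale1r; exact: one_form_add.
have A0 : A 0 = 0.
  by apply: (@addrI _ (A 0)); rewrite -AD ?addr0 //; exact: one_form0.
have AS (s : seq 'I_n) : A (\sum_(i <- s) fscale (b i) (coframe i)) =
    \sum_(i <- s) A (fscale (b i) (coframe i)).
  elim: s => [|i s IH]; first by rewrite !big_nil.
  by rewrite !big_cons AD // IH.
have chi2 : smooth_fun (fun q => chi q * chi q) by exact: smooth_fun_mul.
have E : fscale (fun q => chi q * chi q) be = \sum_i fscale (b i) (coframe i).
  apply/funext => q; rewrite fct_sumE /fscale /b /coframe /fun_ext /form_ext -/c.
  have [cq|ncq] := pselect (dom c q); last first.
    have chiq : chi q = 0 := cutoff0 cchi ncq.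
    rewrite chiq mul0r scale0r big1 // => i _; rewrite mul0r.
    exact: (scale0r (_ : 'rV[R]_n)).
  rewrite -(scalerA (chi q)) -[in LHS](cmapK ac cq) -(fcoord_inj ac (cimage_cmap cq)).
  rewrite (cmapK ac cq); move: (jac _ _ _)^T (fcoord _ _ _) => J w.
  rewrite [w in w *m J]row_sum_delta mulmx_suml !scaler_sumr; apply: eq_bigr => i _.
  by rewrite -scalemxAl !scalerA; congr (_ *: _); rewrite mulrAC.
have := congr1 (fun F => A F x) E; rewrite /= AS AZ // fct_sumE.
(* Near [x] the factor [chi^2] is constantly [1], so its derivative along [Z] is [0]. *)
have -> : (fscale (fun q => chi q * chi q) (A be) +
    fscale (dir Z (fun q => chi q * chi q)) be) x = A be x.
  rewrite -[LHS]/((chi x * chi x) *: A be x + dir Z (fun q => chi q * chi q) x *: be x).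
  rewrite chi_x mulr1 scale1r (@dir_near _ _ (fun=> 1)) //; last 2 first.
  - exact: smooth_fun_cst.
  - by apply: filterS chi1 => z /= ->; rewrite mulr1.
  rewrite dir_at; last exact: smooth_fun_cst.
  by rewrite [X in X *: _]derive_cst scale0r addr0.
move=> ->; rewrite mulmx_sum_row.
have -> : dmx (Z x) (fcoord c be) y0 = \sum_i dir Z (b i) x *: coframe i x.
  rewrite [LHS]row_sum_delta; apply: eq_bigr => i _; rewrite coframe_x; congr (_ *: _).
  rewrite mxE dir_at //; apply: near_eq_derive.
  apply: filterS2 near_cimage chi1 => z cz chiz.
  by rewrite /b /= (fun_extE ac) // chiz mul1r.
rewrite -big_split /=; apply: eq_bigr => i _; rewrite AZ //; last exact: one_form_coframe.
rewrite rowK -[LHS]/(b i x *: A (coframe i) x + dir Z (b i) x *: coframe i x).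
by congr (_ *: _ + _); rewrite /b /fun_ext chi_x mul1r fcoord_at.
Qed.

End Frames.

(** * Divergence and Poisson structures in coordinates *)

Section LocalCalculus.
Context {R : realType} {n : nat}.
Variables (U : set 'rV[R]_n) (oU : open U).
Implicit Types (X Y T : 'rV[R]_n -> 'rV[R]_n) (f psi : 'rV[R]_n -> R) (y z u v : 'rV[R]_n).

Definition gradient f y : 'rV[R]_n := \row_i partial i f y.

Definition Dmat X y : 'M[R]_n := \matrix_(k, i) partial k (fun z => X z 0 i) y.

Definition hessian f y : 'M[R]_n := \matrix_(i, k) partial i (partial k f) y.

(* The divergence of [X] with respect to the density [exp psi]. *)
Definition ldiv psi X y : R := \tr (Dmat X y) + 'D_(X y) psi y.

Definition lie_bracket X Y z : 'rV[R]_n := dmx (X z) Y z - dmx (Y z) X z.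

Lemma dmx_Dmat X v y : mdiff X y -> dmx v X y = v *m Dmat X y.
Proof.
move=> mX; apply/rowP => i; rewrite !mxE derive_partial; last exact: mX.
by apply: eq_bigr => k _; rewrite mxE.
Qed.

Lemma derive_gradient f v y : differentiable f y ->
  'D_v f y = (v *m (gradient f y)^T) 0 0.
Proof.
by move=> df; rewrite derive_partial // mxE; apply: eq_bigr => i _; rewrite !mxE.
Qed.

Lemma smooth_on_dir X f : smooth_mx_on U X -> smooth_on U f ->
  smooth_on U (fun z => 'D_(X z) f z).
Proof.
move=> sX sf; apply: (smooth_on_eq oU (f := fun z => \sum_i X z 0 i * partial i f z)).
  by move=> z Uz; rewrite derive_partial //; exact: smooth_differentiable sf Uz.
apply: smooth_on_sum => // i _; apply: smooth_onM => //.
exact: smooth_partial.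
Qed.

Lemma smooth_mx_dir m k X (F : 'rV[R]_n -> 'M[R]_(m, k)) :
  smooth_mx_on U X -> smooth_mx_on U F -> smooth_mx_on U (fun z => dmx (X z) F z).
Proof.
move=> sX sF i j; apply: (smooth_on_eq oU (f := fun z => 'D_(X z) (fun w => F w i j) z)).
  by move=> z _; rewrite mxE.
by apply: smooth_on_dir => //; exact: sF.
Qed.

Lemma smooth_Dmat X : smooth_mx_on U X -> smooth_mx_on U (Dmat X).
Proof.
move=> sX k i; apply: (smooth_on_eq oU (f := partial k (fun z => X z 0 i))).
  by move=> z _; rewrite mxE.
by apply: smooth_partial; exact: sX.
Qed.

Lemma smooth_gradient f : smooth_on U f -> smooth_mx_on U (gradient f).
Proof.
move=> sf i j; apply: (smooth_on_eq oU (f := partial j f)); last exact: smooth_partial.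
by move=> z _; rewrite mxE.
Qed.

Lemma smooth_on_ldiv psi X : smooth_on U psi -> smooth_mx_on U X -> smooth_on U (ldiv psi X).
Proof.
move=> spsi sX; apply: smooth_onD => //; last exact: smooth_on_dir.
by apply: smooth_on_sum => // i _; exact: smooth_Dmat.
Qed.

Lemma hessian_sym f y : smooth_on U f -> U y -> (hessian f y)^T = hessian f y.
Proof.
move=> sf Uy; apply/matrixP => i k; rewrite !mxE.
exact: partial_comm oU Uy sf.
Qed.

Lemma derive_dir Y f u y : smooth_mx_on U Y -> smooth_on U f -> U y ->
  'D_u (fun z => 'D_(Y z) f z) y =
    'D_(dmx u Y y) f y + (u *m hessian f y *m (Y y)^T) 0 0.
Proof.
move=> sY sf Uy; have dY k : differentiable (fun z => Y z 0 k) y.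
  exact: smooth_differentiable (sY 0 k) Uy.
have dp k : differentiable (partial k f) y.
  exact: smooth_differentiable (smooth_partial k sf) Uy.
have nE : {near y, (fun z => 'D_(Y z) f z) =1 (fun z => \sum_k Y z 0 k * partial k f z)}.
  apply: (open_near_eq oU Uy) => z Uz.
  by rewrite derive_partial //; exact: smooth_differentiable sf Uz.
rewrite (near_eq_derive _ nE) derive_big; last by move=> k _; exact: differentiable_mul.
rewrite derive_partial; last exact: smooth_differentiable sf Uy.
rewrite mxE -big_split /=; apply: eq_bigr => k _.
rewrite derive_mul // [RHS]addrC [dmx _ _ _ _ _]mxE; congr (_ + _); last by rewrite mulrC.
rewrite (derive_partial _ (dp k)) !mxE mulrC; congr (_ * _).
by apply: eq_bigr => i _; rewrite mxE.
Qed.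

(** In components, [d_k (X^i d_i Y^k) = d_k X^i d_i Y^k + X^i d_i (d_k Y^k)], by commuting partial
    derivatives. The first term is symmetric in [X] and [Y] and will cancel in [ldiv_lie]. *)
Lemma dir_tr_Dmat X Y y : smooth_mx_on U X -> smooth_mx_on U Y -> U y ->
  \tr (Dmat (fun z => dmx (X z) Y z) y) =
    \tr (Dmat X y *m Dmat Y y) + 'D_(X y) (fun z => \tr (Dmat Y z)) y.
Proof.
move=> sX sY Uy; rewrite derive_tr; last first.
  by move=> i j; exact: smooth_differentiable (smooth_Dmat sY i j) Uy.
rewrite -big_split /=; apply: eq_bigr => k _; rewrite mxE /partial.
derive_under ltac:(rewrite mxE).
rewrite (derive_dir _ sX (sY 0 k) Uy); congr (_ + _).
  rewrite derive_partial; last exact: smooth_differentiable (sY 0 k) Uy.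
  by rewrite mxE; apply: eq_bigr => i _; rewrite !mxE.
rewrite -rowE !mxE derive_partial; last first.
  exact: smooth_differentiable (smooth_Dmat sY k k) Uy.
apply: eq_bigr => i _; rewrite !mxE mulrC; congr (_ * _).
rewrite (partial_comm _ _ oU Uy (sY 0 k)); apply: eq_derive => z.
by rewrite mxE.
Qed.

(** The second-order expressions [tr (DX DY)] and [Hess psi (X, Y)] are symmetric in [X] and [Y], so
    they disappear from the difference. *)
Lemma ldiv_lie psi X Y y : smooth_on U psi -> smooth_mx_on U X -> smooth_mx_on U Y -> U y ->
  'D_(X y) (ldiv psi Y) y - 'D_(Y y) (ldiv psi X) y = ldiv psi (lie_bracket X Y) y.
Proof.
move=> sp sX sY Uy.
have dtr Z : smooth_mx_on U Z -> differentiable (fun z => \tr (Dmat Z z)) y.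
  move=> sZ; apply: differentiable_big => i _.
  exact: smooth_differentiable (smooth_Dmat sZ i i) Uy.
have dd Z : smooth_mx_on U Z -> differentiable (fun z => 'D_(Z z) psi z) y.
  by move=> sZ; exact: smooth_differentiable (smooth_on_dir sZ sp) Uy.
have DE Z u : smooth_mx_on U Z -> 'D_u (ldiv psi Z) y =
    'D_u (fun z => \tr (Dmat Z z)) y + 'D_u (fun z => 'D_(Z z) psi z) y.
  move=> sZ; rewrite [LHS]deriveD //; apply: diff_derivable; [exact: dtr|exact: dd].
rewrite !DE // /ldiv /lie_bracket.
have -> : Dmat (fun z => dmx (X z) Y z - dmx (Y z) X z) y =
    Dmat (fun z => dmx (X z) Y z) y - Dmat (fun z => dmx (Y z) X z) y.
  apply/matrixP => k i; rewrite !mxE /partial.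
  derive_under ltac:(rewrite mxE [X in _ + X]mxE).
  rewrite [LHS]deriveB //; apply: diff_derivable.
    exact: smooth_differentiable (smooth_mx_dir sX sY 0 i) Uy.
  exact: smooth_differentiable (smooth_mx_dir sY sX 0 i) Uy.
have trB (A B : 'M[R]_n) : \tr (A - B) = \tr A - \tr B by rewrite raddfB.
rewrite [X in _ = X + _]trB [X in _ = X - _ + _](dir_tr_Dmat sX sY Uy).
rewrite [X in _ = _ - X + _](dir_tr_Dmat sY sX Uy).
rewrite [X in _ + X - _ = _](derive_dir _ sY sp Uy) [X in _ - (_ + X) = _](derive_dir _ sX sp Uy).
have -> : 'D_(dmx (X y) Y y - dmx (Y y) X y) psi y =
    'D_(dmx (X y) Y y) psi y - 'D_(dmx (Y y) X y) psi y.
  have dpsi := smooth_differentiable sp Uy.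
  by rewrite !deriveE // linearB.
have -> : (Y y *m hessian psi y *m (X y)^T) 0 0 = (X y *m hessian psi y *m (Y y)^T) 0 0.
  rewrite -[LHS]mulr1 -[in LHS](trmxK (_ *m _ *m _)) mulr1 mxE.
  by rewrite !trmx_mul trmxK hessian_sym // mulmxA.
have aux (a b h a' b' t : R) :
    a + (b + h) - (a' + (b' + h)) = t + a - (t + a') + (b - b') by ring.
rewrite (mxtrace_mulC (Dmat Y y)); exact: aux.
Qed.

Lemma ldiv_sum psi (I : finType) (f : I -> 'rV[R]_n -> R) (X : I -> 'rV[R]_n -> 'rV[R]_n) y :
  smooth_on U psi -> (forall i, smooth_on U (f i)) -> (forall i, smooth_mx_on U (X i)) ->
  U y -> ldiv psi (fun z => \sum_i f i z *: X i z) y =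
    \sum_i (f i y * ldiv psi (X i) y + 'D_(X i y) (f i) y).
Proof.
move=> sp sf sX Uy.
have df i : differentiable (f i) y by exact: smooth_differentiable (sf i) Uy.
have dX i k : differentiable (fun z => X i z 0 k) y.
  exact: smooth_differentiable (sX i 0 k) Uy.
have dpsi := smooth_differentiable sp Uy.
rewrite [LHS]/ldiv.
have -> : 'D_(\sum_i f i y *: X i y) psi y = \sum_i f i y * 'D_(X i y) psi y.
  rewrite deriveE // linear_sum; apply: eq_bigr => i _.
  by rewrite linearZ /= deriveE.
have -> : \tr (Dmat (fun z => \sum_i f i z *: X i z) y) =
    \sum_i (f i y * \tr (Dmat (X i) y) + 'D_(X i y) (f i) y).
  transitivity (\sum_k \sum_i (f i y * partial k (fun z => X i z 0 k) y +
      X i y 0 k * partial k (f i) y)).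
    apply: eq_bigr => k _; rewrite mxE /partial.
    derive_under ltac:(rewrite summxE).
    rewrite derive_big.
      apply: eq_bigr => i _; derive_under ltac:(rewrite mxE).
      by rewrite derive_mul.
    move=> i _; diff_under ltac:(rewrite mxE).
    exact: differentiable_mul.
  rewrite exchange_big /=; apply: eq_bigr => i _.
  rewrite big_split /=; congr (_ + _); last by rewrite derive_partial.
  by rewrite mulr_sumr; apply: eq_bigr => k _; rewrite mxE.
rewrite -big_split /=; apply: eq_bigr => i _.
by rewrite /ldiv mulrDr addrAC.
Qed.

Section ChangeOfCoordinates.
Variables (W : set 'rV[R]_n) (T : 'rV[R]_n -> 'rV[R]_n).
Hypothesis sT : smooth_mx_on U T.
Hypothesis TW : forall z, U z -> W (T z).
Hypothesis DT_unit : forall z, U z -> Dmat T z \in unitmx.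

(** The divergence does not depend on coordinates: the change of [tr DX] is the derivative along [X]
    of [ln |det DT|] by Jacobi's formula, and the change of the log-density compensates it. *)
Lemma ldiv_transition psi psi' X X' y :
  smooth_mx_on U X -> smooth_mx_on W X' -> smooth_on W psi' -> U y ->
  (forall z, U z -> X' (T z) = X z *m Dmat T z) ->
  (forall z, U z -> psi z = psi' (T z) + ln `|\det (Dmat T z)|) ->
  ldiv psi X y = ldiv psi' X' (T y).
Proof.
move=> sX sX' sp' Uy XE pE.
set J := Dmat T y; have uJ : J \in unitmx by exact: DT_unit.
have mT := smooth_mx_mdiff sT Uy; have mX := smooth_mx_mdiff sX Uy.
have mJ := smooth_mx_mdiff (smooth_Dmat sT) Uy.
have mX' := smooth_mx_mdiff sX' (TW Uy).
(* The relation [X' (T z) = X z DT(z)] is differentiated along [v]. By symmetry of the second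
   derivatives of [T], the derivative of [DT] along [v] contracted with [X] is its derivative along
   [X] contracted with [v]. *)
have key : J *m Dmat X' (T y) = Dmat X y *m J + dmx (X y) (Dmat T) y.
  apply: row_mx_eq => v.
  have nE : {near y, (fun z => X' (T z)) =1 (fun z => X z *m Dmat T z)}.
    exact: open_near_eq oU Uy XE.
  have := near_eq_dmx v nE; rewrite dmx_comp // dmxM // !dmx_Dmat // mulmxA => ->.
  apply: (etrans _ (esym (mulmxDr v _ _))); apply: (congr2 +%R (esym (mulmxA v _ _)) _).
  apply/rowP => a; rewrite [LHS]mxE [RHS]mxE.
  transitivity (\sum_i \sum_k X y 0 i * (v 0 k * partial k (partial i (fun z => T z 0 a)) y)).
    apply: eq_bigr => i _; rewrite mxE derive_partial; last exact: mJ.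
    rewrite mulr_sumr; apply: eq_bigr => k _; congr (_ * (_ * _)).
    by apply: eq_derive => z; rewrite mxE.
  rewrite exchange_big /=; apply: eq_bigr => k _; rewrite mxE derive_partial; last exact: mJ.
  rewrite mulr_sumr; apply: eq_bigr => i _; rewrite mulrCA; congr (_ * (_ * _)).
  rewrite (partial_comm _ _ oU Uy (sT 0 a)).
  by apply: eq_derive => z; rewrite mxE.
have tr' : \tr (Dmat X' (T y)) = \tr (Dmat X y) + \tr (invmx J *m dmx (X y) (Dmat T) y).
  rewrite -[Dmat X' (T y)](mulKmx uJ) key mulmxDr mxtraceD mulmxA mxtrace_mulC.
  by rewrite mulmxA mulmxV // mul1mx.
have dJ : \det J != 0 by rewrite -unitfE -unitmxE.
have dD : 'D_(X y) (fun z => ln `|\det (Dmat T z)|) y = \tr (invmx J *m dmx (X y) (Dmat T) y).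
  have ddet := differentiable_det mJ.
  (* The determinant keeps its sign near [y], so the absolute value amounts to multiplication by a
     constant sign. *)
  have nE : {near y, (fun z => ln `|\det (Dmat T z)|) =1
      (fun z => ln (Num.sg (\det J) * \det (Dmat T z)))}.
    have cd : {for y, continuous (fun z => \det (Dmat T z))}.
      exact: differentiable_continuous.
    have pos : 0 < Num.sg (\det J) * \det J by rewrite -normrEsg normr_gt0.
    have : \forall z \near y, 0 < Num.sg (\det J) * \det (Dmat T z).
      have cs : {for y, continuous (fun z => Num.sg (\det J) * \det (Dmat T z))}.
        by apply: continuousM => //; exact: cst_continuous.
      by apply: (cs [set x | 0 < x]); exact: lt_nbhsr.
    apply: filterS => z z0; congr ln.
    have -> : `|\det (Dmat T z)| = `|Num.sg (\det J) * \det (Dmat T z)|.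
      by rewrite normrM normr_sg dJ mul1r.
    by rewrite gtr0_norm.
  rewrite (near_eq_derive _ nE).
  have pos : 0 < Num.sg (\det J) * \det J by rewrite -normrEsg normr_gt0.
  have dsd : differentiable (fun z => Num.sg (\det J) * \det (Dmat T z)) y.
    apply: differentiable_mul; [exact: differentiable_cst|exact: ddet].
  rewrite (derive_ln _ dsd pos).
  rewrite (derive_mul _ (differentiable_cst (Num.sg (\det J)) y) ddet).
  rewrite derive_cst mulr0 addr0 derive_det //.
  have -> : \adj (Dmat T y) = \det J *: invmx J.
    by rewrite /invmx uJ scalerA divff // scale1r.
  rewrite -scalemxAr mxtraceZ.
  have canc (a b t : R) : 0 < a * b -> (a * b)^-1 * (a * (b * t)) = t.
    by move=> ab; rewrite [a * (b * t)]mulrA mulrA mulVf ?mul1r // gt_eqF.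
  apply: (etrans (canc _ _ _ pos)).
  exact: mxtrace_mulC.
have ddpT : differentiable (fun z => psi' (T z)) y.
  by apply: differentiable_mdiff_comp => //; exact: smooth_differentiable sp' (TW Uy).
(* Here [|det|] is written as [sqrt (det^2)], whose argument is smooth and positive. *)
have ddl : differentiable (fun z => ln `|\det (Dmat T z)|) y.
  have := @smooth_on_ln _ _ U (fun z => Num.sqrt (\det (Dmat T z) * \det (Dmat T z))) oU.
  have p0 z : U z -> 0 < \det (Dmat T z) * \det (Dmat T z).
    by move=> Uz; rewrite -expr2 exprn_even_gt0 //= -unitfE -unitmxE DT_unit.
  have sd := smooth_on_det oU (smooth_Dmat sT).
  move=> /(_ _ _); have h1 z : U z -> 0 < Num.sqrt (\det (Dmat T z) * \det (Dmat T z)).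
    by move=> /p0; rewrite sqrtr_gt0.
  move=> /(_ h1 (smooth_on_sqrt oU p0 (smooth_onM oU sd sd))) sl.
  apply: eq_differentiable (smooth_differentiable sl Uy) => z.
  by rewrite -expr2 sqrtr_sqr.
rewrite /ldiv tr' -addrA; congr (_ + _).
rewrite (near_eq_derive _ (open_near_eq oU Uy pE)).
rewrite [LHS](@deriveD _ _ _ (fun z => psi' (T z))); last 2 first.
- exact: diff_derivable.
- exact: diff_derivable.
rewrite addrC dD; congr (_ + _).
rewrite (XE y Uy) (derive_comp _ mT (smooth_differentiable sp' (TW Uy))).
by rewrite (dmx_Dmat _ mT).
Qed.

End ChangeOfCoordinates.
End LocalCalculus.

(** * Poisson bivectors on open subsets of the coordinate space *)

Section LocalPoisson.
Context {R : realType} {n : nat}.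
Variables (U : set 'rV[R]_n) (oU : open U) (P : 'rV[R]_n -> 'M[R]_n).
Hypothesis sP : smooth_mx_on U P.
Hypothesis aP : forall y, U y -> (P y)^T = - P y.
Implicit Types (f psi : 'rV[R]_n -> R) (y z : 'rV[R]_n).

Definition prow i z : 'rV[R]_n := row i (P z).

Definition ham f z : 'rV[R]_n := gradient f z *m P z.

(* Row [i] of [P] is the hamiltonian vector field of the i-th coordinate, so this
   is the derivation [f |-> div X_f] in components. *)
Definition mvec psi z : 'rV[R]_n := \row_i ldiv psi (prow i) z.

Definition local_jacobi : Prop := forall y i j k, U y ->
  'D_(prow i y) (fun z => P z j k) y + 'D_(prow j y) (fun z => P z k i) y
    + 'D_(prow k y) (fun z => P z i j) y = 0.

Lemma smooth_prow i : smooth_mx_on U (prow i).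
Proof.
move=> a j; apply: (smooth_on_eq oU (f := fun z => P z i j)); last exact: sP.
by move=> z _; rewrite mxE.
Qed.

Lemma smooth_ham f : smooth_on U f -> smooth_mx_on U (ham f).
Proof. by move=> sf; apply: smooth_mx_mul => //; exact: smooth_gradient. Qed.

Lemma smooth_mvec psi : smooth_on U psi -> smooth_mx_on U (mvec psi).
Proof.
move=> sp a i; apply: (smooth_on_eq oU (f := ldiv psi (prow i))).
  by move=> z _; rewrite mxE.
by apply: smooth_on_ldiv => //; exact: smooth_prow.
Qed.

Lemma antisymE y i j : U y -> P y i j = - P y j i.
Proof. by move=> Uy; have /matrixP/(_ j i) := aP Uy; rewrite !mxE. Qed.

Lemma trace_antisym_sym (A B : 'M[R]_n) : A^T = - A -> B^T = B -> \tr (A *m B) = 0.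
Proof.
move=> AT BT; have : \tr (A *m B) = - \tr (A *m B).
  by rewrite -[LHS]mxtrace_tr trmx_mul AT BT mulmxN mxtrace_mulC raddfN.
by move/eqP; rewrite -subr_eq0 opprK -mulr2n mulrn_eq0 /= => /eqP.
Qed.

Lemma ldiv_eq psi X Y y : U y -> (forall z, U z -> X z = Y z) -> ldiv psi X y = ldiv psi Y y.
Proof.
move=> Uy XY; rewrite /ldiv XY //; congr (\tr _ + _); apply/matrixP => k i; rewrite !mxE.
by apply: (partial_eq_on _ oU _ Uy) => z Uz; rewrite XY.
Qed.

(** The second-order terms in [f] add up to [tr (P Hess f)], which vanishes because [P] is
    antisymmetric and the hessian symmetric. This makes [f |-> div X_f] a derivation. *)
Lemma ldiv_ham psi f y : smooth_on U psi -> smooth_on U f -> U y ->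
  ldiv psi (ham f) y = 'D_(mvec psi y) f y.
Proof.
move=> sp sf Uy.
rewrite (@ldiv_eq _ _ (fun z => \sum_i partial i f z *: prow i z)) //; last first.
  by move=> z _; rewrite /ham mulmx_sum_row; apply: eq_bigr => i _; rewrite mxE.
rewrite (ldiv_sum sp (fun i => smooth_partial i sf) smooth_prow Uy).
rewrite big_split /= [X in _ + X = _](_ : _ = 0); last first.
  transitivity (\tr (P y *m hessian f y)).
    rewrite /mxtrace; apply: eq_bigr => i _.
    rewrite derive_partial; last exact: smooth_differentiable (smooth_partial i sf) Uy.
    by rewrite mxE; apply: eq_bigr => k _; rewrite !mxE.
  exact: (trace_antisym_sym (aP Uy) (hessian_sym oU sf Uy)).
rewrite addr0 derive_partial; last exact: smooth_differentiable sf Uy.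
by apply: eq_bigr => i _; rewrite mxE mulrC.
Qed.

Hypothesis jP : local_jacobi.

Let dP y i j : U y -> differentiable (fun z => P z i j) y.
Proof. by move=> Uy; exact: smooth_differentiable (sP i j) Uy. Qed.

Let derive_antisym y i j u : U y ->
  'D_u (fun z => P z i j) y = - 'D_u (fun z => P z j i) y.
Proof.
move=> Uy; have nE : {near y, (fun z => P z i j) =1 (fun z => - P z j i)}.
  by apply: (open_near_eq oU Uy) => z Uz; exact: antisymE.
rewrite (near_eq_derive _ nE) [LHS]deriveN //; exact/diff_derivable/dP.
Qed.

(** The hamiltonian fields of two coordinates bracket to that of their Poisson bracket; component
    [j] is the Jacobi identity for [i], [k], [j]. *)
Lemma lie_prow i k y : U y ->
  lie_bracket (prow i) (prow k) y = ham (fun z => P z i k) y.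
Proof.
move=> Uy; apply/rowP => j; rewrite !mxE.
have -> : 'D_(prow i y) (fun z => prow k z 0 j) y = 'D_(prow i y) (fun z => P z k j) y.
  by apply: eq_derive => z; rewrite mxE.
have -> : 'D_(prow k y) (fun z => prow i z 0 j) y = 'D_(prow k y) (fun z => P z i j) y.
  by apply: eq_derive => z; rewrite mxE.
have := jP i k j Uy; rewrite (derive_antisym j i) // => J.
have -> : \sum_l gradient (fun z => P z i k) y 0 l * P y l j =
    - 'D_(prow j y) (fun z => P z i k) y.
  rewrite derive_partial; last exact: dP.
  rewrite -sumrN; apply: eq_bigr => l _; rewrite !mxE (antisymE l j) //.
  by rewrite mulrN mulrC.
apply/eqP; rewrite -subr_eq0 opprK; apply/eqP; exact: J.
Qed.

(* The invariance of [P] under [V = mvec psi]: apply [div [X, Y] = X div Y - Y div X]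
   to the rows of [P], whose brackets are hamiltonian by the Jacobi identity. *)
Lemma mvec_closed psi y : smooth_on U psi -> U y ->
  P y *m Dmat (mvec psi) y - (P y *m Dmat (mvec psi) y)^T = dmx (mvec psi y) P y.
Proof.
move=> sp Uy; have sm := smooth_mvec sp.
have E i k : (P y *m Dmat (mvec psi) y) i k = 'D_(prow i y) (ldiv psi (prow k)) y.
  transitivity ('D_(prow i y) (fun z => mvec psi z 0 k) y).
    rewrite derive_partial; last exact: smooth_differentiable (sm 0 k) Uy.
    by rewrite mxE; apply: eq_bigr => l _; rewrite !mxE.
  by apply: eq_derive => z; rewrite mxE.
apply/matrixP => i k; rewrite mxE [X in _ + X]mxE [X in _ - X]mxE !E [RHS]mxE.
rewrite (ldiv_lie oU sp (smooth_prow i) (smooth_prow k) Uy).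
rewrite -(ldiv_ham sp (sP i k) Uy); apply: ldiv_eq => // z Uz.
exact: lie_prow.
Qed.

(** This is [L_X P = 0] for [X = X_f]. The hessian enters through the symmetric matrix [P Hess f P]
    and cancels; what remains is the Jacobi identity contracted with [df]. *)
Lemma ham_lie f y : smooth_on U f -> U y ->
  dmx (ham f y) P y = (Dmat (ham f) y)^T *m P y + P y *m Dmat (ham f) y.
Proof.
move=> sf Uy; have sh := smooth_ham sf.
have df l : differentiable (partial l f) y by exact: smooth_differentiable (smooth_partial l sf) Uy.
have E i j : (P y *m Dmat (ham f) y) i j =
    (P y *m hessian f y *m P y) i j + \sum_l partial l f y * 'D_(prow i y) (fun z => P z l j) y.
  transitivity ('D_(prow i y) (fun z => ham f z 0 j) y).
    rewrite derive_partial; last exact: smooth_differentiable (sh 0 j) Uy.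
    by rewrite mxE; apply: eq_bigr => l _; rewrite !mxE.
  derive_under ltac:(rewrite mxE).
  rewrite derive_big; last first.
    move=> l _; apply: differentiable_mul; last exact: dP.
    by apply: eq_differentiable (df l) => z; rewrite mxE.
  rewrite mxE -big_split /=; apply: eq_bigr => l _.
  rewrite derive_mul; [|by apply: eq_differentiable (df l) => z; rewrite mxE|exact: dP].
  rewrite addrC mxE; congr (_ + _); rewrite mulrC; congr (_ * _).
  transitivity ('D_(prow i y) (partial l f) y); first by apply: eq_derive => z; rewrite mxE.
  by rewrite derive_partial // mxE; apply: eq_bigr => k _; rewrite !mxE.
have ET : (Dmat (ham f) y)^T *m P y = - (P y *m Dmat (ham f) y)^T.
  by rewrite trmx_mul aP // mulmxN opprK.
apply/matrixP => i j; rewrite ET [RHS]mxE [X in _ = X + _]mxE [X in _ = - X + _]mxE !E.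
have -> : (P y *m hessian f y *m P y) j i = (P y *m hessian f y *m P y) i j.
  transitivity ((P y *m hessian f y *m P y)^T i j); first by rewrite [RHS]mxE.
  by rewrite !trmx_mul (aP Uy) (hessian_sym oU sf Uy) mulNmx !mulmxN opprK mulmxA.
have -> (a b c : R) : - (a + b) + (a + c) = c - b by ring.
rewrite [LHS]mxE [LHS]derive_partial; last exact: dP.
rewrite -sumrB.
transitivity (\sum_l partial l f y * 'D_(prow l y) (fun z => P z i j) y).
  transitivity (\sum_k \sum_l partial l f y * (P y l k * partial k (fun z => P z i j) y)).
    apply: eq_bigr => k _; rewrite mxE mulr_suml; apply: eq_bigr => l _.
    by rewrite mxE mulrA.
  rewrite exchange_big /=; apply: eq_bigr => l _; rewrite derive_partial; last exact: dP.
  by rewrite mulr_sumr; apply: eq_bigr => k _; rewrite mxE.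
apply: eq_bigr => l _; rewrite -mulrBr; congr (_ * _).
have := jP l i j Uy; rewrite (derive_antisym j l) // => J.
have aux (r s t : R) : r + - s + t = 0 -> r = s - t.
  by move/eqP; rewrite addrAC subr_eq0 => /eqP <-; rewrite addrK.
exact: aux J.
Qed.

(** The left side is [2 (delta V)(a, b)]. Since [- (P DV)^T = (DV)^T P], the right side is
    [- (L_V P)(a, b)]: all derivatives of [a] and [b] cancel. *)
Lemma delta_local (a b V : 'rV[R]_n -> 'rV[R]_n) y :
  smooth_mx_on U a -> smooth_mx_on U b -> smooth_mx_on U V -> U y ->
  let Xa z := a z *m P z in let Xb z := b z *m P z in
  'D_(Xa y) (fun z => (b z *m (V z)^T) 0 0) y - 'D_(Xb y) (fun z => (a z *m (V z)^T) 0 0) y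
  - ((Xa y *m Dmat b y + b y *m (Dmat Xa y)^T - (Xb y *m Dmat a y + a y *m (Dmat Xb y)^T)
      - gradient (fun z => (a z *m P z *m (b z)^T) 0 0) y) *m (V y)^T) 0 0
  = (a y *m (P y *m Dmat V y - (P y *m Dmat V y)^T - dmx (V y) P y) *m (b y)^T) 0 0.
Proof.
move=> sa sb sV Uy Xa Xb.
have ma := smooth_mx_mdiff sa Uy; have mb := smooth_mx_mdiff sb Uy.
have mV := smooth_mx_mdiff sV Uy; have mP := smooth_mx_mdiff sP Uy.
have mXa : mdiff Xa y by exact: mdiffM.
have mXb : mdiff Xb y by exact: mdiffM.
have mVT : mdiff (fun z => (V z)^T) y by exact: mdiff_tr.
have D1 u (w : 'rV[R]_n -> 'rV[R]_n) : mdiff w y ->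
    'D_u (fun z => (w z *m (V z)^T) 0 0) y =
    (u *m Dmat w y *m (V y)^T + w y *m (u *m Dmat V y)^T) 0 0.
  move=> mw; transitivity (dmx u (fun z => w z *m (V z)^T) y 0 0); first by rewrite mxE.
  by rewrite dmxM // dmx_tr !dmx_Dmat.
rewrite !D1 //.
have dg : (gradient (fun z => (a z *m P z *m (b z)^T) 0 0) y *m (V y)^T) 0 0 =
    (V y *m Dmat a y *m P y *m (b y)^T + a y *m dmx (V y) P y *m (b y)^T
     + a y *m P y *m (V y *m Dmat b y)^T) 0 0.
  transitivity ('D_(V y) (fun z => (Xa z *m (b z)^T) 0 0) y).
    rewrite derive_gradient; last first.
      by apply: (mdiffM mXa (mdiff_tr mb)).
    transitivity (((gradient (fun z => (Xa z *m (b z)^T) 0 0) y *m (V y)^T)^T) 0 0).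
      by rewrite [RHS]mxE.
    by rewrite trmx_mul trmxK.
  transitivity (dmx (V y) (fun z => Xa z *m (b z)^T) y 0 0); first by rewrite mxE.
  rewrite dmxM //; last exact: mdiff_tr.
  by rewrite /Xa (dmxM (V y) ma mP) dmx_tr (dmx_Dmat _ ma) (dmx_Dmat _ mb) mulmxDl.
have DXa : V y *m Dmat Xa y = V y *m Dmat a y *m P y + a y *m dmx (V y) P y.
  by rewrite -dmx_Dmat // (dmxM _ ma mP) dmx_Dmat.
have DXb : V y *m Dmat Xb y = V y *m Dmat b y *m P y + b y *m dmx (V y) P y.
  by rewrite -dmx_Dmat // (dmxM _ mb mP) dmx_Dmat.
have PVT : (dmx (V y) P y)^T = - dmx (V y) P y.
  apply/matrixP => i j; rewrite !mxE; exact: derive_antisym.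
have PT := aP Uy.
have E (A B : 'M[R]_1) : (A + B) 0 0 = A 0 0 + B 0 0 by rewrite mxE.
have EN (A : 'M[R]_1) : (- A) 0 0 = - A 0 0 by rewrite mxE.
rewrite [in LHS](mulmxBl _ (gradient _ _)) [X in _ - X = _]E [X in _ - (_ + X) = _]EN dg.
move: DXa DXb PVT PT; rewrite /Xa /Xb.
move: (Dmat (fun z => a z *m P z) y) (Dmat (fun z => b z *m P z) y) (dmx (V y) P y).
move: (Dmat a y) (Dmat b y) (Dmat V y) (a y) (b y) (V y) (P y).
move=> Da Db DV a' b' v P' DXa DXb PV EXa EXb PVT PT.
have sw (A : 'M[R]_1) : A^T 0 0 = A 0 0 by rewrite mxE.
have q1 : (b' *m (a' *m P' *m DV)^T) 0 0 = (a' *m (P' *m DV) *m b'^T) 0 0.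
  by rewrite -sw trmx_mul trmxK mulmxA.
have q2 : (a' *m (b' *m P' *m DV)^T) 0 0 = (a' *m (P' *m DV)^T *m b'^T) 0 0.
  by rewrite -mulmxA trmx_mul -mulmxA -trmx_mul.
have s1 : (b' *m DXa^T *m v^T) 0 0 = (v *m Da *m P' *m b'^T) 0 0 + (a' *m PV *m b'^T) 0 0.
  by rewrite -mulmxA -trmx_mul EXa -sw trmx_mul trmxK mulmxDl mxE.
have s2 : (a' *m DXb^T *m v^T) 0 0 =
    - (a' *m P' *m (v *m Db)^T) 0 0 - (a' *m PV *m b'^T) 0 0.
  rewrite -mulmxA -trmx_mul EXb raddfD /= mulmxDr mxE.
  rewrite !trmx_mul PT PVT !mulNmx !mulmxN -!mulmxA.
  by rewrite [in LHS]mxE [X in _ + X]mxE.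
rewrite !mulmxBl !mulmxDl !mulmxBr !mulmxBl.
rewrite !(E, EN) q1 q2 s1 s2.
ring.
Qed.

End LocalPoisson.

(** * The modular vector field *)

Section Globalization.
Context {R : realType} {n : nat} {M : smoothManifold R n}.
Implicit Types (c : chart R n M) (X Y V al be : rowfield M) (f g mu : M -> R).

Lemma cutoff_exists_open c (W : set 'rV[R]_n) y0 : atlas c -> open W -> W `<=` cimage c -> W y0 ->
  exists chi (B : set 'rV[R]_n),
    [/\ cutoff c W chi, open B, B y0, B `<=` W & forall z, B z -> chi (cinv c z) = 1].
Proof.
move=> ac oW Wc Wy0; have [chi cchi chi1] := cutoff_exists ac oW Wc Wy0.
have nW : nbhs y0 W by exact: open_nbhs_nbhs.
have : nbhs y0 (W `&` [set z | chi (cinv c z) = 1]) by exact: filterI.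
rewrite nbhsE => -[B [oO By0] BW].
by exists chi, B; split=> // z /BW[].
Qed.

(** Coordinates are only local functions; these global substitutes transfer identities between
    global functions, such as the Jacobi identity, to components. *)
Lemma coordinate_function c (y : 'rV[R]_n) i : atlas c -> cimage c y ->
  exists f (B : set 'rV[R]_n), [/\ smooth_fun f, open B, B y, B `<=` cimage c &
    forall z, B z -> (f \o cinv c) z = z 0 i].
Proof.
move=> ac cy; have oc := open_cimage ac.
have [chi [B [cchi oO By BW chi1]]] := cutoff_exists_open ac oc (fun z cz => cz) cy.
exists (fun_ext c chi (fun z => z 0 i)), B; split=> //.
  by apply: (smooth_fun_ext ac oc cchi); exact: smooth_on_coord.
by move=> z Oz; rewrite /= (fun_extE ac) ?chi1 ?mul1r //; exact: BW.
Qed.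

Lemma jac_unit c c' p : atlas c -> atlas c' -> dom c p -> dom c' p ->
  jac c c' p \in unitmx.
Proof.
by move=> ac ac' cp c'p; have [uJ _] := mulmx1_unit (jacK ac ac' cp c'p); exact: uJ.
Qed.

Variable P : tensor2 M.

Lemma bivcoord_antisym c y : bivector_field P -> (bivcoord c P y)^T = - bivcoord c P y.
Proof.
move=> [aP _]; rewrite /bivcoord; move: (jac _ _ _) => J.
by rewrite !trmx_mul trmxK aP mulNmx mulmxN mulmxA.
Qed.

Lemma gradient_dform c f y : atlas c -> cimage c y -> smooth_fun f ->
  fcoord c (dform f) y = gradient (f \o cinv c) y.
Proof. by move=> ac cy sf; rewrite fcoord_dform. Qed.

Lemma vcoord_ham c f y : atlas c -> cimage c y -> smooth_fun f ->
  vcoord c (sharp P (dform f)) y = ham (bivcoord c P) (f \o cinv c) y.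
Proof. by move=> ac cy sf; rewrite vcoord_sharp // gradient_dform. Qed.

Lemma pbracket_coord c f g y : atlas c -> cimage c y -> smooth_fun f -> smooth_fun g ->
  pbracket P f g (cinv c y) = 'D_(ham (bivcoord c P) (f \o cinv c) y) (g \o cinv c) y.
Proof.
move=> ac cy sf sg; rewrite /pbracket eval2_form_coord // !gradient_dform //.
by rewrite [RHS]derive_gradient //; exact: smooth_differentiable (sg _ ac) cy.
Qed.

Lemma poisson_jacobi c : atlas c -> is_poisson P ->
  local_jacobi (cimage c) (bivcoord c P).
Proof.
move=> ac [bP jP] y i j k cy; have [_ sP] := bP.
have [fi [Oi [si oi Oiy Oic fiE]]] := coordinate_function i ac cy.
have [fj [Oj [sj oj Ojy Ojc fjE]]] := coordinate_function j ac cy.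
have [fk [Ok [sk ok Oky Okc fkE]]] := coordinate_function k ac cy.
have hamE f (B : set 'rV[R]_n) a z : open B -> (forall z, B z -> (f \o cinv c) z = z 0 a) ->
    B z -> ham (bivcoord c P) (f \o cinv c) z = prow (bivcoord c P) a z.
  move=> oO fE Oz; rewrite /ham /prow rowE; congr (_ *m _); apply/rowP => b.
  rewrite !mxE (partial_eq_on b oO fE Oz) partial_coord eq_sym.
  by rewrite eqxx.
have brE f g (B B' : set 'rV[R]_n) a b z : smooth_fun f -> smooth_fun g -> open B -> open B' ->
    B `<=` cimage c -> (forall z, B z -> (f \o cinv c) z = z 0 a) ->
    (forall z, B' z -> (g \o cinv c) z = z 0 b) -> B z -> B' z ->
    pbracket P f g (cinv c z) = bivcoord c P z a b.
  move=> sf sg oO oO' Oc fE gE Oz B'z; rewrite pbracket_coord //; last exact: Oc.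
  rewrite (hamE f B a) // (near_eq_derive _ (open_near_eq oO' B'z gE)) derive_coord.
  by rewrite mxE.
have sbr f g : smooth_fun f -> smooth_fun g -> smooth_fun (pbracket P f g).
  by move=> sf sg; apply: smooth_eval2 => //; exact: one_form_dform.
have trip f g h (B B' B'' : set 'rV[R]_n) a b d : smooth_fun f -> smooth_fun g -> smooth_fun h ->
    open B -> open B' -> open B'' -> B `<=` cimage c -> B' `<=` cimage c ->
    (forall z, B z -> (f \o cinv c) z = z 0 a) ->
    (forall z, B' z -> (g \o cinv c) z = z 0 b) ->
    (forall z, B'' z -> (h \o cinv c) z = z 0 d) -> B y -> B' y -> B'' y ->
    pbracket P f (pbracket P g h) (cinv c y) =
      'D_(prow (bivcoord c P) a y) (fun z => bivcoord c P z b d) y.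
  move=> sf sg sh oO oO' oO'' Oc Oc' fE gE hE By B'y B''y.
  rewrite pbracket_coord //; last exact: sbr.
  rewrite (hamE f B a) //; apply: near_eq_derive.
  have oI : open (B' `&` B'') by exact: openI.
  by apply: (open_near_eq oI) => // z [B'z B''z]; exact: (brE g h B' B'').
have := congr1 (fun F => F (cinv c y)) (jP fi fj fk si sj sk).
rewrite /= -[LHS]/(_ (cinv c y) + _ (cinv c y) + _ (cinv c y)).
rewrite (trip fi fj fk Oi Oj Ok i j k) // (trip fj fk fi Oj Ok Oi j k i) //.
by rewrite (trip fk fi fj Ok Oi Oj k i j).
Qed.

Definition log_density c mu (y : 'rV[R]_n) : R := ln (denscoord c mu y).

Section Measure.
Variables (mu : M -> R) (smu : smooth_positive_measure mu).

Lemma denscoord_gt0 c y : atlas c -> cimage c y -> 0 < denscoord c mu y.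
Proof.
move=> ac cy; rewrite /denscoord mulr_gt0 //; first by case: smu.
have [aa da] := chart_atP (cinv c y); rewrite normr_gt0 -unitfE -unitmxE.
exact: (jac_unit ac aa (dom_cinv ac cy) da).
Qed.

Lemma smooth_log_density c : atlas c -> smooth_on (cimage c) (log_density c mu).
Proof.
move=> ac; apply: smooth_on_ln; [exact: open_cimage| |by case: smu => _; apply].
by move=> y; exact: denscoord_gt0.
Qed.

Lemma denscoord_transition c c' y : atlas c -> atlas c' -> overlap c c' y ->
  denscoord c mu y = denscoord c' mu (transition c c' y) * `|\det (jac c c' (cinv c y))|.
Proof.
move=> ac ac' yo; have [cy c'y] := yo.
rewrite /denscoord (cinv_transition ac' yo); have [aa da] := chart_atP (cinv c y).
rewrite -(jac_comp ac ac' aa (dom_cinv ac cy) c'y da) det_mulmx normrM.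
by rewrite [X in _ * X = _]mulrC [LHS]mulrA.
Qed.

(** [divergence] is computed in the preferred chart of each point; [ldiv_transition] carries the
    formula to a fixed chart, where it can be differentiated. *)
Lemma divergence_coord c X y : atlas c -> vector_field X -> cimage c y ->
  divergence mu X (cinv c y) = ldiv (log_density c mu) (vcoord c X) y.
Proof.
move=> ac sX cy; set p := cinv c y; have [aa da] := chart_atP p.
set ca := chart_at p in aa da *; have cp : dom c p by exact: dom_cinv.
have yo : overlap c ca y by split.
have Ty : transition c ca y = cmap ca p by [].
(* In the preferred chart this is [d_i (rho X^i) / rho = d_i X^i + X^i d_i (ln rho)]. *)
transitivity (ldiv (log_density ca mu) (vcoord ca X) (cmap ca p)).
  have cay := cimage_cmap da.
  rewrite /divergence /lie_density -/ca /ldiv -(denscoord_at mu p) -/ca.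
  have dd := smooth_differentiable (smu.2 _ aa) cay.
  have d0 := denscoord_gt0 aa cay.
  have dv i : differentiable (fun z => vcoord ca X z 0 i) (cmap ca p).
    exact: smooth_differentiable (sX _ aa 0 i) cay.
  rewrite derive_ln // derive_partial // -[in LHS](mulrC _^-1) mulr_sumr.
  rewrite mulr_sumr -big_split /=; apply: eq_bigr => i _.
  rewrite [in LHS]/partial derive_mul; [|exact: dd|exact: dv].
  rewrite [LHS]mulrDr; apply: (congr2 +%R _ erefl).
  by rewrite [RHS]mxE (mulKf (lt0r_neq0 d0)).
have DJ z : overlap c ca z -> Dmat (transition c ca) z = jac c ca (cinv c z).
  move=> zo; have [cz caz] := zo; apply/matrixP => i j.
  rewrite mxE jacE (cinvK ac cz); apply/esym/jacobianE.
  exact: smooth_mx_mdiff (smooth_transition ac aa) zo.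
have uJ z : overlap c ca z -> Dmat (transition c ca) z \in unitmx.
  move=> zo; have [cz caz] := zo; rewrite (DJ z zo).
  exact: (jac_unit ac aa (dom_cinv ac cz) caz).
have TW z : overlap c ca z -> cimage ca (transition c ca z).
  by move=> zo; exact: cimage_transition.
have sXo : smooth_mx_on (overlap c ca) (vcoord c X).
  by move=> i j; apply: smooth_on_sub (sX _ ac i j) => z [].
have XE z : overlap c ca z ->
    vcoord ca X (transition c ca z) = vcoord c X z *m Dmat (transition c ca) z.
  by move=> zo; rewrite (DJ z zo); exact: vcoord_transition.
have pE z : overlap c ca z -> log_density c mu z =
    log_density ca mu (transition c ca z) + ln `|\det (Dmat (transition c ca) z)|.
  move=> zo; have uz := uJ z zo.
  rewrite /log_density (denscoord_transition ac aa zo) -(DJ z zo) lnM // posrE.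
    by apply: denscoord_gt0 => //; exact: TW.
  by rewrite normr_gt0 -unitfE -unitmxE.
rewrite -Ty; apply/esym.
exact: (ldiv_transition (open_overlap ac aa) (smooth_transition ac aa) TW uJ sXo
  (sX _ aa) (smooth_log_density aa) yo XE pE).
Qed.

Hypothesis pP : is_poisson P.
Let bP : bivector_field P. Proof. by case: pP. Qed.

(** Assembled from the preferred charts; its components in other charts are found by testing
    [dir_modvec] on coordinate functions, without a transformation rule for [mvec]. *)
Definition modvec : rowfield M := fun p =>
  mvec (bivcoord (chart_at p) P) (log_density (chart_at p) mu) (cmap (chart_at p) p).

Lemma divergence_ham c f y : atlas c -> cimage c y -> smooth_fun f ->
  divergence mu (sharp P (dform f)) (cinv c y) =
    'D_(mvec (bivcoord c P) (log_density c mu) y) (f \o cinv c) y.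
Proof.
move=> ac cy sf; have [_ sP] := bP.
rewrite divergence_coord //; last by apply: vector_field_sharp => //; exact: one_form_dform.
rewrite (ldiv_eq (open_cimage ac) _ (Y := ham (bivcoord c P) (f \o cinv c))) //.
  apply: (ldiv_ham (open_cimage ac) (sP _ ac)) => //.
  - by move=> z _; exact: bivcoord_antisym.
  - exact: smooth_log_density.
  - exact: sf.
by move=> z cz; exact: vcoord_ham.
Qed.

Lemma dir_modvec f : smooth_fun f -> dir modvec f = divergence mu (sharp P (dform f)).
Proof.
move=> sf; apply/funext => p; have [aa da] := chart_atP p.
have E := divergence_ham aa (cimage_cmap da) sf; rewrite (cmapK aa da) in E.
by rewrite E (dir_at _ _ sf).
Qed.

Lemma vcoord_modvec c y : atlas c -> cimage c y ->
  vcoord c modvec y = mvec (bivcoord c P) (log_density c mu) y.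
Proof.
move=> ac cy; apply/rowP => i.
have [f [B [sf oO By Oc fE]]] := coordinate_function i ac cy.
have nE := open_near_eq oO By fE.
have := congr1 (fun F => F (cinv c y)) (dir_modvec sf).
by rewrite /= dir_coord // divergence_ham // !(near_eq_derive _ nE) !derive_coord.
Qed.

Lemma vector_field_modvec : vector_field modvec.
Proof.
move=> c ac; have [_ sP] := bP; have oc := open_cimage ac.
apply: (smooth_mx_eq oc (F := mvec (bivcoord c P) (log_density c mu))).
  by move=> y cy; rewrite vcoord_modvec.
by apply: (smooth_mvec oc (sP _ ac)); exact: smooth_log_density.
Qed.

Lemma modular_field_modvec : modular_field P mu modvec.
Proof. by split; [exact: vector_field_modvec|exact: dir_modvec]. Qed.

End Measure.

Lemma delta_fun f al : delta P (mv_fun f) [:: al] = dir (sharp P al) f.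
Proof.
apply/funext => x; rewrite /delta /= !big_ord1 big_pred0; last by case=> [[|m] Hm].
by rewrite expr0 mul1r mulr0 addr0 invr1 mul1r.
Qed.

Lemma delta_vector V al be x : delta P (mv_vector V) [:: al; be] x =
  2^-1 * (dir (sharp P al) (pairing be V) x - dir (sharp P be) (pairing al V) x
          - pairing (form_bracket P al be) V x).
Proof.
rewrite /delta /= -mulrDr; congr (_ * _).
rewrite !big_ord_recl !big_ord0 /= !big_mkcond !big_ord_recl !big_ord0 /=.
rewrite /bump /= !addr0 !expr0 !mul1r expr1 !mulN1r.
rewrite big_pred0; last by case=> [[|[|m]] Hm].
by rewrite /mv_vector /omit /= addr0 add0r.
Qed.

Lemma form_bracket_coord (pP : bivector_field P) al be p : one_form al -> one_form be ->
  let c := chart_at p in let y := cmap c p in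
  let Xa z := fcoord c al z *m bivcoord c P z in
  let Xb z := fcoord c be z *m bivcoord c P z in
  form_bracket P al be p =
    Xa y *m Dmat (fcoord c be) y + be p *m (Dmat Xa y)^T
    - (Xb y *m Dmat (fcoord c al) y + al p *m (Dmat Xb y)^T)
    - gradient (fun z => (fcoord c al z *m bivcoord c P z *m (fcoord c be z)^T) 0 0) y.
Proof.
move=> sal sbe c y Xa Xb; have [ac cp] := chart_atP p.
have oc := open_cimage ac; have cy := cimage_cmap cp.
have DX ga z : one_form ga -> cimage c z -> Dmat (vcoord c (sharp P ga)) z =
    Dmat (fun w => fcoord c ga w *m bivcoord c P w) z.
  move=> sga cz; apply/matrixP => k i; rewrite !mxE.
  by apply: (partial_eq_on _ oc _ cz) => w cw; rewrite vcoord_sharp.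
have LE X ga : lie_form X ga p = X p *m Dmat (fcoord c ga) y + ga p *m (Dmat (vcoord c X) y)^T.
  apply/rowP => j; rewrite mxE [RHS]mxE [X in _ = X + _]mxE [X in _ = _ + X]mxE -big_split /=.
  by apply: eq_bigr => i _; rewrite !mxE.
rewrite /form_bracket -[LHS]/(lie_form _ _ p - lie_form _ _ p - dform _ p) !LE.
rewrite (DX al y sal cy) (DX be y sbe cy).
rewrite -(vcoord_at (sharp P al)) -(vcoord_at (sharp P be)) !(vcoord_sharp ac cy).
congr (_ - _); rewrite -(fcoord_at (dform _)) gradient_dform //; last exact: smooth_eval2.
apply/rowP => j; rewrite !mxE; apply: (partial_eq_on _ oc _ cy) => w cw /=.
by rewrite eval2_form_coord.
Qed.

Lemma delta_vector_coord (pP : bivector_field P) V al be p :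
  one_form al -> one_form be -> vector_field V ->
  let c := chart_at p in let y := cmap c p in
  let Q := bivcoord c P y *m Dmat (vcoord c V) y in
  delta P (mv_vector V) [:: al; be] p =
  2^-1 * (al p *m (Q - Q^T - dmx (V p) (bivcoord c P) y) *m (be p)^T) 0 0.
Proof.
move=> sal sbe sV c y Q; have [ac cp] := chart_atP p.
have oc := open_cimage ac; have cy := cimage_cmap cp; have [_ sP] := pP.
rewrite delta_vector; congr (_ * _).
have aP z : cimage c z -> (bivcoord c P z)^T = - bivcoord c P z.
  by move=> _; exact: bivcoord_antisym.
have := delta_local oc (sP _ ac) aP (sal _ ac) (sbe _ ac) (sV _ ac) cy.
rewrite /= !fcoord_at !vcoord_at -/c -/y => <-.
have dE ga ga' : one_form ga -> one_form ga' -> dir (sharp P ga) (pairing ga' V) p =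
    'D_(ga p *m bivcoord c P y) (fun z => (fcoord c ga' z *m (vcoord c V z)^T) 0 0) y.
  move=> sga sga'; rewrite dir_at; last exact: smooth_pairing.
  rewrite -(vcoord_at (sharp P ga)) (vcoord_sharp ac cy) fcoord_at.
  apply: near_eq_derive; apply: (open_near_eq oc cy) => z cz /=.
  by rewrite pairing_coord.
rewrite (dE al be sal sbe) (dE be al sbe sal).
apply: (congr2 (fun a b : R => a - b) erefl).
rewrite /pairing (form_bracket_coord pP p sal sbe).
rewrite !fcoord_at -/c -/y.
reflexivity.
Qed.

(** By [delta_vector_coord] the differential is [- L_V P / 2], and [mvec_closed] states that
    [L_V P = 0]. *)
Lemma delta_closed_modvec mu : smooth_positive_measure mu -> is_poisson P ->
  delta_closed P (modvec mu).
Proof.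
move=> smu pP al be sal sbe; have [bP _] := pP; apply/funext => p.
have [ac cp] := chart_atP p; have cy := cimage_cmap cp.
have oc := open_cimage ac; have [_ sP] := bP.
have sV := vector_field_modvec smu pP.
rewrite delta_vector_coord //.
have aP z : cimage (chart_at p) z -> (bivcoord (chart_at p) P z)^T = - bivcoord (chart_at p) P z.
  by move=> _; exact: bivcoord_antisym.
have DV : Dmat (vcoord (chart_at p) (modvec mu)) (cmap (chart_at p) p) =
    Dmat (mvec (bivcoord (chart_at p) P) (log_density (chart_at p) mu)) (cmap (chart_at p) p).
  apply/matrixP => k i; rewrite !mxE; apply: (partial_eq_on _ oc _ cy) => w cw.
  by rewrite vcoord_modvec.
rewrite DV (mvec_closed oc (sP _ ac) aP (poisson_jacobi ac pP) (smooth_log_density smu ac) cy).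
by rewrite subrr mulmx0 mul0mx mxE mulr0.
Qed.

End Globalization.

(** * The rank along symplectic leaves *)

Section AntisymmetricMatrix.
Context {F : fieldType} {n : nat}.

(** By antisymmetry, columns with the same indices as a row basis span all columns. Cutting [L P]
    down to these columns therefore loses no rank, and the principal block is invertible. *)
Lemma antisym_minor (P : 'M[F]_n) : P^T = - P ->
  exists L : 'M[F]_(\rank P, n), L *m P *m L^T \in unitmx.
Proof.
move=> PT; pose f := maxrankfun P; exists (rowsub f 1%:M).
set L := rowsub f 1%:M; have LP : L *m P = rowsub f P by rewrite /L -rowsubE.
have : (P <= L *m P)%MS by rewrite LP eq_maxrowsub.
case/submxP => Z PZ.
have E : L *m P = L *m P *m L^T *m Z^T.
  have PE : P = - (L *m P)^T *m Z^T by rewrite mulNmx -trmx_mul -PZ PT opprK.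
  apply: (etrans (congr1 (mulmx L) PE)).
  by rewrite trmx_mul PT !mulNmx opprK !mulmxA.
rewrite -row_free_unit /row_free eqn_leq rank_leq_row /=.
have fr : row_free (L *m P) by rewrite LP; exact: maxrowsub_free.
apply: (leq_trans (n := \rank (L *m P))); first by rewrite (eqP fr).
by rewrite (congr1 mxrank E); exact: mxrankM_maxl.
Qed.

Variables (r : nat) (P : 'M[F]_n) (L : 'M[F]_(r, n)).
Hypothesis uA : L *m P *m L^T \in unitmx.

(* A generalized inverse of [P] as soon as [P] has rank [r]. *)
Definition minor_inv : 'M[F]_n := L^T *m invmx (L *m P *m L^T) *m L.

Lemma rank_ge_minor : (r <= \rank P)%N.
Proof.
have : \rank (L *m P *m L^T) = r by apply/eqP; rewrite -[_ == r]/(row_free _) row_free_unit.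
move=> {1}<-; apply: leq_trans (mxrankM_maxl _ _) _; exact: mxrankM_maxr.
Qed.

(** At rank [r] the rows of [L P] span those of [P]. From [P = Z L P] one gets [P K = Z L] for [K]
    the matrix [minor_inv], whence [P K P = P]. *)
Lemma schur_eq0 : \rank P = r -> P - P *m minor_inv *m P = 0.
Proof.
move=> rP; have : (P <= L *m P)%MS.
  have sLP : (L *m P <= P)%MS by exact: submxMl.
  rewrite -(geq_leqif (mxrank_leqif_sup sLP)) rP.
  have : \rank (L *m P *m L^T) = r by apply/eqP; rewrite -[_ == r]/(row_free _) row_free_unit.
  by move=> {1}<-; exact: mxrankM_maxl.
case/submxP => Z PZ; apply/eqP; rewrite subr_eq0; apply/eqP.
have -> : P *m minor_inv = Z *m L.
  have E : P *m L^T = Z *m (L *m P *m L^T) by rewrite {1}PZ !mulmxA.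
  by rewrite /minor_inv !mulmxA E mulmxK.
by rewrite {1}PZ mulmxA.
Qed.

(** If [P = P K P], then [P] factors through dimension [r], as [K] does; the invertible block gives
    the other inequality. *)
Lemma rank_schur0 : P - P *m minor_inv *m P = 0 -> \rank P = r.
Proof.
move/eqP; rewrite subr_eq0 => /eqP PE; apply/eqP; rewrite eqn_leq rank_ge_minor andbT.
rewrite PE /minor_inv; apply: leq_trans (mxrankM_maxl _ _) _.
apply: leq_trans (mxrankM_maxr _ _) _; apply: leq_trans (mxrankM_maxr _ _) _.
exact: rank_leq_row.
Qed.

End AntisymmetricMatrix.

(** * Derivatives of the Schur complement *)

Section Schur.
Context {R : realType} {n : nat}.
Variables (U : set 'rV[R]_n) (oU : open U) (P : 'rV[R]_n -> 'M[R]_n).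
Hypothesis sP : smooth_mx_on U P.
Variables (r : nat) (L : 'M[R]_(r, n)).

Definition minor_set : set 'rV[R]_n := [set y | U y /\ L *m P y *m L^T \in unitmx].

Definition schur y : 'M[R]_n := P y - P y *m minor_inv (P y) L *m P y.

Let sA : smooth_mx_on U (fun y => L *m P y *m L^T).
Proof.
apply: smooth_mx_mul => //; last exact: smooth_mx_cst.
by apply: smooth_mx_mul => //; exact: smooth_mx_cst.
Qed.

Lemma open_minor_set : open minor_set.
Proof.
rewrite openE => y [Uy uA].
have cd : {for y, continuous (fun z => \det (L *m P z *m L^T))}.
  by apply: differentiable_continuous; exact: smooth_differentiable (smooth_on_det oU sA) Uy.
have nU : nbhs y U by exact: open_nbhs_nbhs.
have d0 : \det (L *m P y *m L^T) != 0 by rewrite -unitfE -unitmxE.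
have nD : \forall z \near y, \det (L *m P z *m L^T) != 0.
  apply: (cd [set x | x != 0]).
  by apply: open_nbhs_nbhs; split=> //; exact: open_neq.
apply: filterS2 nU nD => z Uz dz; split=> //.
by rewrite unitmxE unitfE.
Qed.

Let sub_minor : minor_set `<=` U.
Proof. by move=> y []. Qed.

Let sP' : smooth_mx_on minor_set P.
Proof. by move=> i j; exact: smooth_on_sub sub_minor (sP i j). Qed.

Let sA' : smooth_mx_on minor_set (fun y => L *m P y *m L^T).
Proof. by move=> i j; exact: smooth_on_sub sub_minor (sA i j). Qed.

Let sI : smooth_mx_on minor_set (fun y => invmx (L *m P y *m L^T)).
Proof. by apply: (smooth_mx_inv open_minor_set _ sA') => y []. Qed.

Lemma smooth_minor_inv : smooth_mx_on minor_set (fun y => minor_inv (P y) L).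
Proof.
have om := open_minor_set.
apply: (smooth_mx_mul om _ (smooth_mx_cst _ _)).
exact: (smooth_mx_mul om (smooth_mx_cst _ _) sI).
Qed.

Lemma smooth_schur : smooth_mx_on minor_set schur.
Proof.
have om := open_minor_set; apply: (smooth_mx_sub om sP').
by apply: (smooth_mx_mul om _ sP'); exact: (smooth_mx_mul om sP' smooth_minor_inv).
Qed.

(** Differentiating [A A^-1 = 1] for [A = L P L^T] gives [- A^-1 L P' L^T A^-1]; the outer factors
    [L^T] and [L] rebuild [K] on both sides. *)
Lemma dmx_minor_inv u y : minor_set y ->
  dmx u (fun z => minor_inv (P z) L) y = - (minor_inv (P y) L *m dmx u P y *m minor_inv (P y) L).
Proof.
move=> my; have [Uy uA] := my; have om := open_minor_set.
have mA := smooth_mx_mdiff sA' my; have mI := smooth_mx_mdiff sI my.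
have mP := smooth_mx_mdiff sP' my.
have dA : dmx u (fun z => L *m P z *m L^T) y = L *m dmx u P y *m L^T.
  have mLP : mdiff (fun z => L *m P z) y by apply: mdiffM => //; exact: mdiff_cst.
  rewrite (dmxM u mLP (mdiff_cst _ _)) (dmxM u (mdiff_cst _ _) mP) !dmx_cst.
  by rewrite mulmx0 addr0 mul0mx add0r.
have dI : dmx u (fun z => invmx (L *m P z *m L^T)) y =
    - (invmx (L *m P y *m L^T) *m (L *m dmx u P y *m L^T) *m invmx (L *m P y *m L^T)).
  have nE : {near y, (fun z => (L *m P z *m L^T) *m invmx (L *m P z *m L^T)) =1 (fun=> 1%:M)}.
    by apply: (open_near_eq om my) => z [_ uz]; rewrite mulmxV.
  have := near_eq_dmx u nE; rewrite dmx_cst (dmxM u mA mI) dA.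
  move/eqP; rewrite addrC addr_eq0 => /eqP /(congr1 (mulmx (invmx (L *m P y *m L^T)))).
  by rewrite mulKmx // mulmxN mulmxA.
have mLI : mdiff (fun z => L^T *m invmx (L *m P z *m L^T)) y.
  by apply: mdiffM => //; exact: mdiff_cst.
rewrite /minor_inv (dmxM u mLI (mdiff_cst _ _)) (dmxM u (mdiff_cst _ _) mI) !dmx_cst.
rewrite mulmx0 addr0 mul0mx add0r dI.
by rewrite mulmxN mulNmx !mulmxA.
Qed.

(** Since [K' = - K P' K], the derivative of [P - P K P] is [(1 - P K) P' (1 - K P)]. With
    [P' = J^T P + P J], the factors [P (1 - K P)] and [(1 - P K) P] are both the Schur complement,
    so the equation is linear in it. *)
Lemma dmx_schur (J : 'M[R]_n) u y : minor_set y -> dmx u P y = J^T *m P y + P y *m J ->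
  dmx u schur y = (1%:M - P y *m minor_inv (P y) L) *m J^T *m schur y
                + schur y *m (J *m (1%:M - minor_inv (P y) L *m P y)).
Proof.
move=> my DP; have mP := smooth_mx_mdiff sP' my.
have mK := smooth_mx_mdiff smooth_minor_inv my.
have mPK : mdiff (fun z => P z *m minor_inv (P z) L) y by exact: mdiffM.
rewrite /schur (dmxB u mP (mdiffM mPK mP)) (dmxM u mPK mP) (dmxM u mP mK) dmx_minor_inv //.
rewrite DP; move: (P y) => Q; move: (minor_inv Q L) => K.
have aux (A B C D : 'M[R]_n) : A - (B - C + D) = A - D - (B - C).
  by rewrite opprD addrA addrAC.
have E D : D - ((D *m K + Q *m - (K *m D *m K)) *m Q + Q *m K *m D) =
    (1%:M - Q *m K) *m D *m (1%:M - K *m Q).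
  rewrite mulmxDl mulmxN mulNmx aux mulmxBr mulmx1 !mulmxBl mul1mx.
  by congr (_ - (_ - _)); rewrite !mulmxA.
have SE : Q - Q *m K *m Q = Q *m (1%:M - K *m Q) by rewrite mulmxBr mulmx1 mulmxA.
have SE' : Q - Q *m K *m Q = (1%:M - Q *m K) *m Q by rewrite mulmxBl mul1mx.
rewrite E [in LHS](mulmxDr _ (J^T *m Q)) [LHS]mulmxDl {1}SE SE' !mulmxA.
by congr (_ + _).
Qed.

End Schur.

(** * Uniqueness of the zero solution of linear differential equations *)

Section LinearODE.
Context {R : realType}.

(** The derivative is zero everywhere, so the mean value theorem takes the place of a connectedness
    argument. *)
Lemma locally_constant (f : R -> R) (a b : R) :
  (forall t, a < t < b -> \forall s \near t, f s = f t) ->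
  forall s t, a < s < b -> a < t < b -> f s = f t.
Proof.
move=> lf; suff le s t : a < s -> t < b -> s < t -> f s = f t.
  move=> s t /andP[as_ sb] /andP[at_ tb].
  by case: (ltgtP s t) => [st|ts|->//]; [exact: le|apply/esym; exact: le].
move=> as_ tb st.
have D u : a < u < b -> is_derive u 1 f 0.
  move=> /lf fu; have nE : {near u, cst (f u) =1 f} by apply: filterS fu => v ->.
  exact: near_eq_is_derive nE (is_derive_cst (f u) u 1).
have [u|v|c _] := @MVT R f (fun=> 0) s t st.
- by rewrite in_itv /= => /andP[su ut]; apply: D; rewrite (lt_trans as_ su) (lt_trans ut tb).
- apply: derivable_within_continuous => {}v; rewrite in_itv /= => /andP[sv vt].
  by have [] := D v _; rewrite ?(lt_le_trans as_ sv) ?(le_lt_trans vt tb).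
- by rewrite mul0r => /eqP; rewrite subr_eq0 => /eqP.
Qed.

(** To the left of [t0] the function [phi exp(C t)] is nondecreasing, to the right [phi exp(- C t)]
    is nonincreasing; both vanish at [t0] and are nonnegative. *)
Lemma gronwall_zero (phi dphi : R -> R) (t0 d C : R) : 0 < d ->
  (forall t, `|t - t0| < d -> is_derive t 1 phi (dphi t)) ->
  (forall t, 0 <= phi t) -> phi t0 = 0 ->
  (forall t, `|t - t0| < d -> `|dphi t| <= C * phi t) ->
  forall t, `|t - t0| < d -> phi t = 0.
Proof.
move=> d0 D p0 pt0 bd t td.
have De (k s : R) : is_derive s 1 (fun u : R => expR (k * u)) (expR (k * s) * k).
  have dk : is_derive s 1 (fun u : R => k * u) k.
    apply: is_derive_eq (is_deriveM (is_derive_cst k s 1) (is_derive_id s 1)) _.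
    by rewrite -![_ *: _]/(_ * _) mulr0 addr0 mulr1.
  exact: (@is_derive1_comp _ expR (fun u : R => k * u) s _ _ (is_derive_expR _) dk).
have Dpe (k s : R) : `|s - t0| < d ->
    is_derive s 1 (fun u => phi u * expR (k * u)) ((k * phi s + dphi s) * expR (k * s)).
  move=> sd; apply: is_derive_eq (is_deriveM (D s sd) (De k s)) _.
  by rewrite -![_ *: _]/(_ * _); ring.
have cont (k s u : R) : `|s - t0| < d -> `|u - t0| < d ->
    {within `[s, u], continuous (fun u => phi u * expR (k * u))}.
  move=> sd ud; apply: derivable_within_continuous => v; rewrite in_itv /= => /andP[sv vu].
  have vd : `|v - t0| < d.
    move: sd ud; rewrite !ltr_norml => /andP[s1 s2] /andP[u1 u2].
    by apply/andP; split; lra.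
  by have [] := Dpe k v vd.
have t0d : `|t0 - t0| < d by rewrite subrr normr0.
apply/eqP; rewrite eq_le p0 andbT.
case: (ltgtP t t0) => [lt|gt|->]; last by rewrite pt0.
- have [v|c] := @MVT R _ (fun s => (C * phi s + dphi s) * expR (C * s)) t t0 lt _ (cont C t t0 td t0d).
    rewrite in_itv /= => /andP[tv vt0]; apply: Dpe.
    by move: td; rewrite !ltr_norml => /andP[? ?]; apply/andP; split; lra.
  rewrite in_itv /= => /andP[tc ct0] E.
  have cd : `|c - t0| < d.
    by move: td; rewrite !ltr_norml => /andP[? ?]; apply/andP; split; lra.
  have : 0 <= (C * phi c + dphi c) * expR (C * c) * (t0 - t).
    apply: mulr_ge0; last by rewrite subr_ge0 ltW.
    apply: mulr_ge0; last exact: expR_ge0.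
    by have := bd c cd; rewrite ler_norml => /andP[? ?]; lra.
  rewrite -E pt0 mul0r sub0r oppr_ge0 => h.
  by rewrite -(pmulr_lle0 _ (expR_gt0 (C * t))).
- have [v|c] := @MVT R _ (fun s => (- C * phi s + dphi s) * expR (- C * s)) t0 t gt _ (cont (- C) t0 t t0d td).
    rewrite in_itv /= => /andP[tv vt0]; apply: Dpe.
    by move: td; rewrite !ltr_norml => /andP[? ?]; apply/andP; split; lra.
  rewrite in_itv /= => /andP[tc ct0] E.
  have cd : `|c - t0| < d.
    by move: td; rewrite !ltr_norml => /andP[? ?]; apply/andP; split; lra.
  have : (- C * phi c + dphi c) * expR (- C * c) * (t - t0) <= 0.
    rewrite -[leLHS]opprK oppr_le0 -mulNr; apply: mulr_ge0; last by rewrite subr_ge0 ltW.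
    rewrite -mulNr; apply: mulr_ge0; last exact: expR_ge0.
    by have := bd c cd; rewrite ler_norml => /andP[? ?]; lra.
  rewrite -E pt0 mul0r subr0 => h.
  by rewrite -(pmulr_lle0 _ (expR_gt0 (- C * t))).
Qed.

Lemma linear_ode_zero n (s B C : R -> 'M[R]_n) (t0 k : R) :
  (\forall t \near t0, [/\ mdiff s t, dmx (1 : R) s t = B t *m s t + s t *m C t,
    forall i j, `|B t i j| <= k & forall i j, `|C t i j| <= k]) ->
  s t0 = 0 -> \forall t \near t0, s t = 0.
Proof.
move=> /nbhs_ballP[d /= d0 Hd] s0.
have near_d t : `|t - t0| < d -> [/\ mdiff s t, dmx (1 : R) s t = B t *m s t + s t *m C t,
    forall i j, `|B t i j| <= k & forall i j, `|C t i j| <= k].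
  by move=> td; apply: Hd; rewrite /ball /= distrC.
pose phi t := \sum_i \sum_j s t i j * s t i j.
pose dphi t := \sum_i \sum_j (s t i j * dmx (1 : R) s t i j + s t i j * dmx (1 : R) s t i j).
have phi0 t : 0 <= phi t.
  by apply: sumr_ge0 => i _; apply: sumr_ge0 => j _; rewrite -expr2 sqr_ge0.
have phi_le t i j : s t i j ^+ 2 <= phi t.
  rewrite /phi (bigD1 i) //= (bigD1 j) //= -expr2 -addrA lerDl addr_ge0 //.
    by apply: sumr_ge0 => l _; rewrite -expr2 sqr_ge0.
  by apply: sumr_ge0 => l _; apply: sumr_ge0 => m _; rewrite -expr2 sqr_ge0.
have mul_le t i j i' j' : `|s t i j * s t i' j'| <= phi t.
  have h1 := phi_le t i j; have h2 := phi_le t i' j'.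
  rewrite normrM; move: h1 h2; rewrite -(real_normK (num_real (s t i j))).
  rewrite -(real_normK (num_real (s t i' j'))).
  move: `|_| `|_| => u v h1 h2; have := sqr_ge0 (u - v); nra.
have zero : forall t, `|t - t0| < d -> phi t = 0.
  (* [phi] is the sum of the squared entries. Each pair [(i, j)] contributes two equal terms to
     [dphi], and each of these is at most [2 k phi] per index [l], once for [B] and once for [C]. *)
  apply: (@gronwall_zero phi dphi t0 d (\sum_(i < n) \sum_(j < n) \sum_(l < n) 4 * k)) => //.
  - move=> t td; have [ms _ _ _] := near_d t td.
    have dphiE : differentiable phi t.
      apply: differentiable_big => i _; apply: differentiable_big => j _.
      by apply: differentiable_mul; exact: ms.
    split; first exact: diff_derivable.
    rewrite derive_big; last first.
      move=> i _; apply: differentiable_big => j _.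
      by apply: differentiable_mul; exact: ms.
    apply: eq_bigr => i _; rewrite derive_big; last first.
      by move=> j _; apply: differentiable_mul; exact: ms.
    apply: eq_bigr => j _; rewrite derive_mul; [|exact: ms|exact: ms].
    by rewrite mxE.
  - by apply: big1 => i _; apply: big1 => j _; rewrite s0 mxE mul0r.
  - move=> t td; have [_ dE Bk Ck] := near_d t td.
    rewrite mulr_suml; apply: (le_trans (ler_norm_sum _ _ _)); apply: ler_sum => i _.
    rewrite mulr_suml; apply: (le_trans (ler_norm_sum _ _ _)); apply: ler_sum => j _.
    have hx : `|s t i j * dmx (1 : R) s t i j| <= \sum_(l < n) 2 * k * phi t.
      rewrite dE mxE mulrDr [(B t *m s t) i j]mxE [(s t *m C t) i j]mxE.
      rewrite [X in `|X + _|]mulr_sumr [X in `|_ + X|]mulr_sumr.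
      rewrite -big_split /=; apply: (le_trans (ler_norm_sum _ _ _)); apply: ler_sum => l _.
      have b1 : `|s t i j * (B t i l * s t l j)| <= k * phi t.
        by rewrite mulrCA normrM; apply: ler_pM => //; exact: Bk.
      have b2 : `|s t i j * (s t i l * C t l j)| <= k * phi t.
        by rewrite mulrA mulrC normrM; apply: ler_pM => //; exact: Ck.
      have -> : 2 * k * phi t = k * phi t + k * phi t by ring.
      exact: le_trans (ler_normD _ _) (lerD b1 b2).
    have -> : (\sum_(l < n) 4 * k) * phi t =
        \sum_(l < n) 2 * k * phi t + \sum_(l < n) 2 * k * phi t.
      by rewrite mulr_suml -big_split /=; apply: eq_bigr => l _; ring.
    exact: le_trans (ler_normD _ _) (lerD hx hx).
apply/nbhs_ballP; exists d => //= t; rewrite /ball /= distrC => /zero pt.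
apply/matrixP => i j; rewrite mxE; apply/eqP; rewrite -sqrf_eq0; apply/eqP/le_anti.
by rewrite sqr_ge0 andbT -pt.
Qed.

End LinearODE.

(** * Constancy of the rank on leaves and forms annihilated by # *)

Section Leaves.
Context {R : realType} {n : nat} {M : smoothManifold R n}.
Variable P : tensor2 M.
Hypothesis pP : is_poisson P.
Let bP : bivector_field P. Proof. by case: pP. Qed.

Lemma rank_bivcoord c p : atlas c -> dom c p -> \rank (bivcoord c P (cmap c p)) = \rank (P p).
Proof.
move=> ac cp; rewrite /bivcoord (cmapK ac cp).
have [aa da] := chart_atP p; have uJ := jac_unit aa ac da cp.
rewrite mxrankMfree ?row_free_unit // eqmxMfull // row_full_unit.
by rewrite unitmx_tr.
Qed.

(** In [integral_curve] the chart varies with [t]; the differential equation for the Schur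
    complement needs one chart for all nearby times. *)
Lemma curve_coord (X : rowfield M) (gamma : R -> M) a b t c : integral_curve X a b gamma -> a < t < b ->
  atlas c -> dom c (gamma t) ->
  mdiff (cmap c \o gamma) t /\
  dmx (1 : R) (cmap c \o gamma) t = vcoord c X (cmap c (gamma t)).
Proof.
move=> ig atb ac ct; have [cg [dg vg]] := ig t atb.
have [aa da] := chart_atP (gamma t); set ca := chart_at (gamma t) in aa da dg vg.
pose w := cmap ca \o gamma.
have mw : mdiff w t.
  by move=> i j; apply/derivable1_diffP; exact: ((derivable_mxP _ _ _).1 dg i j).
have mT : mdiff (transition ca c) (w t) by exact: mdiff_transition.
have nE : {near t, (fun s => transition ca c (w s)) =1 cmap c \o gamma}.
  have nd : \forall s \near t, dom ca (gamma s) by exact: (cg _ (near_dom aa da)).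
  apply: filterS nd => s das.
  by rewrite /transition /w /= cmapK.
split; first by apply: near_eq_mdiff nE _; exact: mdiff_comp.
have dw : dmx (1 : R) w t = X (gamma t) by rewrite (dmxE _ mw).
rewrite -(near_eq_dmx _ nE) (dmx_comp _ mw mT) dw /vcoord (cmapK ac ct) -/ca.
by rewrite (jac_dmx aa ac _ da ct).
Qed.

Lemma near_continuous (S T : topologicalType) (g : S -> T) (t : S) (A : set T) :
  {for t, continuous g} -> nbhs (g t) A -> \forall s \near t, A (g s).
Proof. by move=> cg nA; exact: (cg _ nA). Qed.

Lemma near_bounded (F : R -> 'M[R]_n) t :
  (forall i j, {for t, continuous (fun s => F s i j)}) ->
  exists k, \forall s \near t, forall i j, `|F s i j| <= k.
Proof.
move=> cF; exists (\sum_i \sum_j (`|F t i j| + 1)).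
have ge0 i : 0 <= \sum_j (`|F t i j| + 1) by apply: sumr_ge0 => j _; rewrite addr_ge0.
suff H i j : \forall s \near t, `|F s i j| <= \sum_i \sum_j (`|F t i j| + 1).
  have H1 i : \forall s \near t, forall j, `|F s i j| <= \sum_i \sum_j (`|F t i j| + 1).
    exact: (@filter_forall _ _ (fun j s => `|F s i j| <= _) (nbhs t) _ (H i)).
  exact: (@filter_forall _ _ (fun i s => forall j, `|F s i j| <= _) (nbhs t) _ H1).
have /cvgrPdist_lt/(_ 1 ltr01) := cF i j; apply: filterS => s Fs.
apply: (@le_trans _ _ (`|F t i j| + 1)).
  rewrite -[F s i j](subrK (F t i j)) addrC; apply: (le_trans (ler_normD _ _)).
  by rewrite lerD2l distrC ltW.
rewrite (bigD1 i) //= (bigD1 j) //= -addrA lerDl addr_ge0 //.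
  by apply: sumr_ge0 => l _; rewrite addr_ge0.
by apply: sumr_ge0 => l _; exact: ge0.
Qed.

Lemma rank_locally_constant f (gamma : R -> M) a b t : smooth_fun f ->
  integral_curve (sharp P (dform f)) a b gamma -> a < t < b ->
  \forall s \near t, \rank (P (gamma s)) = \rank (P (gamma t)).
Proof.
move=> sf ig atb; have [ac ct] := chart_atP (gamma t).
set c := chart_at (gamma t) in ac ct.
have oc := open_cimage ac; have [_ /(_ c ac) sQ] := bP.
pose Q := bivcoord c P; pose u := cmap c \o gamma.
have aQ y : cimage c y -> (Q y)^T = - Q y by move=> _; exact: bivcoord_antisym.
have jQ := poisson_jacobi ac pP.
have cy : cimage c (u t) by exact: cimage_cmap.
have [r [L [rE uL]]] : exists r (L : 'M[R]_(r, n)),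
    \rank (Q (u t)) = r /\ L *m Q (u t) *m L^T \in unitmx.
  by have [L0 uL0] := antisym_minor (aQ _ cy); exists (\rank (Q (u t))), L0.
have mst : minor_set (cimage c) Q L (u t) by split.
have om : open (minor_set (cimage c) Q L) by exact: open_minor_set.
have [mu_ _] := curve_coord ig atb ac ct.
have cu : {for t, continuous u}.
  by apply: differentiable_continuous; exact: mdiff_differentiable.
have nm : \forall s \near t, minor_set (cimage c) Q L (u s).
  have nms : nbhs (u t) (minor_set (cimage c) Q L) by exact: open_nbhs_nbhs (conj om mst).
  exact: near_continuous cu nms.
have nd : \forall s \near t, dom c (gamma s).
  by have [cg _] := ig t atb; exact: (cg _ (near_dom ac ct)).
have nab : \forall s \near t, a < s < b.
  by move: atb => /andP[at_ tb]; near=> s; apply/andP; split; near: s; [exact: lt_nbhsr|exact: lt_nbhsl].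
pose J := Dmat (ham Q (f \o cinv c)).
have sh : smooth_mx_on (cimage c) (ham Q (f \o cinv c)) by exact: (smooth_ham oc sQ (sf _ ac)).
have sub : minor_set (cimage c) Q L `<=` cimage c by move=> y [].
have sJ : smooth_mx_on (minor_set (cimage c) Q L) J.
  by move=> i j; apply: smooth_on_sub sub _; exact: smooth_Dmat.
have sQ' : smooth_mx_on (minor_set (cimage c) Q L) Q.
  by move=> i j; apply: smooth_on_sub sub (sQ i j).
have sK := smooth_minor_inv oc sQ L.
(* [B] and [C] are the coefficients of [dmx_schur] with [J] the derivative of the hamiltonian field.
   Continuity bounds them near [t], as [linear_ode_zero] requires. *)
pose B y := (1%:M - Q y *m minor_inv (Q y) L) *m (J y)^T.
pose C y := J y *m (1%:M - minor_inv (Q y) L *m Q y).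
have sB : smooth_mx_on (minor_set (cimage c) Q L) B.
  apply: smooth_mx_mul => //; last exact: smooth_mx_tr.
  by apply: smooth_mx_sub => //; [exact: smooth_mx_cst|exact: smooth_mx_mul].
have sC : smooth_mx_on (minor_set (cimage c) Q L) C.
  apply: smooth_mx_mul => //.
  by apply: smooth_mx_sub => //; [exact: smooth_mx_cst|exact: smooth_mx_mul].
have cont (F : 'rV[R]_n -> 'M[R]_n) : smooth_mx_on (minor_set (cimage c) Q L) F ->
    forall i j, {for t, continuous (fun s => F (u s) i j)}.
  move=> sF i j; apply: differentiable_continuous.
  apply: (@differentiable_mdiff_comp _ _ _ u (fun y => F y i j) t mu_).
  exact: smooth_differentiable (sF i j) mst.
have [k1 nk1] := near_bounded (cont B sB).
have [k2 nk2] := near_bounded (cont C sC).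
have sS := smooth_schur oc sQ L.
have S0 : schur Q L (u t) = 0 by exact: (schur_eq0 uL rE).
have ode : \forall s \near t, [/\ mdiff (fun s => schur Q L (u s)) s,
    dmx (1 : R) (fun s => schur Q L (u s)) s =
      B (u s) *m schur Q L (u s) + schur Q L (u s) *m C (u s),
    forall i j, `|B (u s) i j| <= Num.max k1 k2 & forall i j, `|C (u s) i j| <= Num.max k1 k2].
  near=> s.
  have ms : minor_set (cimage c) Q L (u s) by near: s; exact: nm.
  have ds : dom c (gamma s) by near: s; exact: nd.
  have sab : a < s < b by near: s; exact: nab.
  have b1 : forall i j, `|B (u s) i j| <= k1 by near: s; exact: nk1.
  have b2 : forall i j, `|C (u s) i j| <= k2 by near: s; exact: nk2.
  have [mus vus] := curve_coord ig sab ac ds.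
  have mSs : mdiff (schur Q L) (u s) by exact: smooth_mx_mdiff sS ms.
  split.
  - exact: mdiff_comp.
  - rewrite (dmx_comp _ mus mSs) vus vcoord_ham //; last exact: sub.
    exact: (dmx_schur oc sQ ms (ham_lie oc sQ aQ jQ (sf _ ac) (sub _ ms))).
  - by move=> i j; rewrite le_max b1.
  - by move=> i j; rewrite le_max b2 orbT.
have nS := linear_ode_zero ode S0.
near=> s.
have Ss : schur Q L (u s) = 0 by near: s; exact: nS.
have [_ us] : minor_set (cimage c) Q L (u s) by near: s; exact: nm.
have ds : dom c (gamma s) by near: s; exact: nd.
rewrite -(rank_bivcoord ac ds) -(rank_bivcoord ac ct).
exact: etrans (rank_schur0 us Ss) (esym rE).
Unshelve. all: by end_near. Qed.

Lemma rank_arc x y : hamiltonian_arc P x y -> \rank (P x) = \rank (P y).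
Proof.
move=> [f [a [b [gamma [s [t [sf ig sab tab [<- <-]]]]]]]].
(* The rank is read as a real number, so that [locally_constant] applies to it along the curve. *)
have := @locally_constant R (fun t => (\rank (P (gamma t)))%:R) a b _ s t sab tab.
move=> H; apply/eqP; rewrite -(eqr_nat R); apply/eqP; apply: H => v vab.
by apply: filterS (rank_locally_constant sf ig vab) => w ->.
Qed.

Lemma rank_leaf S : symplectic_leaf P S -> forall x y, S x -> S y -> \rank (P x) = \rank (P y).
Proof.
move=> [z ->] x y zx zy.
have E w : clos_refl_trans M (hamiltonian_arc P) z w -> \rank (P z) = \rank (P w).
  elim=> [p q|//|p q q' _ -> _ ->//]; exact: rank_arc.
by rewrite -(E x zx) (E y zy).
Qed.

(* The extension of [v] is [chi v (1 - P K)] with [K = minor_inv P L]; its image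
   under # is [chi v (P - P K P)]. *)
Lemma kernel_form x (v : 'rV[R]_n) : v *m P x = 0 ->
  exists be, [/\ one_form be, be x = v &
    forall q, \rank (P q) = \rank (P x) -> sharp P be q = 0].
Proof.
move=> vP; have [ac cx] := chart_atP x; set c := chart_at x in ac cx.
have oc := open_cimage ac; have [_ /(_ c ac) sQ] := bP.
pose Q := bivcoord c P; set y0 := cmap c x.
have Qy0 : Q y0 = P x by exact: bivcoord_at.
have aQ : (Q y0)^T = - Q y0 by exact: bivcoord_antisym.
have cy : cimage c y0 by exact: cimage_cmap.
have [r [L [rE uL]]] : exists r (L : 'M[R]_(r, n)),
    \rank (Q y0) = r /\ L *m Q y0 *m L^T \in unitmx.
  by have [L0 uL0] := antisym_minor aQ; exists (\rank (Q y0)), L0.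
have ms0 : minor_set (cimage c) Q L y0 by split.
have om : open (minor_set (cimage c) Q L) by exact: open_minor_set.
have sub : minor_set (cimage c) Q L `<=` cimage c by move=> y [].
have [chi [B [cchi oB By BW chi1]]] := cutoff_exists_open ac om sub ms0.
pose w y := v - v *m Q y *m minor_inv (Q y) L.
have sw : smooth_mx_on (minor_set (cimage c) Q L) w.
  apply: smooth_mx_sub => //; first exact: smooth_mx_cst.
  apply: smooth_mx_mul => //; last exact: smooth_minor_inv.
  apply: smooth_mx_mul => //; first exact: smooth_mx_cst.
  by move=> i j; apply: smooth_on_sub sub (sQ i j).
have chix : chi x = 1 by rewrite -[x](cmapK ac cx); exact: chi1.
exists (form_ext c chi w); split.
- exact: (one_form_ext ac om cchi).
- rewrite -[LHS]fcoord_at (fcoord_form_ext ac cchi) // cmapK // chix scale1r.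
  by rewrite /w -/c -/y0 Qy0 vP mul0mx subr0.
move=> q rq; have [qms|nq] := pselect (chart_set c (minor_set (cimage c) Q L) q); last first.
  have chiq : chi q = 0.
    by case: cchi => _ [K [_ KW K0]]; apply: K0 => /KW.
  rewrite /sharp /form_ext chiq; have -> : forall A : 'rV[R]_n, 0 *: A = 0 by move=> A; rewrite scale0r.
  by rewrite mul0mx.
have [cq [cyq uq]] := qms.
rewrite -(cmapK ac cq) -(vcoord_inj ac cyq) (vcoord_sharp ac cyq).
rewrite (fcoord_form_ext ac cchi) // -scalemxAl.
have -> : w (cmap c q) *m bivcoord c P (cmap c q) = 0.
  have rQ : \rank (Q (cmap c q)) = r by rewrite (rank_bivcoord ac cq) rq -Qy0.
  rewrite /w mulmxBl -[v *m Q _ *m _ *m _]mulmxA -[v *m Q _ *m _]mulmxA -mulmxBr -/(Q _) mulmxA.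
  by rewrite (schur_eq0 uq rQ) mulmx0.
by have -> : forall (k : R) (A : 'M[R]_n), (k *: (0 : 'rV[R]_n)) *m A = 0
  by move=> k A; rewrite scaler0 mul0mx.
Qed.

End Leaves.

(** * Traces of connections *)

Section Trace.
Context {R : realType} {n : nat}.

(* [P = P Q P] for [Q = pinvmx P], so [A = P B] with [B = Q A]. The infinitesimal
   invariance of [P] then says [P (B - B^T) P = 0], whence
   [2 tr A = tr (P (B - B^T)) = tr (Q P (B - B^T) P) = 0]. *)
Lemma trace_basic (P A : 'M[R]_n) : P^T = - P ->
  (forall v : 'rV_n, v *m P = 0 -> v *m A = 0) -> A *m P + P *m A^T = 0 -> \tr A = 0.
Proof.
move=> PT kP AP; set Q := pinvmx P.
have PQP : P *m Q *m P = P by rewrite mulmxKpV.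
have AE : A = P *m (Q *m A).
  apply/eqP; rewrite mulmxA -subr_eq0 -{1}[A]mul1mx -mulmxBl; apply/eqP/row_matrixP => i.
  rewrite row_mul kP ?row0 // -row_mul mulmxBl mul1mx PQP subrr.
  exact: row0.
move: AP; rewrite AE; move: (Q *m A) => B AP.
have C0 : P *m (B - B^T) *m P = 0.
  by rewrite -AP trmx_mul PT mulmxN mulmxBr mulmxBl mulmxN -!mulmxA.
have t1 : \tr (P *m (B - B^T)) = 0.
  have -> : P *m (B - B^T) = P *m (Q *m P *m (B - B^T)) by rewrite [RHS]mulmxA mulmxA PQP.
  rewrite mxtrace_mulC; have -> : Q *m P *m (B - B^T) *m P = Q *m (P *m (B - B^T) *m P).
    by rewrite !mulmxA.
  by rewrite C0 mulmx0 mxtrace0.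
have t2 : \tr (P *m B^T) = - \tr (P *m B).
  by rewrite -[LHS]mxtrace_tr trmx_mul trmxK PT mulmxN raddfN mxtrace_mulC.
move: t1; rewrite mulmxBr raddfB /= t2 opprK -mulr2n => /eqP.
by rewrite mulrn_eq0 /= => /eqP.
Qed.

End Trace.

(** * Basic connections along hamiltonian fields *)

Section Connections.
Context {R : realType} {n : nat} {M : smoothManifold R n}.
Variable P : tensor2 M.
Hypothesis pP : is_poisson P.
Let bP : bivector_field P. Proof. by case: pP. Qed.
Implicit Types (D : form_operator (M := M)) (al be : rowfield M).

Lemma leibniz_connection D al : contravariant_connection P D -> one_form al ->
  leibniz_form (sharp P al) (D al).
Proof.
move=> cD sal; split=> [be be' sbe sbe'|f be sf sbe]; last exact: contra_leibniz.
by have := contra_linear_r cD 1 sal sbe sbe'; rewrite !scale1r.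
Qed.

Lemma leibniz_tensorial D be : contravariant_connection P D -> one_form be ->
  leibniz_form 0 (fun al => D al be).
Proof.
move=> cD sbe; split=> [al al' sal sal'|f al sf sal].
  by have := contra_linear_l cD 1 sal sal' sbe; rewrite !scale1r.
rewrite (contra_tensorial cD) //.
have -> : dir 0 f = 0 by apply/funext => p; rewrite /dir /pairing trmx0 mulmx0 mxE.
by rewrite -[LHS]addr0; congr (_ + _); apply/funext => p; rewrite /fscale scale0r.
Qed.

(** Bracketing with [df] is the Lie derivative along [X_f]: one has [L_(# be) df = d (P(be, df)) = -
    d (P(df, be))] by symmetry of the hessian, so the last two terms of the bracket cancel. *)
Lemma form_bracket_dform f be p : smooth_fun f -> one_form be ->
  let c := chart_at p in let y := cmap c p in
  let X := ham (bivcoord c P) (f \o cinv c) in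
  form_bracket P (dform f) be p = dmx (X y) (fcoord c be) y + be p *m (Dmat X y)^T.
Proof.
move=> sf sbe c y X; have [ac cp] := chart_atP p.
have oc := open_cimage ac; have cy := cimage_cmap cp; have [_ /(_ _ ac) sQ] := bP.
set F := f \o cinv c; have sF : smooth_on (cimage c) F by exact: (sf _ ac).
set Q := bivcoord c P; set b := fcoord c be; pose Xb z := b z *m Q z.
have sb : smooth_mx_on (cimage c) b by exact: (sbe _ ac).
have sXb : smooth_mx_on (cimage c) Xb by exact: smooth_mx_mul.
have sg : smooth_mx_on (cimage c) (gradient F) by exact: smooth_gradient.
have mb := smooth_mx_mdiff sb cy; have mg := smooth_mx_mdiff sg cy.
have mXb := smooth_mx_mdiff sXb cy.
rewrite (form_bracket_coord bP p (one_form_dform sf) sbe) -/c -/y -/Q -/b.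
have gE z : cimage c z -> fcoord c (dform f) z = gradient F z by move=> cz; exact: gradient_dform.
have DE (T T' : 'rV[R]_n -> 'rV[R]_n) : (forall z, cimage c z -> T z = T' z) -> Dmat T y = Dmat T' y.
  move=> TT; apply/matrixP => k i; rewrite !mxE.
  by apply: (partial_eq_on _ oc _ cy) => z cz; rewrite TT.
rewrite -(fcoord_at (dform f)) -/c -/y gE // (DE (fcoord c (dform f)) (gradient F)) //.
rewrite (DE (fun z => fcoord c (dform f) z *m Q z) X); last by move=> z cz; rewrite gE.
have -> : gradient (fun z => (fcoord c (dform f) z *m Q z *m (b z)^T) 0 0) y =
    - (Xb y *m Dmat (gradient F) y + gradient F y *m (Dmat Xb y)^T).
  apply/rowP => j; rewrite [LHS]mxE.
  rewrite (@partial_eq_on _ _ (cimage c) j _ (fun z => - (gradient F z *m (Xb z)^T) 0 0)) //; last first.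
    have aux (g w : 'rV[R]_n) (A : 'M[R]_n) : A^T = - A ->
        (g *m A *m w^T) 0 0 = - (g *m (w *m A)^T) 0 0.
      by move=> AT; rewrite trmx_mul AT mulNmx mulmxN mulmxA [in RHS]mxE opprK.
    by move=> z cz; rewrite gE //; apply: aux; exact: bivcoord_antisym.
  have -> : partial j (fun z => - (gradient F z *m (Xb z)^T) 0 0) y =
      - (dmx (delta_mx 0 j) (fun z => gradient F z *m (Xb z)^T) y 0 0).
    rewrite mxE /partial [LHS]deriveN //.
    by apply: diff_derivable; apply: (mdiffM mg (mdiff_tr mXb)).
  rewrite [RHS]mxE; congr (- _); rewrite (dmxM _ mg (mdiff_tr mXb)) dmx_tr !mxE; congr (_ + _).
    apply: eq_bigr => i _; rewrite !mxE mulrC; congr (_ * _).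
    transitivity (hessian F y j i); first by rewrite mxE; apply: eq_derive => z; rewrite mxE.
    rewrite -(hessian_sym oc sF cy) !mxE.
    by apply: eq_derive => z; rewrite mxE.
  by apply: eq_bigr => i _; rewrite !mxE.
by rewrite opprK subrK (dmx_Dmat _ mb).
Qed.

Section AtPoint.
Variables (D1 : form_operator (M := M)) (x : M).
Hypothesis basic1 : basic_connection P D1.
Let c := chart_at x.
Let y0 := cmap c x.
Let ac : atlas c. Proof. by have [] := chart_atP x. Qed.
Let cx : dom c x. Proof. by have [] := chart_atP x. Qed.
Let cy0 : cimage c y0. Proof. exact: cimage_cmap. Qed.
Let oc : open (cimage c). Proof. exact: open_cimage. Qed.
Let Q := bivcoord c P.
Let Qy0 : Q y0 = P x. Proof. exact: bivcoord_at. Qed.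
Let sQ : smooth_mx_on (cimage c) Q. Proof. by have [_] := bP; apply. Qed.
Let aQ y : cimage c y -> (Q y)^T = - Q y. Proof. by move=> _; exact: bivcoord_antisym. Qed.

Variable chi : M -> R.
Hypothesis cchi : cutoff c (cimage c) chi.
Hypothesis chi1 : \forall z \near y0, chi (cinv c z) = 1.

(* The endomorphism [dy_i |-> D_al dy_i] of the cotangent space at [x]. *)
Definition christoffel D al : 'M[R]_n := \matrix_i D al (coframe x chi i) x.

(** [leibniz_at] with [Z = 0] has no derivative term, so only the value of the first argument at [x]
    remains. *)
Lemma tensorial_at D al al' be : contravariant_connection P D ->
  one_form al -> one_form al' -> one_form be -> al x = al' x -> D al be x = D al' be x.
Proof.
move=> cD sal sal' sbe E; have L := leibniz_tensorial cD sbe.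
have D0E ga : dmx ((0 : rowfield M) x) (fcoord c ga) y0 = 0.
  by apply/matrixP => i j; rewrite !mxE; exact: derive0.
by rewrite (leibniz_at cchi chi1 L sal) (leibniz_at cchi chi1 L sal') !D0E E.
Qed.

(** A cut-off linear function realises any covector. Together with [tensorial_at], this reduces the
    trace of [D1] to the case of differentials. *)
Lemma function_with_differential (a : 'rV[R]_n) : exists2 f, smooth_fun f & dform f x = a.
Proof.
pose u (z : 'rV[R]_n) := \sum_i z 0 i * a 0 i.
have su : smooth_on (cimage c) u.
  apply: smooth_on_sum => // i _; apply: smooth_onM => //; last exact: smooth_on_cst.
  exact: smooth_on_coord.
have sf : smooth_fun (fun_ext c chi u) by exact: (smooth_fun_ext ac oc cchi su).
exists (fun_ext c chi u) => //; rewrite -[LHS]fcoord_at gradient_dform //.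
apply/rowP => j; rewrite mxE; transitivity (partial j u y0).
  apply: near_eq_derive; have nc : \forall z \near y0, cimage c z by exact: open_nbhs_nbhs.
  by apply: filterS2 nc chi1 => z cz chiz; rewrite /= (fun_extE ac) // chiz mul1r.
rewrite /partial derive_big; last first.
  move=> i _; apply: differentiable_mul; last exact: differentiable_cst.
  exact: differentiable_coord.
rewrite (bigD1 j) //= big1 => [|i ij].
  rewrite derive_mul; [|exact: differentiable_coord|exact: differentiable_cst].
  by rewrite derive_cst derive_coord mxE !eqxx mulr0 add0r mulr1 addr0.
rewrite derive_mul; [|exact: differentiable_coord|exact: differentiable_cst].
by rewrite derive_cst derive_coord mxE eqxx (negPf ij) !mulr0 addr0.
Qed.

Lemma trace_basic_connection f : smooth_fun f ->
  \tr (christoffel D1 (dform f)) = \tr (Dmat (ham Q (f \o cinv c)) y0).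
Proof.
move=> sf; set X := ham Q (f \o cinv c); set G := christoffel D1 (dform f).
have cD := basic_contravariant basic1.
have sdf := one_form_dform sf.
have Xx : sharp P (dform f) x = X y0.
  by rewrite -[LHS]vcoord_at (vcoord_ham _ ac cy0 sf).
(* [D1] along [df] and the bracket with [df] differentiate [be] along the same vector, so their
   difference is the matrix [G - (DX)^T] acting on [be x]. *)
have DE be : one_form be ->
    D1 (dform f) be x = form_bracket P (dform f) be x + be x *m (G - (Dmat X y0)^T).
  move=> sbe; rewrite (leibniz_at cchi chi1 (leibniz_connection cD sdf) sbe) Xx.
  rewrite (form_bracket_dform x sf sbe) mulmxBr -/c -/y0 -/Q -/X.
  by rewrite addrCA addrK addrC.
suff : \tr (G - (Dmat X y0)^T) = 0.
  by rewrite raddfB /= mxtrace_tr => /eqP; rewrite subr_eq0 => /eqP.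
apply: (@trace_basic _ _ (P x)); first by case: bP.
- move=> v vP; have [be [sbe bex kbe]] := kernel_form pP vP.
  pose S := [set y | clos_refl_trans M (hamiltonian_arc P) x y].
  have lS : symplectic_leaf P S by exists x.
  have Sx : S x by exact: rt_refl.
  have Sk q : S q -> sharp P be q = 0.
    by move=> Sq; apply: kbe; exact: (rank_leaf pP lS Sq Sx).
  have := basic_leaf basic1 lS sdf sbe Sk Sx; rewrite DE // bex => /eqP.
  by rewrite -subr_eq0 addrC addKr => /eqP.
(* [D1 P = 0] evaluated on the coframe, whose components are constant near [x]. *)
- have E i j : ((G *m P x + P x *m G^T) - dmx (X y0) Q y0) i j = 0.
    have se k := one_form_coframe cchi k.
    have : dir (sharp P (dform f)) (eval2 P (coframe x chi i) (coframe x chi j)) x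
        - eval2 P (D1 (dform f) (coframe x chi i)) (coframe x chi j) x
        - eval2 P (coframe x chi i) (D1 (dform f) (coframe x chi j)) x = 0.
      exact: (congr1 (fun F => F x) (basic_poisson basic1 sdf (se i) (se j))).
    have -> : dir (sharp P (dform f)) (eval2 P (coframe x chi i) (coframe x chi j)) x =
        dmx (X y0) Q y0 i j.
      rewrite dir_at ?Xx; last exact: smooth_eval2.
      rewrite mxE; apply: near_eq_derive.
      have nc : \forall z \near y0, cimage c z by exact: open_nbhs_nbhs.
      apply: filterS3 nc (near_coframe cchi chi1 i) (near_coframe cchi chi1 j) => z cz ei ej.
      by rewrite /= eval2_form_coord // ei ej -rowE trmx_delta -colE !mxE.
    rewrite /eval2 !(coframe_x cchi chi1).
    have -> : (D1 (dform f) (coframe x chi i) x *m P x *m (delta_mx 0 j : 'rV[R]_n)^T) 0 0 = (G *m P x) i j.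
      by rewrite trmx_delta -colE mxE -[D1 _ _ x](rowK (fun k => D1 (dform f) (coframe x chi k) x)) -row_mul mxE.
    have -> : ((delta_mx 0 i : 'rV[R]_n) *m P x *m (D1 (dform f) (coframe x chi j) x)^T) 0 0 = (P x *m G^T) i j.
      rewrite -[D1 _ _ x](rowK (fun k => D1 (dform f) (coframe x chi k) x)) tr_row -rowE.
      by rewrite !mxE; apply: eq_bigr => k _; rewrite !mxE.
    have Ea (A B : 'M[R]_n) : (A + B) i j = A i j + B i j by rewrite mxE.
    have En (A : 'M[R]_n) : (- A) i j = - A i j by rewrite mxE.
    move=> H; rewrite Ea En Ea.
    by apply/eqP; rewrite subr_eq0; apply/eqP/esym; move/eqP: H; rewrite -addrA -opprD subr_eq0 => /eqP.
  have /eqP : (G *m P x + P x *m G^T) - dmx (X y0) Q y0 = 0.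
    by apply/matrixP => i j; rewrite E mxE.
  rewrite subr_eq0 => /eqP GE.
  rewrite linearB /= trmxK mulmxBl mulmxBr addrACA GE -opprD.
  have jQ := poisson_jacobi ac pP.
  (* Subtracting [L_X P = 0] from [D1 P = 0] removes the derivative of [P] and leaves the algebraic
     condition of [trace_basic]. *)
  rewrite (ham_lie oc sQ aQ jQ (sf _ ac) cy0) -/X Qy0.
  by rewrite subrr.
Qed.

End AtPoint.
End Connections.

(** * The riemannian density and the trace of a riemannian connection *)

Section RiemannianDensity.
Context {R : realType} {n : nat} {M : smoothManifold R n}.
Variable G : tensor2 M.
Hypothesis rG : riemannian_metric G.

(* The absolute value spares a proof that positive definite matrices have a
   positive determinant. *)
Definition volume : M -> R := fun p => Num.sqrt `|\det (G p)|.

Lemma det_metric_neq0 p : \det (G p) != 0.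
Proof.
have [_ posG _] := rG; apply/det0P => -[v v0 vG].
by have := posG p v v0; rewrite vG mul0mx mxE ltxx.
Qed.

Lemma denscoord_volume c y : atlas c -> cimage c y ->
  denscoord c volume y = Num.sqrt `|\det (metcoord c G y)|.
Proof.
move=> ac cy; rewrite /denscoord /metcoord /volume; set p := cinv c y.
move: (jac c (chart_at p) p) => J.
rewrite !det_mulmx det_tr -mulrA [_ * \det J]mulrC mulrA -expr2 normrM normrX.
by rewrite sqrtrM ?exprn_ge0 // sqrtr_sqr normr_id mulrC.
Qed.

Lemma det_metcoord_neq0 c y : atlas c -> cimage c y -> \det (metcoord c G y) != 0.
Proof.
move=> ac cy; have [aa da] := chart_atP (cinv c y).
have := jac_unit ac aa (dom_cinv ac cy) da.
rewrite /metcoord unitmxE unitfE; set p := cinv c y.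
move: (jac c (chart_at p) p) => J dJ.
by rewrite !det_mulmx det_tr !mulf_neq0 //; exact: det_metric_neq0.
Qed.

Lemma smooth_positive_volume : smooth_positive_measure volume.
Proof.
split=> [p|c ac]; first by rewrite /volume sqrtr_gt0 normr_gt0; exact: det_metric_neq0.
have [_ _ /(_ c ac) sG] := rG; have oc := open_cimage ac.
have sd := smooth_on_det oc sG.
have d2 y : cimage c y -> 0 < \det (metcoord c G y) * \det (metcoord c G y).
  by move=> cy; rewrite -expr2 exprn_even_gt0 //= det_metcoord_neq0.
apply: (smooth_on_eq oc (f := fun y =>
    Num.sqrt (Num.sqrt (\det (metcoord c G y) * \det (metcoord c G y))))).
  by move=> y cy; rewrite denscoord_volume // -expr2 sqrtr_sqr.
apply: smooth_on_sqrt => // [y cy|]; first by rewrite sqrtr_gt0 d2.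
by apply: smooth_on_sqrt => //; exact: smooth_onM.
Qed.

Lemma derive_log_volume c u y : atlas c -> cimage c y ->
  'D_u (log_density c volume) y =
    2^-1 * \tr (dmx u (metcoord c G) y *m invmx (metcoord c G y)).
Proof.
move=> ac cy; have oc := open_cimage ac; have [_ _ /(_ c ac) sG] := rG.
pose d z := \det (metcoord c G z).
have dd : differentiable d y by exact: smooth_differentiable (smooth_on_det oc sG) cy.
have d0 : d y != 0 by exact: det_metcoord_neq0.
have d2 : 0 < d y * d y by rewrite -expr2 exprn_even_gt0.
have ddd : differentiable (fun z => d z * d z) y by exact: differentiable_mul.
(* For [rho = sqrt |d|] one has [rho^4 = d^2]; the factor [1/4] is the price for removing both the
   absolute value and the root. *)
have lE z : cimage c z -> log_density c volume z = 4^-1 * ln (d z * d z).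
  move=> cz; rewrite /log_density denscoord_volume // -/(d z).
  have dz : d z != 0 by exact: det_metcoord_neq0.
  have s0 : 0 < Num.sqrt `|d z| by rewrite sqrtr_gt0 normr_gt0.
  have -> : d z * d z = Num.sqrt `|d z| ^+ 4.
    rewrite -[4%N]/(2 * 2)%N exprM sqr_sqrtr ?normr_ge0 // real_normK ?expr2 //.
    exact: num_real.
  by rewrite lnXn // -[ln _ *+ 4]mulr_natl mulKf // pnatr_eq0.
rewrite (near_eq_derive _ (open_near_eq oc cy lE)).
rewrite [LHS](@deriveMl _ _ (fun z => ln (d z * d z))).
  rewrite (derive_ln _ ddd d2) derive_mul // /d derive_det; last exact: smooth_mx_mdiff sG cy.
  have -> : \adj (metcoord c G y) = d y *: invmx (metcoord c G y).
    by rewrite /invmx unitmxE unitfE d0 scalerA divff // scale1r.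
  rewrite -scalemxAr mxtraceZ -/(d y); move: (\tr _) (d y) d0 => t e e0.
  by field.
apply: diff_derivable; apply: differentiable_comp => //.
exact: differentiable_ln.
Qed.

End RiemannianDensity.

Section RiemannianTrace.
Context {R : realType} {n : nat} {M : smoothManifold R n}.
Variable P : tensor2 M.
Hypothesis bP : bivector_field P.
Variables (G : tensor2 M) (N : rowfield M -> rowfield M -> rowfield M).
Variable D0 : form_operator (M := M).
Hypothesis rG : riemannian_metric G.
Hypothesis mN : metric_connection G N.
Hypothesis dN : forall al be Y, one_form al -> one_form be -> vector_field Y ->
  pairing (D0 al be) Y = dir (sharp P al) (pairing be Y) - pairing be (N (sharp P al) Y).
Variable x : M.
Let c := chart_at x.
Let y0 := cmap c x.
Let ac : atlas c. Proof. by have [] := chart_atP x. Qed.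
Let cx : dom c x. Proof. by have [] := chart_atP x. Qed.
Let cy0 : cimage c y0. Proof. exact: cimage_cmap. Qed.
Let oc : open (cimage c). Proof. exact: open_cimage. Qed.
Variable chi : M -> R.
Hypothesis cchi : cutoff c (cimage c) chi.
Hypothesis chi1 : \forall z \near y0, chi (cinv c z) = 1.

(** If [B] is the matrix of [N_X] on the frame, duality gives [- B^T] on the coframe, and [N g = 0]
    reads [X g = B g + g B^T]. Hence [tr B] is half of [tr (X g . g^-1)], the logarithmic derivative
    of the volume. *)
Lemma trace_riemannian_connection al : one_form al ->
  \tr (christoffel x chi D0 al) = - 'D_(sharp P al x) (log_density c (volume G)) y0.
Proof.
move=> sal; set X := sharp P al.
have sX : vector_field X by exact: vector_field_sharp.
have sb i := vector_field_frame cchi i.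
have se i := one_form_coframe cchi i.
have nc : \forall z \near y0, cimage c z by exact: open_nbhs_nbhs.
pose B : 'M[R]_n := \matrix_j N X (frame x chi j) x.
have rowB j : N X (frame x chi j) x = delta_mx 0 j *m B by rewrite -rowE rowK.
(* The pairing of coframe and frame is constant near [x], so the derivative in the duality formula
   drops out. *)
have chE : christoffel x chi D0 al = - B^T.
  apply/matrixP => i j; rewrite [LHS]mxE.
  have := congr1 (fun F => F x) (dN sal (se i) (sb j)).
  rewrite -[(_ - _) x]/(dir _ _ x - pairing _ _ x) (@dir_near _ _ _ x X _ (fun=> (i == j)%:R)) //.
  - rewrite dir_at; last exact: smooth_fun_cst.
    rewrite [X in X - _]derive_cst sub0r /pairing (frame_x cchi chi1) (coframe_x cchi chi1).
    rewrite rowB => H; rewrite [RHS]mxE [X in - X]mxE; transitivity ((D0 al (coframe x chi i) x *m (delta_mx 0 j : 'rV[R]_n)^T) 0 0).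
      by rewrite trmx_delta -colE mxE.
    by rewrite H -rowE mxE -rowE !mxE.
  - by apply: smooth_pairing.
  - exact: smooth_fun_cst.
  - apply: filterS3 nc (near_coframe cchi chi1 i) (near_frame cchi chi1 j) => z cz ei bj.
    by rewrite pairing_coord // ei bj trmx_delta mul_delta_mx_cond mulmxnE mxE !eqxx.
set Gc := metcoord c G.
have Gx : Gc y0 = G x by exact: metcoord_at.
have GE : dmx (X x) Gc y0 = B *m G x + G x *m B^T.
  apply/matrixP => i j.
  have := congr1 (fun F => F x) (mN sX (sb i) (sb j)).
  rewrite -[(_ + _) x]/(eval2 _ _ _ x + eval2 _ _ _ x).
  have -> : dir X (eval2 G (frame x chi i) (frame x chi j)) x = dmx (X x) Gc y0 i j.
    rewrite dir_at.
      rewrite mxE; apply: near_eq_derive.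
      apply: filterS3 nc (near_frame cchi chi1 i) (near_frame cchi chi1 j) => z cz bi bj.
      by rewrite /= eval2_field_coord // bi bj trmx_delta -rowE -colE !mxE.
    move=> c' ac'; have oc' := open_cimage ac'; have [_ _ /(_ c' ac') sG'] := rG.
    apply: (smooth_on_eq oc' (f := fun y => (vcoord c' (frame x chi i) y *m metcoord c' G y
        *m (vcoord c' (frame x chi j) y)^T) 0 0)).
      by move=> y cy; rewrite /= eval2_field_coord.
    apply: smooth_mx_mul => //; last by apply: smooth_mx_tr => //; exact: (sb j).
    by apply: smooth_mx_mul => //; exact: (sb i).
  move=> ->; rewrite /eval2 !(frame_x cchi chi1) !rowB [RHS]mxE; congr (_ + _).
    by rewrite trmx_delta -!rowE -colE -row_mul !mxE.
  by rewrite trmx_mul trmx_delta mulmxA -colE -mulmxA -rowE !mxE.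
have uG : G x \in unitmx by rewrite unitmxE unitfE; exact: det_metric_neq0.
rewrite chE raddfN /= mxtrace_tr (derive_log_volume rG _ ac cy0) -/Gc GE Gx mulmxDl.
rewrite mxtraceD mulmxK // mxtrace_mulC mulKmx // mxtrace_tr; congr (- _).
by move: (\tr B) => t; field.
Qed.

End RiemannianTrace.

(** * Cosets in cohomology and change of density *)

Section CohomologyClasses.
Context {R : realType} {n : nat} {M : smoothManifold R n}.
Variable P : tensor2 M.
Hypothesis bP : bivector_field P.
Implicit Types (X V W al be : rowfield M) (f g h : M -> R).

Lemma pairing_scale (a : R) al X p : pairing al (a *: X) p = a * pairing al X p.
Proof.
rewrite /pairing -[(a *: X) p]/(a *: X p) linearZ /= -scalemxAr [LHS]mxE.
by [].
Qed.

Lemma dir_linear X (a : R) f g p : smooth_fun f -> smooth_fun g ->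
  dir X (fun q => a * f q + g q) p = a * dir X f p + dir X g p.
Proof.
move=> sf sg; have [ac cp] := chart_atP p; have cy := cimage_cmap cp.
have df := smooth_differentiable (sf _ ac) cy; have dg := smooth_differentiable (sg _ ac) cy.
have saf : smooth_fun (fun q => a * f q) by apply: smooth_fun_mul => //; exact: smooth_fun_cst.
rewrite !dir_at //; last exact: smooth_fun_add.
have da : differentiable (fun y => a * (f \o cinv (chart_at p)) y) (cmap (chart_at p) p).
  by apply: differentiable_mul => //; exact: differentiable_cst.
rewrite [LHS](@deriveD _ _ _ (fun y => a * (f \o cinv (chart_at p)) y) (g \o cinv (chart_at p))).
- by congr (_ + _); rewrite derive_mul ?derive_cst ?mulr0 ?addr0 //; exact: differentiable_cst.
- exact: diff_derivable.
- exact: diff_derivable.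
Qed.

Lemma delta_closed_scale (a : R) V : vector_field V -> delta_closed P V ->
  delta_closed P (a *: V).
Proof.
move=> sV cV al be sal sbe; apply/funext => p.
have := congr1 (fun F => F p) (cV al be sal sbe); rewrite !delta_vector.
have dE ga ga' : one_form ga -> one_form ga' ->
    dir (sharp P ga) (pairing ga' (a *: V)) p = a * dir (sharp P ga) (pairing ga' V) p.
  move=> sga sga'; have sp := smooth_pairing sga' sV.
  have -> : pairing ga' (a *: V) = (fun q => a * pairing ga' V q + 0).
    by apply/funext => q; rewrite pairing_scale addr0.
  rewrite dir_linear //; last exact: smooth_fun_cst.
  rewrite [X in _ + X](_ : _ = 0) ?addr0 // dir_at; last exact: smooth_fun_cst.
  exact: derive_cst.
rewrite (dE al be sal sbe) (dE be al sbe sal) pairing_scale -!mulrBr mulrCA => ->.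
exact: mulr0.
Qed.

Lemma H1_classE V W : H1_class P V W <-> [/\ vector_field W, delta_closed P W &
  exists2 f, smooth_fun f & forall al, one_form al -> forall p,
    pairing al W p = pairing al V p + dir (sharp P al) f p].
Proof.
split=> -[sW cW [f sf E]]; split=> //; exists f => // al sal.
  move=> p; have := congr1 (fun F => F p) (E al sal).
  by rewrite delta_fun.
by apply/funext => p; rewrite delta_fun; exact: E.
Qed.

Lemma H1_class_scale (a : R) V W h : a != 0 -> smooth_fun h ->
  (forall al, one_form al -> forall p,
    pairing al V p = pairing al W p + dir (sharp P al) h p) ->
  H1_class P (a *: V) = H1_scale a (H1_class P W).
Proof.
move=> a0 sh VW.
have sc (b : R) f : smooth_fun f -> smooth_fun (fun q => b * f q).
  by move=> sf; apply: smooth_fun_mul => //; exact: smooth_fun_cst.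
apply/seteqP; split=> U.
  case/H1_classE=> sU cU [f sf E].
  exists (a^-1 *: U); last by rewrite scalerA divff // scale1r.
  apply/H1_classE; split; [exact: vector_field_scale|exact: delta_closed_scale|].
  (* From [U = a V + delta f] and [V = W + delta h] follows [a^-1 U = W + delta (a^-1 f + h)]. *)
  exists (fun q => a^-1 * f q + h q); first by apply: smooth_fun_add => //; exact: sc.
  move=> al sal p; rewrite pairing_scale E // pairing_scale VW // dir_linear //.
  rewrite mulrDr mulKf // -addrA; congr (_ + _); exact: addrC.
case=> U' /H1_classE[sU cU [f sf E]] <-; apply/H1_classE; split.
- exact: vector_field_scale.
- exact: delta_closed_scale.
(* Conversely, [U' = W + delta f] gives [a U' = a V + delta (a f - a h)]. *)
exists (fun q => a * f q + (- a) * h q).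
  by apply: smooth_fun_add; exact: sc.
move=> al sal p; rewrite !pairing_scale E // VW // dir_linear //; last exact: sc.
have -> : dir (sharp P al) (fun q => - a * h q) p = - a * dir (sharp P al) h p.
  have -> : (fun q => - a * h q) = (fun q => - a * h q + 0).
    by apply/funext => q; rewrite addr0.
  rewrite dir_linear //; last exact: smooth_fun_cst.
  rewrite [X in _ + X](_ : _ = 0) ?addr0 // dir_at; last exact: smooth_fun_cst.
  exact: derive_cst.
have aux (u v w : R) : a * (u + v) = a * (u + w) + (a * v + - a * w) by ring.
exact: aux.
Qed.

End CohomologyClasses.

Section ModularFields.
Context {R : realType} {n : nat} {M : smoothManifold R n}.
Variable P : tensor2 M.
Hypothesis pP : is_poisson P.
Let bP : bivector_field P. Proof. by case: pP. Qed.

(** Both densities carry the same jacobian factor, so the difference of their logarithms is a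
    function on [M]. *)
Lemma log_density_sub (mu nu : M -> R) c y : smooth_positive_measure mu ->
  smooth_positive_measure nu -> atlas c -> cimage c y ->
  log_density c nu y - log_density c mu y = ln (nu (cinv c y)) - ln (mu (cinv c y)).
Proof.
move=> [mu0 _] [nu0 _] ac cy; rewrite /log_density /denscoord.
have [aa da] := chart_atP (cinv c y).
have : 0 < `|\det (jac c (chart_at (cinv c y)) (cinv c y))|.
  by rewrite normr_gt0 -unitfE -unitmxE; exact: (jac_unit ac aa (dom_cinv ac cy) da).
move: `|_| => j j0; rewrite (lnM (nu0 _) j0) (lnM (mu0 _) j0).
by rewrite opprD addrACA subrr addr0.
Qed.

(** The density enters [ldiv] only through the derivative of its logarithm along the field;
    replacing it therefore adds the derivative of [ln (nu / mu)] along the rows of [P]. *)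
Lemma modvec_change (mu nu : M -> R) : smooth_positive_measure mu -> smooth_positive_measure nu ->
  exists2 h, smooth_fun h & forall al, one_form al -> forall p,
    pairing al (modvec P nu) p = pairing al (modvec P mu) p + dir (sharp P al) h p.
Proof.
move=> smu snu; pose h q := ln (nu q) - ln (mu q).
have sh : smooth_fun h.
  move=> c ac; have oc := open_cimage ac.
  apply: (smooth_on_eq oc (f := fun y => log_density c nu y - log_density c mu y)).
    by move=> y cy; exact: log_density_sub.
  apply: smooth_onD => //; first exact: smooth_log_density.
  by apply: smooth_onN => //; exact: smooth_log_density.
exists h => // al sal p; have [ac cp] := chart_atP p; have cy := cimage_cmap cp.
set c := chart_at p in ac cp cy; set y := cmap c p in cy.
have oc := open_cimage ac; have [_ /(_ c ac) sQ] := bP.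
have dn := smooth_differentiable (smooth_log_density snu ac) cy.
have dm := smooth_differentiable (smooth_log_density smu ac) cy.
have dE u : 'D_u (h \o cinv c) y = 'D_u (log_density c nu) y - 'D_u (log_density c mu) y.
  rewrite -deriveB; [|exact: diff_derivable|exact: diff_derivable].
  apply: near_eq_derive; apply: (open_near_eq oc cy) => z cz.
  by rewrite /= /h -(log_density_sub smu snu ac cz).
have dh : differentiable (h \o cinv c) y by exact: smooth_differentiable (sh _ ac) cy.
rewrite (dir_at _ _ sh) /sharp mulmx_sum_row deriveE // linear_sum.
rewrite /pairing !mxE -big_split /=; apply: eq_bigr => i _.
rewrite linearZ /= -deriveE // dE -[_ *: _]/(_ * _) -mulrDr; congr (_ * _).
rewrite !mxE /ldiv /prow bivcoord_at -/c -/y; move: (\tr _) ('D_(_) _ _) => t u.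
by ring.
Qed.

End ModularFields.

Theorem theorem4p4p1 (R : realType) (n : nat) (M : smoothManifold R n)
    (P : tensor2 M) (P_poisson : is_poisson P)
    (D1 D0 : form_operator (M := M)) (mu : M -> R)
    (D1_basic : basic_connection P D1)
    (D0_riemannian : riemannian_connection P D0)
    (mu_measure : smooth_positive_measure mu) :
  exists m1 md : set (rowfield M),
    [/\ first_secondary_class P D1 D0 m1,
        modular_class P mu md
      & m1 = H1_scale (2 * pi)^-1 md].
Proof.
have [bP _] := P_poisson.
have [cD0 [G [N [rG _ mN dN]]]] := D0_riemannian.
have cD1 := basic_contravariant D1_basic.
have snu := smooth_positive_volume rG; set nu := volume G in snu.
have sV := vector_field_modvec snu P_poisson; set V := modvec P nu in sV.
have a0 : (2 * pi)^-1 != 0 :> R by rewrite invr_eq0 mulf_neq0 ?pnatr_eq0 ?gt_eqF ?pi_gt0.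
have [h sh Vh] := modvec_change P_poisson mu_measure snu.
have cV := delta_closed_modvec snu P_poisson.
exists (H1_class P ((2 * pi)^-1 *: V)), (H1_class P (modvec P mu)); split.
- exists ((2 * pi)^-1 *: V); split; [|exact: delta_closed_scale|by []].
  split=> [|al sal x]; first exact: vector_field_scale.
  have [ac cx] := chart_atP x; have cy := cimage_cmap cx.
  have oc := open_cimage ac.
  have [chi cchi chi1] := cutoff_exists ac oc (fun z cz => cz) cy.
  (* Both connections satisfy the Leibniz rule for the same vector [# al], so the derivative terms
     of [leibniz_at] cancel in the difference. *)
  exists (christoffel x chi D1 al - christoffel x chi D0 al).
    move=> be sbe; rewrite -[LHS]/(D1 al be x - D0 al be x) mulmxBr.
    rewrite (leibniz_at cchi chi1 (leibniz_connection cD1 sal) sbe).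
    rewrite (leibniz_at cchi chi1 (leibniz_connection cD0 sal) sbe).
    by rewrite opprD addrACA subrr addr0.
  rewrite pairing_scale; congr (_ * _).
  (* The trace of [D1] is known for differentials only, so [al] is replaced by [df] with the same
     value at [x]; the formula for [D0] holds for [al] itself. *)
  have [f sf dfx] := function_with_differential cchi chi1 (al x).
  have sdf := one_form_dform sf.
  have chE D : contravariant_connection P D -> christoffel x chi D al = christoffel x chi D (dform f).
    move=> cD; apply/row_matrixP => i; rewrite !rowK.
    by apply: (tensorial_at cchi chi1 cD) => //; exact: (one_form_coframe cchi).
  rewrite raddfB /= (chE D1 cD1) (trace_basic_connection P_poisson D1_basic cchi chi1 sf).
  rewrite (trace_riemannian_connection bP rG mN dN cchi chi1 sal) opprK.
  (* The two traces have become [tr (D X_f)] and the derivative of the log-density along [X_f], the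
     two terms of the divergence of [X_f] for the riemannian density. *)
  have -> : pairing al V x = dir V f x by rewrite /dir /pairing dfx.
  rewrite (dir_modvec snu P_poisson sf).
  have dE := divergence_coord snu ac (vector_field_sharp bP sdf) cy.
  have {}dE : divergence nu (sharp P (dform f)) x =
      ldiv (log_density (chart_at x) nu) (vcoord (chart_at x) (sharp P (dform f)))
        (cmap (chart_at x) x) by rewrite -dE (cmapK ac cx).
  apply: (etrans dE); apply: (congr2 +%R).
    apply: (congr1 mxtrace); apply/matrixP => k i; rewrite !mxE.
    by apply: (partial_eq_on _ oc _ cy) => z cz; rewrite vcoord_ham.
  by rewrite vcoord_at /sharp dfx.
- by exists (modvec P mu); split; [exact: modular_field_modvec|exact: delta_closed_modvec|].
exact: (H1_class_scale a0 sh Vh).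
Qed.
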